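(* Let $N$ be a positive integer such that $L$ (the largest integer whose square divides $N$) is odd, and let $$g=\prod_{m\in\mathcal{D}_N}\prod_{h=0}^{\ell(m)-1}F_{m,h}^{\,a(m,h)}\quad\text{for some } a(m,h)\in\mathbf{Z}.$$ Then $g$ is a modular unit on $X_0(N)$ if and only if all the following hold. (1) The order of $g$ at the cusp $\infty$ is an integer. (2) The order of $g$ at the cusp $0$ is an integer. (3) The order of $g$ at the cusp $\binom{1}{N_0}$ is an integer, where $N_0$ is the odd part of $N$. (4) (mod $L$ condition) For any integer $1\le i\le N$ prime to $N$, $$\sum_{m\in\mathcal{D}_N^*}\psi_i(m)\sum_{h=1}^{\ell(m)-1}h\,a(m,h)\equiv0\pmod L,$$ where $$\psi_i(m)=\sum_{1\le\alpha\le m'',\ (\alpha,m'')=1}\delta\left\lfloor\frac{\alpha i}{m''}\right\rfloor\frac{L}{\ell(m)}.$$ (5) (mod $2$ condition) For every odd prime divisor $p$ of $N$, $$\sum_{m:\,m''=p^r}\ \sum_{h=0}^{\ell(m)-1}a(m,h)\equiv0\pmod2,$$ where the first sum runs over all $m\in\mathcal{D}_N$ such that $m''$ is a power of $p$.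
   Context: A modular unit on $X_0(N)$ is a modular function on $X_0(N)$ having zeros and poles only at cusps. Let $q=e^{2\pi i\tau}$, $\zeta_n=e^{2\pi i/n}$, $B_2(x)=x^2-x+1/6$. $\mathcal{D}_N$ is the set of positive divisors of $N$ different from $N$. For a positive divisor $m$ of $N$, $\ell(m)$ is the largest integer whose square divides $N/m$ (so $L=\ell(1)$); $m''=N/(m\ell(m))$, $N'=N/\ell(m)$ (depending on $m$); $\mathcal{D}_N^*=\{m\in\mathcal{D}_N:\ell(m)>1\}$. For an integer $\alpha$ prime to $m''$ with $1\le\alpha\le m''-1$, $\delta\in\{1,\dots,m''-1\}$ denotes the integer with $\alpha\delta\equiv1\pmod{m''}$ (so $\delta$ depends on $\alpha$ and $m''$; this is also the meaning of $\delta$ in $\psi_i(m)$). For integers $g,h$ not both $0$ modulo $N$ let $E_{g,h}(\tau)=q^{B_2(g/N)/2}\prod_{n\ge1}(1-\zeta_N^hq^{n-1+g/N})(1-\zeta_N^{-h}q^{n-g/N})$. Fix a set $S_{m''}\subset\{1,\dots,m''-1\}$ of representatives of $(\mathbf{Z}/m''\mathbf{Z})^\times/\{\pm1\}$. Then $F_{m,h}(\tau)=\prod_{\alpha\in S_{m''}}E_{\alpha m\ell(m),\,\delta hN'}(N'\tau)$ if $m''\neq2$, and $F_{m,h}(\tau)=E_{m\ell(m),\,hN'}(N'\tau)^{1/2}$ if $m''=2$. For a positive divisor $c$ of $N$ and an integer $a$ prime to $c$, $\binom{a}{c}$ denotes the cusp of $X_0(N)$ represented by $a/c$; $0=\binom11$,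 $\infty=\binom1N$. The order at $\binom ac$ of a product of functions $F_{m,h}$ is the leading exponent of $q$ in the expansion of $g\circ\gamma$, with $\gamma\in\mathrm{SL}_2(\mathbf{Z})$ and $\gamma\infty=a/c$, multiplied by the width $N/(c^2,N)$ of the cusp; it is additive on products, and for $F_{m,h}$ it equals $$\frac{\ell(m)(N',c)^2}{4(c^2,N)}\sum_{\alpha\in(\mathbf{Z}/m''\mathbf{Z})^\times}P_2\!\left(\frac{\alpha a'}{m''}+\frac{\delta hc'}{\ell(m)}\right),$$ where $P_2(x)=B_2(x-\lfloor x\rfloor)$, $a'=N'a/(N',c)$, $c'=c/(N',c)$. *)

(* Defs.v *)
From mathcomp Require Import all_boot all_order all_algebra.
From mathcomp Require Import complex.
From mathcomp Require Import all_classical all_reals all_analysis.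

Set Implicit Arguments.
Unset Strict Implicit.
Unset Printing Implicit Defensive.

Import Order.TTheory GRing.Theory Num.Theory numFieldNormedType.Exports.

Local Open Scope classical_set_scope.
Local Open Scope complex_scope.
Local Open Scope ring_scope.

Section Arithmetic.
Local Open Scope nat_scope.
Implicit Types N m i n : nat.

Definition proper_divisors N : seq nat := [seq m <- divisors N | m != N].

(* The largest d with d ^ 2 dividing N / m; for N > 0 such a d is at most N. *)
Definition ell N m : nat := \max_(d < N.+1 | d ^ 2 %| N %/ m) d.

(* m'' and N' ; both divisions are exact when m divides N > 0.
   If moreover m != N, then m'' >= 2. *)
Definition mpp N m : nat := N %/ (m * ell N m).
Definition Np N m : nat := N %/ ell N m.

(* For n > 1 and alpha prime to n, the delta in {1, ..., n - 1} such that
   alpha * delta = 1 mod n.  ('Z_n is the ring of integers mod n for n > 1.) *)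
Definition delta n (alpha : nat) : nat := ((alpha%:R : 'Z_n)^-1)%R.

(* S is a set of representatives of (Z/nZ)^* / {1, -1}. *)
Definition half_units n (S : {set 'I_n}) : Prop :=
  (forall s : 'I_n, s \in S -> coprime s n) /\
  (forall alpha : nat, coprime alpha n ->
     exists! s : 'I_n,
       s \in S /\ (s = alpha %[mod n] \/ s + alpha = 0 %[mod n])).

Definition psi N i m : nat :=
  \sum_(1 <= alpha < (mpp N m).+1 | coprime alpha (mpp N m))
    delta (mpp N m) alpha * (alpha * i %/ mpp N m) * (ell N 1 %/ ell N m).

End Arithmetic.

Section ModularFunctions.
Variable R : realType.
Implicit Types (f : R[i] -> R[i]) (tau z : R[i]) (e r x : R).
Implicit Types (gamma : 'M[int]_2) (N n : nat).

Definition upper_half : set R[i] := [set tau | 0 < complex.Im tau].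

Definition cexp z : R[i] :=
  (expR (complex.Re z))%:C * (cos (complex.Im z) +i* sin (complex.Im z)).

Definition e2pi z : R[i] := cexp ((0 +i* (2 * pi)) * z).

(* q ^ x for a real exponent x, where q = exp (2 pi i tau). *)
Definition qpow tau x : R[i] := e2pi (x%:C * tau).

(* R[i]^o is R[i] as a normed space over itself, so that derivable is complex
   differentiability. *)
Definition holomorphic_at f z : Prop :=
  \forall w \near (z : R[i]^o), derivable (f : R[i]^o -> R[i]^o) w 1.

Definition meromorphic_at f z : Prop :=
  exists (n : nat) (h : R[i] -> R[i]), holomorphic_at h z /\
    \forall w \near (z : R[i]^o)^', f w = h w / (w - z) ^+ n.

Definition mobius gamma tau : R[i] :=
  ((gamma 0 0)%:~R * tau + (gamma 0 1)%:~R) /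
  ((gamma 1 0)%:~R * tau + (gamma 1 1)%:~R).

Definition SL2Z gamma : Prop := \det gamma = 1.

Definition Gamma0 N gamma : Prop := SL2Z gamma /\ (N%:Z %| gamma 1%R 0%R)%Z.

(* f(tau) is the sum over k >= 0 of c_k q ^ (e + k / n) for Im tau large. *)
Definition q_expansion f e n (c : nat -> R[i]) : Prop :=
  (0 < n)%N /\
  exists y : R, forall tau, y < complex.Im tau ->
    series (fun k => c k * qpow tau (e + k%:R / n%:R) : R[i]^o) @ \oo
      --> (f tau : R[i]^o).

Definition meromorphic_at_infty f : Prop :=
  exists (k0 : int) (n : nat) (c : nat -> R[i]),
    q_expansion f (k0%:~R / n%:R) n c.

Definition leading_exponent f e : Prop :=
  exists (n : nat) (c : nat -> R[i]), c 0%N != 0 /\ q_expansion f e n c.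

(* A meromorphic function on the upper half plane is represented by a total
   function, with a value at its poles that is constant on Gamma0 N-orbits. *)
Definition modular_function N f : Prop :=
  [/\ forall tau, upper_half tau -> meromorphic_at f tau,
      forall gamma tau, Gamma0 N gamma -> upper_half tau ->
        f (mobius gamma tau) = f tau
    & forall gamma, SL2Z gamma ->
        meromorphic_at_infty (fun tau => f (mobius gamma tau))].

(* No pole and no zero on the upper half plane. *)
Definition modular_unit N f : Prop :=
  modular_function N f /\
  forall tau, upper_half tau -> holomorphic_at f tau /\ f tau != 0.

(* r is the order of f at the cusp a / c of X_0(N), for c a positive divisor
   of N and a prime to c: the leading exponent of f o gamma, where
   gamma oo = a / c, multiplied by the width of the cusp. *)
Definition cusp_order N f (a : int) (c : nat) r : Prop :=
  exists (gamma : 'M[int]_2) (e : R),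
    [/\ SL2Z gamma, gamma 0 0 * c%:Z = a * gamma 1 0,
        leading_exponent (fun tau => f (mobius gamma tau)) e
      & r = e * (N %/ gcdn (c ^ 2) N)%N%:R].

Definition integral_cusp_order N f a c : Prop :=
  exists k : int, cusp_order N f a c k%:~R.

Definition B2 x : R := x ^+ 2 - x + 6%:R^-1.

Definition zeta_pow N (h : int) : R[i] := e2pi (h%:~R / N%:R).

Definition E N (g h : int) tau : R[i] :=
  let x : R := g%:~R / N%:R in
  qpow tau (B2 x / 2) *
  lim ((fun k : nat => \prod_(1 <= n < k)
    ((1 - zeta_pow N h * qpow tau (n%:R - 1 + x)) *
     (1 - zeta_pow N (- h) * qpow tau (n%:R - x))) : R[i]^o) @ \oo).

(* f is F_{m,h} on the upper half plane.  For m'' = 2 the exponent 1/2 denotes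
   a holomorphic branch of the square root, which is unique up to sign. *)
Definition is_F (S : forall n, {set 'I_n}) N (m h : nat) f : Prop :=
  if mpp N m == 2%N then
    forall tau, upper_half tau ->
      holomorphic_at f tau /\
      f tau ^+ 2 =
        E N (m * ell N m)%N%:Z (h * Np N m)%N%:Z ((Np N m)%:R * tau)
  else
    forall tau, upper_half tau ->
      f tau = \prod_(alpha in S (mpp N m))
        E N (alpha * m * ell N m)%N%:Z
            (delta (mpp N m) alpha * h * Np N m)%N%:Z
            ((Np N m)%:R * tau).

End ModularFunctions.

(* Main.v *)
From HB Require Import structures.
Require Import Defs.
From mathcomp Require Import all_boot all_order all_algebra.
From mathcomp Require Import complex.
From mathcomp Require Import all_classical all_reals all_analysis.
From mathcomp Require Import ring lra zify.
From mathcomp Require finfield.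

(** Write M = m'', l = ell N m, and e(x) = exp (2 i pi x).  Each F_{m,h} is a product
    over the units alpha modulo M, taken up to sign, of Siegel products with characteristics
    (alpha / M, delta h / l), taken at N' tau; when M = 2 it is, up to sign, Weber's
    function f_1 (N tau).

    The modular group permutes the Siegel products up to roots of unity.  For S = (0 -1; 1 0) this is
    proved by the uniqueness of the theta product among entire functions with its
    quasi-periods (theta_unique, through the theorem of Liouville), which leaves an
    unknown constant; the product of the three values at the 2-torsion characteristics
    shows that it is a root of unity independent of tau, and tau = i gives its value
    (sieg_S).  Since S and T = (1 1; 0 1) generate SL2(Z), the general multiplier is that of eta ^ 2
    times an explicit phase (sieg_mob); its classes modulo 3 and 4 are given by closed
    formulas that are verified on generators by finite computation.  Consequently g has
    no zero or pole on the upper half-plane, it has a q-expansion at every cusp, and for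
    every matrix of Gamma_0(N) it is an eigenfunction, with an eigenvalue given by a
    character chi.  It is a modular unit if and only if chi is trivial.

    The order of g at the cusp 1 / c is an integer if and only if chi is 1 on a generator
    of the stabilizer of 1 / c in Gamma_0(N) (integral_cusp).  For the cusps infinity and
    0 these generators are conjugate to T and to the inverse of
    U = (1 0; N 1).  So the conditions at infinity and 0 say that chi is 1 on T and U, and
    all the cusp conditions are necessary.

    Multiplying by powers of T and U brings a matrix of Gamma_0(N) to the shape
    (a b; c d) with b and c divisible by 24 N and a = 1 mod 8 (inv_all).  This uses that
    N is not divisible by 4, which is how the hypothesis that L is odd enters at the
    prime 2.  On such matrices chi = e(T / 2 - Y / L) for integers T and Y that are sums of
    the quotients of a alpha by M (theta_total), and L is odd, so chi is 1 exactly when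
    T is even and L divides Y.

    The sign is governed by the lemma of Gauss.  The contribution of m to T is even
    unless M is a power of an odd prime p modulo which a is not a square (quo_even,
    quo_odd).  Choosing a to be a nonsquare modulo a single p shows that T is always even
    if and only if the condition modulo 2 holds.  As for Y, the units pair up as s and
    M - s, and this turns 2 Y into d times the sum of the condition modulo L with i = a
    (half_sum_psi, Ytot_psi).  Every class of units modulo N contains a number that is
    1 modulo 8 (class_lift), so L always divides Y if and only if that condition holds
    for all i. *)

Set Implicit Arguments.
Unset Strict Implicit.
Unset Printing Implicit Defensive.

Import Order.TTheory GRing.Theory Num.Theory numFieldNormedType.Exports.

Local Open Scope complex_scope.
Local Open Scope ring_scope.

(** * Complex numbers and limits *)
Section ComplexAnalysis.
Variable R : realType.
Implicit Types (z w h l : R[i]) (u v : nat -> R[i]).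

Notation nc := (@ComplexField.Normc.normc R).
Arguments ComplexField.Normc.normc : simpl never.

Lemma ncE z : `|z| = (nc z)%:C.
Proof. by []. Qed.

Lemma nc_ge0 z : 0 <= nc z.
Proof. by rewrite -ler0c -ncE. Qed.

Lemma ncM z w : nc (z * w) = nc z * nc w.
Proof. exact: ComplexField.Normc.normcM. Qed.

Lemma ncV z : nc z^-1 = (nc z)^-1.
Proof. exact: ComplexField.Normc.normcV. Qed.

Lemma nc0 : nc 0 = 0.
Proof. exact: ComplexField.Normc.normc0. Qed.

Lemma nc1 : nc 1 = 1.
Proof. exact: ComplexField.Normc.normc1. Qed.

Lemma ncN z : nc (- z) = nc z.
Proof. exact: normcN. Qed.

Lemma ncD z w : nc (z + w) <= nc z + nc w.
Proof. exact: le_normcD. Qed.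

Lemma ncX z n : nc (z ^+ n) = nc z ^+ n.
Proof. by elim: n => [|n IH]; rewrite ?expr0 ?nc1 // !exprS ncM IH. Qed.

Lemma nc_dist z w : nc (z - w) = nc (w - z).
Proof. by rewrite -ncN opprB. Qed.

Lemma nc_eq0 z : (nc z == 0) = (z == 0).
Proof.
apply/eqP/eqP => [|->]; last exact: nc0.
exact: ComplexField.Normc.eq0_normc.
Qed.

Lemma nc_gt0 z : (0 < nc z) = (z != 0).
Proof. by rewrite lt_def nc_eq0 nc_ge0 andbT. Qed.

Lemma ncR (r : R) : nc r%:C = `|r|.
Proof. by rewrite /ComplexField.Normc.normc /= expr0n addr0 sqrtr_sqr. Qed.

Lemma nc_nat n : nc n%:R = n%:R.
Proof. by rewrite -(rmorph_nat (real_complex R)) ncR normr_nat. Qed.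

Lemma Re_le_nc z : `|complex.Re z| <= nc z.
Proof. by have := normc_ge_Re z; rewrite ncE lecR. Qed.

Lemma Im_le_nc z : `|complex.Im z| <= nc z.
Proof.
case: z => a b; rewrite /ComplexField.Normc.normc /= -[leLHS]sqrtr_sqr.
by rewrite ler_wsqrtr // lerDr sqr_ge0.
Qed.

Lemma nc_le_ReIm z : nc z <= `|complex.Re z| + `|complex.Im z|.
Proof.
have := ncD (complex.Re z)%:C ('i * (complex.Im z)%:C).
rewrite -complexE ncM !ncR; congr (_ <= _ + _).
by rewrite /ComplexField.Normc.normc /= expr0n expr1n add0r sqrtr1 mul1r.
Qed.

Lemma nc_sum (I : Type) (r : seq I) (F : I -> R[i]) :
  nc (\sum_(k <- r) F k) <= \sum_(k <- r) nc (F k).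
Proof.
elim: r => [|k r IH]; first by rewrite !big_nil nc0.
by rewrite !big_cons; apply: le_trans (ncD _ _) _; rewrite lerD2l.
Qed.

Lemma ReD z w : complex.Re (z + w) = complex.Re z + complex.Re w.
Proof. by case: z; case: w. Qed.

Lemma ImD z w : complex.Im (z + w) = complex.Im z + complex.Im w.
Proof. by case: z; case: w. Qed.

Lemma ReN z : complex.Re (- z) = - complex.Re z.
Proof. by case: z. Qed.

Lemma ImN z : complex.Im (- z) = - complex.Im z.
Proof. by case: z. Qed.

Lemma complex_eq z w :
  complex.Re z = complex.Re w -> complex.Im z = complex.Im w -> z = w.
Proof. by case: z; case: w => a b c d /= -> ->. Qed.

(** The filter limits take place in R[i]^o; cvgC is the same notion with the real
    modulus nc, so that estimates stay inside the ordered field R. *)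
Definition cvgC u l : Prop := forall e : R, 0 < e ->
  exists n0, forall n, (n0 <= n)%N -> nc (u n - l) < e.

Lemma gtr0_real (e : R[i]) : 0 < e -> exists2 r : R, 0 < r & e = r%:C.
Proof.
by case: e => a b; rewrite ltcE /= => /andP[/eqP -> a0]; exists a.
Qed.

Lemma cvgCP u l :
  cvgC u l <-> ((u : nat -> R[i]^o) @ \oo --> (l : R[i]^o))%classic.
Proof.
split.
  move=> H; apply/cvgrPdist_lt => /= _ /gtr0_real[r r0 ->].
  have [n0 Hn] := H _ r0.
  by exists n0 => // n /= nn; rewrite distrC ncE ltcR; apply: Hn.
move/cvgrPdist_lt => H e e0.
have : 0 < e%:C :> R[i] by rewrite ltcR.
move/H => [n0 _ Hn]; exists n0 => n nn.
by have := Hn n nn; rewrite distrC ncE ltcR.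
Qed.

Lemma nearCP z (P : R[i] -> Prop) :
  (\forall w \near (z : R[i]^o), P w) <->
  exists2 r : R, 0 < r & forall w, nc (w - z) < r -> P w.
Proof.
split.
  move/nbhs_ballP => [e /= /gtr0_real[r r0 ->] H].
  by exists r => // w Hw; apply: H; rewrite /ball /= distrC ncE ltcR.
move=> [r r0 H]; apply/nbhs_ballP; exists r%:C => /=; first by rewrite ltcR.
by move=> w; rewrite /ball /= distrC ncE ltcR; apply: H.
Qed.

Lemma cvgC_unique u l w : cvgC u l -> cvgC u w -> l = w.
Proof.
move=> Hl Hw; apply/eqP; rewrite -subr_eq0 -nc_eq0.
apply/negPn/negP => lw.
have e0 : 0 < nc (l - w) / 2.
  by rewrite divr_gt0 // lt_def lw nc_ge0.
have [n1 H1] := Hl _ e0; have [n2 H2] := Hw _ e0.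
have := H1 (maxn n1 n2) (leq_maxl _ _); have := H2 (maxn n1 n2) (leq_maxr _ _).
set x := u _ => Hx Hy.
have := ncD (l - x) (x - w); rewrite addrA subrK (nc_dist l); lra.
Qed.

Lemma cvgC_eventually u v l n0 :
  (forall n, (n0 <= n)%N -> u n = v n) -> cvgC u l -> cvgC v l.
Proof.
move=> uv H e /H[n1 H1]; exists (maxn n0 n1) => n.
by rewrite geq_max => /andP[/uv <- /H1].
Qed.

Lemma cvgC_cst l : cvgC (fun=> l) l.
Proof. by move=> e e0; exists 0%N => n _; rewrite subrr nc0. Qed.

Lemma cvgCD u v l w : cvgC u l -> cvgC v w -> cvgC (fun n => u n + v n) (l + w).
Proof.
move=> Hl Hw e e0; have e2 : 0 < e / 2 by lra.
have [n1 H1] := Hl _ e2; have [n2 H2] := Hw _ e2.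
exists (maxn n1 n2) => n; rewrite geq_max => /andP[/H1 h1 /H2 h2].
have := ncD (u n - l) (v n - w).
by rewrite (_ : u n - l + _ = u n + v n - (l + w)) => [|]; [lra|ring].
Qed.

Lemma cvgC_bounded u l : cvgC u l ->
  exists K n0, 0 < K /\ forall n, (n0 <= n)%N -> nc (u n) <= K.
Proof.
move=> /(_ 1 ltr01)[n0 H]; exists (nc l + 1), n0; split.
  by have := nc_ge0 l; lra.
move=> n /H Hn; have := ncD (u n - l) l; rewrite subrK; lra.
Qed.

Lemma cvgCM u v l w : cvgC u l -> cvgC v w -> cvgC (fun n => u n * v n) (l * w).
Proof.
move=> Hl Hw e e0.
have [K [n0 [K0 HK]]] := cvgC_bounded Hl.
have e1 : 0 < e / 2 / K by rewrite !divr_gt0.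
have W0 : 0 < nc w + 1 by have := nc_ge0 w; lra.
have e2 : 0 < e / 2 / (nc w + 1) by rewrite !divr_gt0.
have [n1 H1] := Hl _ e2; have [n2 H2] := Hw _ e1.
exists (maxn n0 (maxn n1 n2)) => n; rewrite !geq_max => /and3P[/HK hK /H1 h1 /H2 h2].
have := ncD (u n * (v n - w)) ((u n - l) * w).
rewrite (_ : _ + _ * w = u n * v n - l * w); last by ring.
rewrite !ncM => Hle; apply: le_lt_trans Hle _.
have A1 : nc (u n) * nc (v n - w) <= e / 2.
  apply: le_trans (ler_pM (nc_ge0 _) (nc_ge0 _) hK (ltW h2)) _.
  by rewrite mulrC divfK ?gt_eqF.
have A2 : nc (u n - l) * nc w < e / 2.
  apply: (@le_lt_trans _ _ (nc (u n - l) * (nc w + 1))).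
    by apply: (ler_wpM2l (nc_ge0 _)); lra.
  by rewrite -ltr_pdivlMr.
lra.
Qed.

Lemma cvgC_le u l K n0 :
  (forall n, (n0 <= n)%N -> nc (u n) <= K) -> cvgC u l -> nc l <= K.
Proof.
move=> uK H; rewrite leNgt; apply/negP => Kl.
have e0 : 0 < nc l - K by lra.
have [n1 H1] := H _ e0.
have := H1 (maxn n0 n1) (leq_maxr _ _); have := uK (maxn n0 n1) (leq_maxl _ _).
set x := u _ => ? ?; have := ncD x (l - x); rewrite addrC subrK (nc_dist l); lra.
Qed.

Lemma cvgC_sub u l (f : nat -> nat) :
  (forall n, (n <= f n)%N) -> cvgC u l -> cvgC (fun n => u (f n)) l.
Proof.
move=> fn H e /H[n0 Hn]; exists n0 => n nn; apply: Hn.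
exact: leq_trans (fn n).
Qed.

(** * Geometrically dominated series *)

Definition psums u n : R[i] := \sum_(k < n) u k.
Definition csum u : R[i] := (lim ((psums u : nat -> R[i]^o) @ \oo))%classic.
(** Every series below converges geometrically; keeping the majorant explicit makes
    tails, products and remainders immediate to estimate. *)
Definition gdom u (B t : R) : Prop :=
  [/\ 0 <= B, 0 <= t < 1 & forall k, nc (u k) <= B * t ^+ k].

Lemma gdom_cvg u B t : gdom u B t -> exists l, cvgC (psums u) l.
Proof.
move=> [B0 /andP[t0 t1] H].
have key (v : nat -> R) : (forall k, `|v k| <= B * t ^+ k) ->
    exists l : R, ((series v) @ \oo --> l)%classic.
  move=> Hv; exists (lim (series v @ \oo)%classic).
  apply: normed_cvg; apply: (@series_le_cvg _ _ (geometric B t)).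
  - by move=> n /=; exact: normr_ge0.
  - by move=> n /=; rewrite mulr_ge0 ?exprn_ge0.
  - by move=> n; exact: Hv.
  - by apply: is_cvg_geometric_series; rewrite ger0_norm.
have [a Ha] : exists l : R,
    ((series (fun k => complex.Re (u k))) @ \oo --> l)%classic.
  by apply: key => k; apply: le_trans (Re_le_nc _) (H k).
have [b Hb] : exists l : R,
    ((series (fun k => complex.Im (u k))) @ \oo --> l)%classic.
  by apply: key => k; apply: le_trans (Im_le_nc _) (H k).
exists (a +i* b) => e e0; have e2 : 0 < e / 2 by lra.
move/cvgrPdist_lt: Ha => /(_ _ e2)[n1 _ H1].
move/cvgrPdist_lt: Hb => /(_ _ e2)[n2 _ H2].
have RS n : complex.Re (psums u n) = series (fun k => complex.Re (u k)) n.
  rewrite /psums /series /= big_mkord.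
  by elim: n => [|n IH]; rewrite ?big_ord0 // !big_ord_recr /= -IH ReD.
have IS n : complex.Im (psums u n) = series (fun k => complex.Im (u k)) n.
  rewrite /psums /series /= big_mkord.
  by elim: n => [|n IH]; rewrite ?big_ord0 // !big_ord_recr /= -IH ImD.
exists (maxn n1 n2) => n; rewrite geq_max => /andP[/H1 /= h1 /H2 /= h2].
apply: le_lt_trans (nc_le_ReIm _) _.
rewrite ReD ImD ReN ImN /= RS IS distrC (distrC _ b); lra.
Qed.

Lemma csum_eq u l : cvgC (psums u) l -> csum u = l.
Proof. by move=> /cvgCP Hl; apply: (cvg_lim (@norm_hausdorff _ _) Hl). Qed.

Lemma csumP u B t : gdom u B t -> cvgC (psums u) (csum u).
Proof.
move=> /gdom_cvg[l Hl]; by rewrite (csum_eq Hl).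
Qed.

Lemma geo_sum_le (B t : R) m n : 0 <= B -> 0 <= t < 1 ->
  \sum_(k < n) B * t ^+ (m + k) <= B * t ^+ m / (1 - t).
Proof.
move=> B0 /andP[t0 t1]; have t1' : 0 < 1 - t by lra.
rewrite ler_pdivlMr //.
suff -> : (\sum_(k < n) B * t ^+ (m + k)) * (1 - t) =
    B * t ^+ m - B * t ^+ (m + n).
  by rewrite lerBlDr lerDl mulr_ge0 ?exprn_ge0.
elim: n => [|n IH]; first by rewrite big_ord0 addn0; ring.
by rewrite big_ord_recr /= mulrDl IH addnS exprS; ring.
Qed.

Lemma psums_tail u B t m n : gdom u B t -> (m <= n)%N ->
  nc (psums u n - psums u m) <= B * t ^+ m / (1 - t).
Proof.
move=> [B0 t01 H] mn; rewrite -(subnKC mn).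
have -> : psums u (m + (n - m)) - psums u m = \sum_(k < n - m) u (m + k)%N.
  by rewrite /psums big_split_ord /= addrAC subrr add0r.
apply: le_trans (nc_sum _ _) _.
apply: le_trans _ (geo_sum_le m (n - m) B0 t01).
by apply: ler_sum => k _; exact: H.
Qed.

Lemma csum_tail u B t m : gdom u B t ->
  nc (csum u - psums u m) <= B * t ^+ m / (1 - t).
Proof.
move=> G; have := csumP G => H.
apply: (@cvgC_le (fun n => psums u n - psums u m) _ _ m).
  by move=> n; exact: psums_tail.
by apply: cvgCD H (cvgC_cst _).
Qed.

Lemma csum_bound u B t : gdom u B t -> nc (csum u) <= B / (1 - t).
Proof.
by move=> /(@csum_tail _ _ _ 0); rewrite /psums big_ord0 subr0 expr0 mulr1.
Qed.

Lemma cvgC_csumD u v l w : cvgC (psums u) l -> cvgC (psums v) w ->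
  cvgC (psums (fun k => u k + v k)) (l + w).
Proof.
move=> Hu Hv; apply: (@cvgC_eventually _ _ _ 0) (cvgCD Hu Hv) => n _.
by rewrite /psums big_split.
Qed.

Lemma cvgC_csumZ u l a : cvgC (psums u) l ->
  cvgC (psums (fun k => a * u k)) (a * l).
Proof.
move=> Hu; apply: (@cvgC_eventually _ _ _ 0) (cvgCM (cvgC_cst a) Hu) => n _.
by rewrite /psums mulr_sumr.
Qed.

(** * Second-order expansions *)

Definition bigO n (r : R[i] -> R[i]) : Prop := exists K d : R,
  [/\ 0 <= K, 0 < d & forall h, nc h < d -> nc (r h) <= K * nc h ^+ n].

Lemma bigO_ext n (r s : R[i] -> R[i]) : r =1 s -> bigO n r -> bigO n s.
Proof. by move=> rs [K [d [K0 d0 H]]]; exists K, d; split=> // h; rewrite -rs; exact: H. Qed.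

Lemma bigOD n r s : bigO n r -> bigO n s -> bigO n (fun h => r h + s h).
Proof.
move=> [K [d [K0 d0 H]]] [K' [d' [K'0 d'0 H']]].
exists (K + K'), (Num.min d d'); split; [lra| by rewrite lt_min d0 |].
move=> h; rewrite lt_min => /andP[/H h1 /H' h2].
by apply: le_trans (ncD _ _) _; rewrite mulrDl; exact: lerD.
Qed.

Lemma bigOM n m r s : bigO n r -> bigO m s -> bigO (n + m) (fun h => r h * s h).
Proof.
move=> [K [d [K0 d0 H]]] [K' [d' [K'0 d'0 H']]].
exists (K * K'), (Num.min d d'); split; [exact: mulr_ge0| by rewrite lt_min d0 |].
move=> h; rewrite lt_min => /andP[/H h1 /H' h2].
by rewrite ncM exprD mulrACA; apply: ler_pM; rewrite ?nc_ge0.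
Qed.

Lemma bigO_weak n m r : (n <= m)%N -> bigO m r -> bigO n r.
Proof.
move=> nm [K [d [K0 d0 H]]]; exists K, (Num.min d 1).
split=> //; first by rewrite lt_min d0 ltr01.
move=> h; rewrite lt_min => /andP[/H h1 /ltW h2]; apply: le_trans h1 _.
by apply: ler_wpM2l => //; apply: ler_wiXn2l => //; exact: nc_ge0.
Qed.

Lemma bigO_cst a : bigO 0 (fun=> a).
Proof. by exists (nc a), 1; split=> [||h _]; rewrite ?nc_ge0 // expr0 mulr1. Qed.

Lemma bigO_mono a n : bigO n (fun h => a * h ^+ n).
Proof.
by exists (nc a), 1; split=> [||h _]; rewrite ?nc_ge0 // ncM ncX.
Qed.

Lemma bigO_comp n r s : bigO n r -> bigO 1 s -> bigO n (fun h => r (s h)).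
Proof.
move=> [K [d [K0 d0 H]]] [K' [d' [K'0 d'0 H']]].
have K1 : 0 < K' + 1 by lra.
exists (K * (K' + 1) ^+ n), (Num.min d' (d / (K' + 1))).
split; first by rewrite mulr_ge0 // exprn_ge0 // ltW.
  by rewrite lt_min d'0 divr_gt0.
move=> h; rewrite lt_min => /andP[/H' h1]; rewrite ltr_pdivlMr // => h2.
have h0 := nc_ge0 h.
have h3 : nc (s h) <= (K' + 1) * nc h.
  by apply: le_trans h1 _; rewrite expr1; nra.
apply: le_trans (H _ _) _; first by apply: le_lt_trans h3 _; rewrite mulrC.
rewrite -mulrA -exprMn; apply: ler_wpM2l => //.
by rewrite lerXn2r // nnegrE ?nc_ge0 // mulr_ge0 // ltW.
Qed.

(** Having an expansion to second order, with a cubic remainder, stands in for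
    holomorphy.  It is stable under sums, products, composition and inverses, it
    gives complex differentiability, and it bounds the discrete Laplacian on small
    crosses, which is what the maximum principle needs. *)
Definition jet2 (f : R[i] -> R[i]) z : Prop := exists A B,
  bigO 3 (fun h => f (z + h) - (f z + A * h + B * h ^+ 2)).

Lemma jet2_ext f g z (d : R) : 0 < d ->
  (forall w, nc (w - z) < d -> f w = g w) -> jet2 f z -> jet2 g z.
Proof.
move=> d0 fg [A [B [K [e [K0 e0 H]]]]]; exists A, B, K, (Num.min e d).
split=> //; first by rewrite lt_min e0.
move=> h; rewrite lt_min => /andP[/H h1 h2].
by rewrite -!fg // ?subrr ?nc0 // addrC addKr.
Qed.

Lemma jet2_cst a z : jet2 (fun=> a) z.
Proof.
exists 0, 0; apply: bigO_ext (bigO_mono 0 3) => h; by ring.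
Qed.

Lemma jet2_id z : jet2 id z.
Proof.
by exists 1, 0; apply: bigO_ext (bigO_mono 0 3) => h; ring.
Qed.

Lemma jet2D f g z : jet2 f z -> jet2 g z -> jet2 (fun w => f w + g w) z.
Proof.
move=> [A [B Hf]] [A' [B' Hg]]; exists (A + A'), (B + B').
by apply: bigO_ext (bigOD Hf Hg) => h /=; ring.
Qed.

Lemma jet2_O1 f z A B :
  bigO 3 (fun h => f (z + h) - (f z + A * h + B * h ^+ 2)) ->
  bigO 1 (fun h => f (z + h) - f z).
Proof.
move=> H; have := bigOD (bigO_weak (n := 1) (m := 3) isT H)
  (bigOD (bigO_mono A 1) (bigO_weak (n := 1) (m := 2) isT (bigO_mono B 2))).
by apply: bigO_ext => h /=; ring.
Qed.

Lemma jet2M f g z : jet2 f z -> jet2 g z -> jet2 (fun w => f w * g w) z.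
Proof.
move=> [A [B Hf]] [A' [B' Hg]].
exists (A * g z + f z * A'), (B * g z + A * A' + f z * B').
have Hg0 : bigO 0 (fun h => g (z + h)).
  have := bigOD (bigO_weak (n := 0) isT (jet2_O1 Hg)) (bigO_cst (g z)).
  by apply: bigO_ext => h /=; ring.
have Hp : bigO 0 (fun h => f z + A * h + B * h ^+ 2).
  have := bigOD (bigO_cst (f z)) (bigOD (bigO_weak (n := 0) isT (bigO_mono A 1))
    (bigO_weak (n := 0) isT (bigO_mono B 2))).
  by apply: bigO_ext => h /=; ring.
have := bigOD (bigOM Hf Hg0) (bigOD (bigOM Hp Hg)
  (bigOD (bigO_mono (A * B' + B * A') 3)
     (bigO_weak (n := 3) (m := 4) isT (bigO_mono (B * B') 4)))).
by apply: bigO_ext => h /=; ring.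
Qed.

Lemma jet2_comp f g z : jet2 f z -> jet2 g (f z) -> jet2 (fun w => g (f w)) z.
Proof.
move=> [A [B Hf]] [A' [B' Hg]].
exists (A' * A), (A' * B + B' * A ^+ 2).
have H1 := jet2_O1 Hf.
have Hr := bigO_comp Hg H1.
have Hp : bigO 1 (fun h => A * h + B * h ^+ 2).
  have := bigOD (bigO_mono A 1) (bigO_weak (n := 1) (m := 2) isT (bigO_mono B 2)).
  by apply: bigO_ext => h /=; ring.
have H2 : bigO 3 (fun h => (f (z + h) - (f z + A * h + B * h ^+ 2)) *
    ((f (z + h) - f z) + (A * h + B * h ^+ 2))).
  by apply: (bigO_weak (m := 4)) (bigOM Hf (bigOD H1 Hp)).
have H3 := bigOM (bigO_cst B') H2.
have := bigOD Hr (bigOD (bigOM (bigO_cst A') Hf) (bigOD H3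
  (bigOD (bigO_mono (B' * 2%:R * A * B) 3)
     (bigO_weak (n := 3) (m := 4) isT (bigO_mono (B' * B ^+ 2) 4))))).
apply: bigO_ext => h /=.
rewrite (_ : f z + (f (z + h) - f z) = f (z + h)); last by ring.
by ring.
Qed.

Lemma jet2_inv z : z != 0 -> jet2 (fun w => w^-1) z.
Proof.
move=> z0; have nz : 0 < nc z by rewrite nc_gt0.
exists (- z^-1 ^+ 2), (z^-1 ^+ 3).
exists (2 / nc z ^+ 4), (nc z / 2); split; [|lra|].
  by rewrite divr_ge0 // exprn_ge0 // ltW.
move=> h hz.
have zh : nc z / 2 <= nc (z + h).
  by have := ncD (z + h) (- h); rewrite addrK ncN; lra.
have zh0 : z + h != 0 by rewrite -nc_gt0; lra.
have -> : (z + h)^-1 - (z^-1 + - z^-1 ^+ 2 * h + z^-1 ^+ 3 * h ^+ 2) =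
    h ^+ 3 * - ((z ^+ 3)^-1 * (z + h)^-1) by field; rewrite zh0.
rewrite !(ncM, ncV, ncN, ncX) mulrC; apply: ler_wpM2r.
  by rewrite exprn_ge0 // nc_ge0.
rewrite (_ : 2 / nc z ^+ 4 = (nc z ^+ 3)^-1 * (nc z / 2)^-1); last by field; rewrite gt_eqF.
apply: ler_wpM2l; first by rewrite invr_ge0 exprn_ge0 // nc_ge0.
by rewrite lef_pV2 // posrE; lra.
Qed.

Lemma jet2V f z : f z != 0 -> jet2 f z -> jet2 (fun w => (f w)^-1) z.
Proof. by move=> f0 Hf; apply: (jet2_comp Hf (jet2_inv f0)). Qed.

Definition contC (f : R[i] -> R[i]) z : Prop := forall e : R, 0 < e ->
  exists2 d : R, 0 < d & forall w, nc (w - z) < d -> nc (f w - f z) < e.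

Lemma jet2_cont f z : jet2 f z -> contC f z.
Proof.
move=> [A [B /jet2_O1[K [d [K0 d0 H]]]]] e e0.
have K1 : 0 < K + 1 by lra.
exists (Num.min d (e / (K + 1))); first by rewrite lt_min d0 divr_gt0.
move=> w; rewrite lt_min => /andP[/H]; rewrite subrKC expr1 => h1.
rewrite ltr_pdivlMr // => h2; apply: le_lt_trans h1 _.
by have := nc_ge0 (w - z); nra.
Qed.

Lemma jet2_derivable f z : jet2 f z ->
  derivable (f : R[i]^o -> R[i]^o) z 1.
Proof.
move=> [A [B H]].
have [K [d [K0 d0 HK]]] : bigO 2 (fun h => f (z + h) - (f z + A * h)).
  have := bigOD (bigO_weak (n := 2) (m := 3) isT H) (bigO_mono B 2).
  by apply: bigO_ext => h /=; ring.
apply/cvg_ex; exists (A : R[i]^o).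
apply/cvgrPdist_lt => /= _ /gtr0_real[r r0 ->].
have K1 : 0 < K + 1 by lra.
apply/nbhs_ballP; exists (Num.min d (r / (K + 1)))%:C => /=.
  by rewrite ltcR lt_min d0 divr_gt0.
move=> h; rewrite /ball /= sub0r normrN ncE ltcR lt_min => /andP[hd hr] h0.
rewrite distrC ncE ltcR /GRing.scale /= mulr1 (addrC h z).
have -> : h^-1 * (f (z + h) - f z) - A = h^-1 * (f (z + h) - (f z + A * h)).
  by field.
have h0' : 0 < nc h by rewrite nc_gt0.
rewrite ncM ncV mulrC ltr_pdivrMr //; apply: le_lt_trans (HK _ hd) _.
move: hr; rewrite ltr_pdivlMr // => hr; rewrite expr2; nra.
Qed.

Lemma jet2_holomorphic f z (d : R) : 0 < d ->
  (forall w, nc (w - z) < d -> jet2 f w) -> holomorphic_at f z.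
Proof.
by move=> d0 H; apply/nearCP; exists d => // w /H; exact: jet2_derivable.
Qed.

(** * Power series *)

Definition pser (c : nat -> R[i]) z : R[i] := csum (fun k => c k * z ^+ k).
Definition psbound (c : nat -> R[i]) (r : R) : Prop :=
  exists2 B : R, 0 <= B & forall k, nc (c k) * r ^+ k <= B.

Lemma psbound_gdom c (r t : R) : 0 < r -> 0 <= t < r -> psbound c r ->
  exists2 B : R, 0 <= B &
  forall K u, 0 <= K -> (forall k, nc (u k) <= K * t ^+ k) ->
    gdom (fun k => c k * u k) (B * K) (t / r).
Proof.
move=> r0 /andP[t0 tr] [B B0 H]; exists B => // K u K0 Hu; split.
- exact: mulr_ge0.
- by rewrite divr_ge0 ?(ltW r0) //= ltr_pdivrMr // mul1r.
move=> k; rewrite ncM expr_div_n.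
apply: le_trans (ler_wpM2l (nc_ge0 _) (Hu k)) _.
rewrite (_ : nc (c k) * _ = (nc (c k) * r ^+ k) * (K * t ^+ k / r ^+ k)).
  rewrite -(mulrA B) (mulrA K); apply: ler_wpM2r => //.
  by rewrite !mulr_ge0 ?invr_ge0 ?exprn_ge0 // ltW.
by field; rewrite expf_neq0 // gt_eqF.
Qed.

Lemma pserP c (r : R) z : 0 < r -> nc z < r -> psbound c r ->
  cvgC (psums (fun k => c k * z ^+ k)) (pser c z).
Proof.
move=> r0 zr /(@psbound_gdom _ r (nc z) r0); rewrite nc_ge0 zr.
move=> /(_ isT)[B B0 H]; apply: (@csumP _ (B * 1) (nc z / r)).
by apply: H => // k; rewrite ncX mul1r.
Qed.

(** The coefficients of the expansion of w ^ k at w = z up to second order. *)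
Fixpoint pow_jet z k : R[i] * R[i] * R[i] :=
  if k is k'.+1 then
    let: (a, b, d) := pow_jet z k' in (z * a, z * b + a, z * d + b)
  else (1, 0, 0).

Lemma pow_jet_bound z (d : R) k : 0 < d ->
  [/\ (pow_jet z k).1.1 = z ^+ k,
      nc (pow_jet z k).1.2 <= d^-1 * (nc z + d) ^+ k &
      nc (pow_jet z k).2 <= d^-1 ^+ 2 * (nc z + d) ^+ k].
Proof.
move=> d0; have di : 0 < d^-1 by rewrite invr_gt0.
elim: k => [|k] /=.
  by rewrite !nc0 !expr0 !mulr1; split=> //; rewrite ?exprn_ge0 // ltW.
case: (pow_jet z k) => [[a b] c] /= [-> Hb Hc].
have z0 := nc_ge0 z; have rk : 0 <= (nc z + d) ^+ k by rewrite exprn_ge0 //; lra.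
rewrite !(exprS _ k); split=> //.
  apply: le_trans (ncD _ _) _; rewrite ncM ncX.
  have H1 : nc z ^+ k <= (nc z + d) ^+ k by rewrite lerXn2r // ?nnegrE; lra.
  rewrite (_ : d^-1 * _ = nc z * (d^-1 * (nc z + d) ^+ k) + (nc z + d) ^+ k).
    by apply: lerD => //; apply: ler_wpM2l.
  by field; rewrite gt_eqF.
apply: le_trans (ncD _ _) _; rewrite ncM.
rewrite (_ : d^-1 ^+ 2 * _ = nc z * (d^-1 ^+ 2 * (nc z + d) ^+ k) +
   d^-1 * (nc z + d) ^+ k); first by apply: lerD => //; apply: ler_wpM2l.
by field; rewrite gt_eqF.
Qed.

Lemma pow_jet_rem z h (d : R) k : 0 < d -> nc h < d / 2 ->
  nc ((z + h) ^+ k - ((pow_jet z k).1.1 + (pow_jet z k).1.2 * h +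
      (pow_jet z k).2 * h ^+ 2)) <=
  (2 * d^-1 ^+ 3 * nc h ^+ 3) * (nc z + d) ^+ k.
Proof.
move=> d0 hd; have di : 0 < d^-1 by rewrite invr_gt0.
have z0 := nc_ge0 z; have h0 := nc_ge0 h.
elim: k => [|k].
  rewrite /= !expr0 !mul0r !addr0 subrr nc0 mulr1.
  by rewrite !mulr_ge0 ?exprn_ge0 // ltW.
have [_ _] := pow_jet_bound z k d0.
rewrite /=; case: (pow_jet z k) => [[a b] c] /= Hc IH.
rewrite !(exprS _ k).
set X := (z + h) ^+ k in IH *; set r := (nc z + d) ^+ k in IH Hc *.
have r0 : 0 <= r by rewrite exprn_ge0 //; lra.
rewrite (_ : _ - _ = (z + h) * (X - (a + b * h + c * h ^+ 2)) + c * h ^+ 3).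
  apply: le_trans (ncD _ _) _; rewrite (ncM (z + h)) (ncM c) ncX.
  have A1 : nc (z + h) <= nc z + d / 2 by have := ncD z h; lra.
  have e0 : 0 <= nc h ^+ 3 by rewrite exprn_ge0.
  have A2 := ler_pM (nc_ge0 _) (nc_ge0 _) A1 IH.
  have A3 := ler_wpM2r e0 Hc.
  apply: le_trans (lerD A2 A3) _.
  rewrite le_eqVlt; apply/orP; left; apply/eqP; field; by rewrite gt_eqF.
by ring.
Qed.

(** The 2-jets of the monomials grow geometrically, so they may be summed term by
    term inside the disc of convergence. *)
Lemma pser_jet2 c (r : R) z : 0 < r -> nc z < r -> psbound c r ->
  jet2 (pser c) z.
Proof.
move=> r0 zr Hc.
pose d := (r - nc z) / 2; have d0 : 0 < d by rewrite /d; lra.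
have z0 := nc_ge0 z; have di : 0 < d^-1 by rewrite invr_gt0.
have td : 0 <= nc z + d < r by apply/andP; rewrite /d; lra.
have [B B0 HB] := psbound_gdom r0 td Hc.
have ht : (nc z + d) / r < 1 by rewrite ltr_pdivrMr // mul1r; case/andP: td.
pose b k := (pow_jet z k).1.2; pose e k := (pow_jet z k).2.
have Gb := HB _ b (ltW di) (fun k => let: And3 _ H _ := pow_jet_bound z k d0 in H).
have di2 : 0 <= d^-1 ^+ 2 by rewrite exprn_ge0 // ltW.
have Ge := HB _ e di2 (fun k => let: And3 _ _ H := pow_jet_bound z k d0 in H).
exists (csum (fun k => c k * b k)), (csum (fun k => c k * e k)).
exists (B * (2 * d^-1 ^+ 3) / (1 - (nc z + d) / r)), (d / 2); split.
- by apply: divr_ge0; [rewrite !mulr_ge0 ?exprn_ge0 // ltW | lra].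
- lra.
move=> h hd.
have K0 : 0 <= 2 * d^-1 ^+ 3 * nc h ^+ 3.
  by rewrite !mulr_ge0 ?exprn_ge0 ?nc_ge0 // ltW.
have Gr := HB _ _ K0 (fun k => pow_jet_rem z k d0 hd).
have zhr : nc (z + h) < r by have := ncD z h; rewrite /d in hd; lra.
have C1 := pserP r0 zhr Hc.
have C2 := cvgC_csumZ (- 1) (pserP r0 zr Hc).
have C3 := cvgC_csumZ (- h) (csumP Gb).
have C4 := cvgC_csumZ (- h ^+ 2) (csumP Ge).
have C5 := cvgC_csumD (cvgC_csumD (cvgC_csumD C1 C2) C3) C4.
have -> : pser c (z + h) - (pser c z + csum (fun k => c k * b k) * h +
    csum (fun k => c k * e k) * h ^+ 2) =
  csum (fun k => c k * ((z + h) ^+ k - ((pow_jet z k).1.1 +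
    (pow_jet z k).1.2 * h + (pow_jet z k).2 * h ^+ 2))).
  rewrite (_ : _ - _ = pser c (z + h) + - 1 * pser c z +
    - h * csum (fun k => c k * b k) + - h ^+ 2 * csum (fun k => c k * e k));
    last by ring.
  apply/esym/csum_eq; apply: (cvgC_eventually (n0 := 0)) C5 => n _.
  apply: eq_bigr => k _; have [-> _ _] := pow_jet_bound z k d0.
  by rewrite /b /e; ring.
apply: le_trans (csum_bound Gr) _.
rewrite le_eqVlt; apply/orP; left; apply/eqP; rewrite !mulrA; ring.
Qed.

End ComplexAnalysis.
(** * Cauchy products and reciprocals *)
Section Reciprocals.
Variable R : realType.
Implicit Types (z w h l : R[i]) (u v : nat -> R[i]).
Notation nc := (@ComplexField.Normc.normc R).
Arguments ComplexField.Normc.normc : simpl never.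

Lemma expr_cvg0 (t e : R) : 0 <= t < 1 -> 0 < e ->
  exists n0, forall n, (n0 <= n)%N -> t ^+ n < e.
Proof.
move=> /andP[t0 t1] e0.
have /cvg_expr : `|t| < 1 by rewrite ger0_norm.
move=> /cvgrPdist_lt /(_ _ e0)[n0 _ H]; exists n0 => n /H /=.
by rewrite sub0r normrN ger0_norm // exprn_ge0.
Qed.

Definition cauchy_prod u v n : R[i] := \sum_(k < n.+1) u k * v (n - k)%N.

Lemma psums_cauchy u v n :
  psums (cauchy_prod u v) n = \sum_(k < n) u k * psums v (n - k).
Proof.
elim: n => [|n IH]; first by rewrite /psums !big_ord0.
rewrite /psums big_ord_recr /= -/(psums (cauchy_prod u v) n) IH.
rewrite /cauchy_prod !big_ord_recr /= subSnn subnn /psums big_ord1 addrA.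
congr (_ + _); rewrite -big_split /=; apply: eq_bigr => k _.
by rewrite subSn ?(ltnW (ltn_ord k)) // big_ord_recr /= mulrDr.
Qed.

Lemma cvgC_cauchy u v (A B s t : R) : s < t -> gdom u A s -> gdom v B t ->
  cvgC (psums (cauchy_prod u v)) (csum u * csum v).
Proof.
move=> st Gu Gv; have [A0 /andP[s0 s1] Hu] := Gu; have [B0 /andP[t0 t1] Hv] := Gv.
have tp : 0 < t by lra.
pose K := A * (B / (1 - t)) / (1 - s / t).
have q1 : s / t < 1 by rewrite ltr_pdivrMr // mul1r.
have q0 : 0 <= s / t by rewrite divr_ge0.
have K0 : 0 <= K by rewrite !mulr_ge0 ?invr_ge0 //; lra.
have D n : nc (psums u n * csum v - psums (cauchy_prod u v) n) <= K * t ^+ n.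
  rewrite psums_cauchy /psums mulr_suml -sumrB.
  apply: le_trans (nc_sum _ _) _.
  have H1 (k : 'I_n) : nc (u k * csum v - u k * psums v (n - k)) <=
      A * (B / (1 - t)) * t ^+ n * (s / t) ^+ (0 + k).
    rewrite -mulrBr ncM; have H2 := csum_tail (n - k) Gv.
    apply: le_trans (ler_pM (nc_ge0 _) (nc_ge0 _) (Hu k) H2) _.
    rewrite le_eqVlt; apply/orP; left; apply/eqP.
    have E : t ^+ n = t ^+ (n - k) * t ^+ k.
      by rewrite -exprD subnK // ltnW.
    rewrite E add0n expr_div_n.
    have N1 : 1 - t != 0 by rewrite subr_eq0 gt_eqF.
    have N2 : t ^+ k != 0 by rewrite expf_neq0 // gt_eqF.
    by field; rewrite N1 N2.
  apply: le_trans (ler_sum _ (fun k _ => H1 k)) _.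
  apply: le_trans (geo_sum_le 0 n _ _) _.
  - by rewrite !mulr_ge0 ?invr_ge0 ?exprn_ge0 //; lra.
  - by rewrite q0.
  by rewrite expr0 mulr1 /K mulrAC.
have Z : cvgC (fun n => psums (cauchy_prod u v) n - psums u n * csum v) 0.
  move=> e e0; have e1 : 0 < e / (K + 1) by rewrite divr_gt0 //; lra.
  have [n0 H] := @expr_cvg0 t _ (introT andP (conj t0 t1)) e1.
  exists n0 => n /H; rewrite ltr_pdivlMr; last lra.
  move=> H2; rewrite subr0 nc_dist; apply: le_lt_trans (D n) _.
  by have := exprn_ge0 n t0; nra.
have := cvgCD Z (cvgCM (csumP Gu) (cvgC_cst (csum v))).
rewrite add0r; apply: (cvgC_eventually (n0 := 0)) => n _; by ring.
Qed.

Lemma psbound_le c (r s : R) : 0 <= s <= r -> psbound c r -> psbound c s :> Prop.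
Proof.
move=> /andP[s0 sr] [B B0 H]; exists B => // k; apply: le_trans (H k).
by apply: ler_wpM2l (nc_ge0 _) _ _ _; rewrite lerXn2r // nnegrE; lra.
Qed.

Lemma psbound_cauchy c d (r s : R) : 0 < s < r -> psbound c r -> psbound d s ->
  psbound (cauchy_prod c d) s.
Proof.
move=> /andP[s0 sr] Hc [D D0 HD].
have r0 : 0 < r by lra.
have [|B B0 H] := @psbound_gdom _ c r s r0 _ Hc; first lra.
have [||G0 G1 G] := H 1 (fun k => (s%:C) ^+ k); first lra.
  by move=> k; rewrite ncX ncR gtr0_norm // mul1r.
exists (D * (B * 1 / (1 - s / r))).
  by rewrite mulr_ge0 // divr_ge0 //; case/andP: G1; lra.
move=> n; apply: le_trans (ler_wpM2r (exprn_ge0 n (ltW s0)) (nc_sum _ _)) _.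
rewrite mulr_suml mulrC.
have H1 (k : 'I_n.+1) : nc (c k * d (n - k)%N) * s ^+ n <=
    D * (B * 1 * (s / r) ^+ (0 + k)).
  have E : s ^+ n = s ^+ (n - k) * s ^+ k by rewrite -exprD subnK // leq_ord.
  rewrite ncM E.
  rewrite (_ : _ * (_ * _) = (nc (d (n - k)%N) * s ^+ (n - k)) * (nc (c k) * s ^+ k));
    last by ring.
  apply: ler_pM; rewrite ?mulr_ge0 ?nc_ge0 ?exprn_ge0 ?(ltW s0) //.
  by have := G k; rewrite ncM ncX ncR gtr0_norm.
apply: le_trans (ler_sum _ (fun k _ => H1 k)) _.
rewrite -mulr_sumr [leRHS]mulrC; apply: ler_wpM2l => //.
by apply: le_trans (geo_sum_le 0 n.+1 _ _) _; rewrite ?expr0 ?mulr1 // mulr_ge0.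
Qed.

Lemma pser_cauchy c d (r : R) z : nc z < r -> psbound c r -> psbound d r ->
  pser (cauchy_prod c d) z = pser c z * pser d z.
Proof.
move=> zr Hc Hd; have z0 := nc_ge0 z; have r0 : 0 < r by lra.
pose t := (nc z + r) / 2.
have [|B B0 HB] := @psbound_gdom _ c r (nc z) r0 _ Hc; first by rewrite z0.
have [|D D0 HD] := @psbound_gdom _ d r t r0 _ Hd; first by rewrite /t; lra.
have G1 : gdom (fun k => c k * z ^+ k) (B * 1) (nc z / r).
  by apply: HB => // k; rewrite ncX mul1r.
have G2 : gdom (fun k => d k * z ^+ k) (D * 1) (t / r).
  by apply: HD => // k; rewrite ncX mul1r lerXn2r // ?nnegrE /t; lra.
have st : nc z / r < t / r by rewrite ltr_pM2r ?invr_gt0 // /t; lra.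
apply: csum_eq; apply: (cvgC_eventually (n0 := 0)) (cvgC_cauchy st G1 G2) => n _.
apply: eq_bigr => k _; rewrite /cauchy_prod mulr_suml; apply: eq_bigr => j _.
have E : z ^+ k = z ^+ j * z ^+ (k - j) by rewrite -exprD subnKC // leq_ord.
by rewrite E; ring.
Qed.

(** The reciprocal of a power series with constant term 1, whose coefficients obey
    a recurrence involving all the previous ones. *)
Fixpoint recip_list (c : nat -> R[i]) n : seq R[i] :=
  if n is n'.+1 then
    let s := recip_list c n' in
    rcons s (- \sum_(k < n) c k.+1 * nth 0 s (n' - k))
  else [:: 1].
Definition recip c n : R[i] := nth 0 (recip_list c n) n.

Lemma size_recip_list c n : size (recip_list c n) = n.+1.
Proof. by elim: n => //= n IH; rewrite size_rcons IH. Qed.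

Lemma nth_recip_list c n k : (k <= n)%N -> nth 0 (recip_list c n) k = recip c k.
Proof.
elim: n => [|n IH]; first by rewrite leqn0 => /eqP ->.
rewrite leq_eqVlt => /orP[/eqP -> //|]; rewrite ltnS => kn.
by rewrite /= nth_rcons size_recip_list ltnS kn IH.
Qed.

Lemma recipS c n : recip c n.+1 = - \sum_(k < n.+1) c k.+1 * recip c (n - k)%N.
Proof.
rewrite /recip /= nth_rcons size_recip_list ltnn eqxx; congr (- _).
by apply: eq_bigr => k _; rewrite nth_recip_list // leq_subr.
Qed.

Lemma recip_cauchy c n : c 0%N = 1 -> cauchy_prod c (recip c) n = (n == 0%N)%:R.
Proof.
move=> c0; case: n => [|n]; rewrite /cauchy_prod.
  by rewrite big_ord1 c0 mul1r.
by rewrite big_ord_recl /= c0 mul1r subn0 recipS addrC subrr.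
Qed.

(** If the coefficients of c are bounded by B on the disc of radius r, the recurrence
    keeps those of the reciprocal bounded by 1 on a disc smaller by a factor
    2 B + 2, because a geometric sum absorbs the convolution. *)
Lemma psbound_recip c (r : R) : 0 < r -> psbound c r ->
  exists2 s : R, 0 < s <= r & psbound (recip c) s.
Proof.
move=> r0 [B B0 H]; pose t := (2 * B + 2)^-1.
have tp : 0 < t by rewrite invr_gt0; lra.
have tB : t * (2 * B + 2) = 1 by rewrite mulVf // gt_eqF //; lra.
have t1 : t < 1 by nra.
have rt0 : 0 < r * t by rewrite mulr_gt0.
exists (r * t); first by rewrite rt0 ler_piMr // ltW.
exists 1 => //; elim/ltn_ind => -[|n] IH.
  by rewrite /recip /= nc1 expr0 mulr1.
rewrite recipS ncN.
apply: le_trans (ler_wpM2r (exprn_ge0 n.+1 (ltW rt0)) (nc_sum _ _)) _.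
rewrite mulr_suml.
have H1 (k : 'I_n.+1) : nc (c k.+1 * recip c (n - k)%N) * (r * t) ^+ n.+1 <=
    B * t ^+ (1 + k).
  have E : (r * t) ^+ n.+1 = (r * t) ^+ k.+1 * (r * t) ^+ (n - k).
    by rewrite -exprD addSn subnKC // leq_ord.
  rewrite ncM E mulrACA.
  rewrite -[leRHS]mulr1; apply: ler_pM.
  - by rewrite mulr_ge0 ?nc_ge0 ?exprn_ge0 // ltW.
  - by rewrite mulr_ge0 ?nc_ge0 ?exprn_ge0 // ltW.
  - by rewrite exprMn mulrA; apply: ler_wpM2r; rewrite ?exprn_ge0 // ltW.
  - by apply: IH; rewrite ltnS leq_subr.
apply: le_trans (ler_sum _ (fun k _ => H1 k)) _.
apply: le_trans (geo_sum_le 1 n.+1 B0 _) _; first by rewrite (ltW tp).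
rewrite expr1 ler_pdivrMr; nra.
Qed.

Lemma pser_inv c (r : R) : 0 < r -> psbound c r -> c 0%N != 0 ->
  exists d s, [/\ 0 < s, s <= r, psbound d s, d 0%N != 0 &
    forall z, nc z < s -> pser c z * pser d z = 1].
Proof.
move=> r0 Hc c0.
pose e k := (c 0%N)^-1 * c k.
have He : psbound e r.
  case: Hc => B B0 H; exists (nc (c 0%N)^-1 * B); first by rewrite mulr_ge0 ?nc_ge0.
  by move=> k; rewrite ncM -mulrA; apply: ler_wpM2l (nc_ge0 _) _ _ (H k).
have [s /andP[s0 sr] Hs] := psbound_recip r0 He.
exists (fun k => (c 0%N)^-1 * recip e k), s; split=> //.
- case: Hs => B B0 H; exists (nc (c 0%N)^-1 * B); first by rewrite mulr_ge0 ?nc_ge0.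
  by move=> k; rewrite ncM -mulrA; apply: ler_wpM2l (nc_ge0 _) _ _ (H k).
- by rewrite mulf_neq0 ?invr_neq0 // oner_eq0.
move=> z zs.
have He' : psbound e s by apply: psbound_le He; rewrite sr ltW.
have <- : pser (cauchy_prod e (recip e)) z = 1.
  apply: csum_eq; apply: (cvgC_eventually (n0 := 1)) (cvgC_cst _) => n n0.
  rewrite /psums -(subnKC n0) big_split_ord /= big_ord1 expr0 mulr1.
  rewrite recip_cauchy ?eqxx /=; last by rewrite /e mulVf.
  rewrite big1 ?addr0 // => k _.
  by rewrite recip_cauchy ?mul0r // /e mulVf.
rewrite (pser_cauchy zs He' Hs).
have pZ a (f : nat -> R[i]) : psbound f s -> pser (fun k => a * f k) z = a * pser f z.
  move=> Hf; apply: csum_eq.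
  apply: (cvgC_eventually (n0 := 0)) (cvgC_csumZ a (pserP s0 zs Hf)) => n _.
  by apply: eq_bigr => k _; rewrite mulrA.
rewrite !pZ //; first by ring.
by apply: psbound_le Hc; rewrite sr ltW.
Qed.

(** * The complex exponential *)

Definition expc_coeff k : R[i] := k`!%:R^-1.

Lemma fact_neq0 n : (n`!%:R : R[i]) != 0.
Proof. by rewrite pnatr_eq0 -lt0n fact_gt0. Qed.

Lemma psbound_exp (r : R) : 0 <= r -> psbound expc_coeff r.
Proof.
move=> r0; exists (expR r) => [|k]; first exact: expR_ge0.
rewrite ncV nc_nat mulrC; case: k => [|k].
  by rewrite expr0 fact0 divr1; have := expR_ge1Dx r; lra.
by have := expR_ge1Dxn k r0; lra.
Qed.

Lemma psums_expR (x : R) : cvgC (psums (fun k => x%:C ^+ k / k`!%:R)) (expR x)%:C.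
Proof.
have H : (series (exp_coeff x) @ \oo --> expR x)%classic.
  by rewrite /expR; exact: is_cvg_series_exp_coeff.
move=> e e0; move/cvgrPdist_lt: H => /(_ _ e0)[n0 _ H]; exists n0 => n /H /=.
rewrite distrC -ncR rmorphB; congr (nc (_ - _) < _).
rewrite /series /psums /= big_mkord rmorph_sum; apply: eq_bigr => k _.
by rewrite /exp_coeff /= rmorphM fmorphV rmorphXn rmorph_nat.
Qed.

Lemma psums_cis (y : R) :
  cvgC (psums (fun k => (0 +i* y) ^+ k / k`!%:R)) (cos y +i* sin y).
Proof.
have H1 : (series (cos_coeff y) @ \oo --> cos y)%classic.
  by rewrite cos.unlock; exact: is_cvg_series_cos_coeff.
have H2 : (series (sin_coeff y) @ \oo --> sin y)%classic.
  by rewrite sin.unlock; exact: is_cvg_series_sin_coeff.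
have T k : (0 +i* y) ^+ k / k`!%:R = cos_coeff y k +i* sin_coeff y k.
  have E : (0 +i* y) = 'i * y%:C by apply/eqP; rewrite eq_complex /=; apply/andP; split; apply/eqP; ring.
  have F : (k`!%:R : R[i])^-1 = (k`!%:R^-1)%:C by rewrite fmorphV rmorph_nat.
  rewrite E exprMn -rmorphXn F /=.
  have P : 'i ^+ k = ((~~ odd k)%:R * (-1) ^+ k./2) +i* ((odd k)%:R * (-1) ^+ k.-1./2) :> R[i].
    rewrite -{1}(odd_double_half k) exprD -muln2 mulnC exprM sqr_i.
    have -> : (-1) ^+ k./2 = ((-1) ^+ k./2)%:C :> R[i] by rewrite rmorphXn rmorphN1.
    case ok : (odd k) => /=.
      have -> : k.-1./2 = k./2 by case: k ok {F} => //= k; rewrite uphalf_half => /negbTE ->.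
      by rewrite expr1; apply/eqP; rewrite eq_complex /=; apply/andP; split; apply/eqP; ring.
    by rewrite expr0; apply/eqP; rewrite eq_complex /=; apply/andP; split; apply/eqP; ring.
  rewrite P; apply/eqP; rewrite eq_complex /= cos_coeffE sin_coeffE.
  by apply/andP; split; apply/eqP; ring.
move=> e e0; have e2 : 0 < e / 2 by lra.
move/cvgrPdist_lt: H1 => /(_ _ e2)[n1 _ H1].
move/cvgrPdist_lt: H2 => /(_ _ e2)[n2 _ H2].
exists (maxn n1 n2) => n; rewrite geq_max => /andP[/H1 /= h1 /H2 /= h2].
apply: le_lt_trans (nc_le_ReIm _) _.
have -> : psums (fun k => (0 +i* y) ^+ k / k`!%:R) n =
    series (cos_coeff y) n +i* series (sin_coeff y) n.
  rewrite /psums /series /= !big_mkord.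
  elim: n {h1 h2} => [|n IH]; first by rewrite !big_ord0.
  by rewrite !big_ord_recr /= IH T.
rewrite /= distrC (distrC _ (sin y)); lra.
Qed.

Lemma gdom_exp a (M : R) : 1 < M ->
  exists B, gdom (fun k => a ^+ k / k`!%:R) B (1 / M).
Proof.
move=> M1; have [|B B0 H] := @psbound_exp (M * nc a).
  by rewrite mulr_ge0 ?nc_ge0 //; lra.
exists B; split=> //.
  by rewrite divr_ge0 //= ?ltr_pdivrMr ?mul1r //; lra.
move=> k; have M0 : 0 < M ^+ k by rewrite exprn_gt0 //; lra.
rewrite expr_div_n expr1n mulrA mulr1 ler_pdivlMr //.
by apply: le_trans (H k); rewrite ncM ncX exprMn mulrC mulrA mulrC mulrA.
Qed.

Lemma cexpE z : cexp z = pser expc_coeff z.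
Proof.
case: z => x y; rewrite /cexp /=.
have [|A GA] := @gdom_exp x%:C 4; first lra.
have [|B GB] := @gdom_exp (0 +i* y) 2; first lra.
have st : (1 / 4 : R) < 1 / 2 by lra.
rewrite -(csum_eq (psums_expR x)) -(csum_eq (psums_cis y)).
apply/esym; apply: csum_eq.
apply: (cvgC_eventually (n0 := 0)) (cvgC_cauchy st GA GB) => n _.
apply: eq_bigr => k _.
have -> : x +i* y = (0 +i* y) + x%:C 
  by apply/eqP; rewrite eq_complex /= add0r addr0 !eqxx.
rewrite exprDn mulr_sumr; apply: eq_bigr => j _.
have jk : (j <= k)%N := leq_ord j.
have E : (k`! = 'C(k, j) * (j`! * (k - j)`!))%N by rewrite bin_fact.
have B0 : ('C(k, j)%:R : R[i]) != 0 by rewrite pnatr_eq0 -lt0n bin_gt0.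
rewrite /expc_coeff E !natrM -mulr_natr.
by field; rewrite !fact_neq0 B0.
Qed.

Lemma cexp_add z w : cexp (z + w) = cexp z * cexp w.
Proof.
case: z => x y; case: w => a b; rewrite /cexp /= expRD cosD sinD rmorphM.
by apply/eqP; rewrite eq_complex /=; apply/andP; split; apply/eqP; ring.
Qed.

Lemma cexp0 : cexp 0 = 1 :> R[i].
Proof. by rewrite /cexp /= expR0 cos0 sin0 mul1r. Qed.

Lemma nc_cexp z : nc (cexp z) = expR (complex.Re z).
Proof.
rewrite /cexp ncM ncR ger0_norm ?expR_ge0 // /ComplexField.Normc.normc /=.
by rewrite cos2Dsin2 sqrtr1 mulr1.
Qed.

Lemma cexp_neq0 z : cexp z != 0.
Proof. by rewrite -nc_gt0 nc_cexp expR_gt0. Qed.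

Lemma cexp_jet2 z : jet2 (@cexp R) z.
Proof.
apply: (@jet2_ext _ (pser expc_coeff) _ z 1) => // [w _|]; first by rewrite cexpE.
apply: (@pser_jet2 _ _ (nc z + 1)); [by have := nc_ge0 z; lra | lra |].
by apply: psbound_exp; have := nc_ge0 z; lra.
Qed.

End Reciprocals.
(** The function extending (e^z - 1) / z to the whole plane; it divides the theta
    product by its zero at the origin. *)
HB.lock Definition expm1_quot (R : realType) (z : R[i]) : R[i] :=
  pser (fun k => k.+1`!%:R^-1) z.
Section Expm1.
Variable R : realType.
Implicit Types (z w h l : R[i]) (u v : nat -> R[i]).
Notation nc := (@ComplexField.Normc.normc R).


Lemma psbound_expm1 (r : R) : 1 <= r -> psbound (fun k => k.+1`!%:R^-1 : R[i]) r.
Proof.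
move=> r1; have [|B B0 H] := @psbound_exp R r; first lra.
exists B => // k; apply: le_trans (H k.+1).
by apply: ler_wpM2l (nc_ge0 _) _ _ _; rewrite exprS ler_peMl // exprn_ge0 //; lra.
Qed.

Lemma expm1_quot_jet2 z : jet2 (@expm1_quot R) z.
Proof.
have z0 := nc_ge0 z.
apply: (@jet2_ext _ (pser (fun k => k.+1`!%:R^-1)) _ z 1) => // [w _|].
  by rewrite expm1_quot.unlock.
apply: (@pser_jet2 _ _ (nc z + 1)); [lra | lra |].
by apply: psbound_expm1; lra.
Qed.

Lemma cexp_sub1 z : cexp z - 1 = z * expm1_quot z.
Proof.
have z0 := nc_ge0 z.
have Hb : psbound (fun k => k.+1`!%:R^-1 : R[i]) (nc z + 1) by apply: psbound_expm1; lra.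
have C1 := @pserP _ _ (nc z + 1) z ltac:(lra) ltac:(lra) Hb.
rewrite expm1_quot.unlock.
have C2 := @pserP _ (@expc_coeff R) (nc z + 1) z ltac:(lra) ltac:(lra) (psbound_exp _).
apply: (@cvgC_unique _ (fun n => psums (fun k => @expc_coeff R k * z ^+ k) n.+1 - 1)).
  rewrite cexpE; apply: cvgCD (cvgC_cst _); apply: (cvgC_sub (f := S)) => //.
  by apply: C2; lra.
apply: (cvgC_eventually (n0 := 0)) (cvgC_csumZ z C1) => n _.
rewrite /psums [RHS]addrC big_ord_recl /expc_coeff /= fact0 invr1 expr0 mulr1 addKr.
by apply: eq_bigr => k _; rewrite /bump /= add1n exprS; ring.
Qed.

Lemma expm1_quot0 : expm1_quot 0 = 1 :> R[i].
Proof.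
rewrite expm1_quot.unlock; apply: csum_eq; apply: (cvgC_eventually (n0 := 1)) (cvgC_cst _) => n n0.
rewrite /psums -(subnKC n0) big_split_ord /= big_ord1 expr0 mulr1 invr1.
by rewrite big1 ?addr0 // => k _; rewrite expr0n mulr0.
Qed.

End Expm1.
Section Liouville.
Variable R : realType.
Implicit Types (z w h l : R[i]) (u v : nat -> R[i]).
Notation nc := (@ComplexField.Normc.normc R).
Arguments ComplexField.Normc.normc : simpl never.
(** * A maximum principle *)

Definition contR (f : R[i] -> R) z : Prop := forall e : R, 0 < e ->
  exists2 d : R, 0 < d & forall w, nc (w - z) < d -> `|f w - f z| < e.

Definition sqn z : R := complex.Re z ^+ 2 + complex.Im z ^+ 2.

Lemma sqn_ge0 z : 0 <= sqn z.
Proof. by rewrite addr_ge0 ?sqr_ge0. Qed.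

Lemma sqnE z : sqn z = nc z ^+ 2.
Proof.
rewrite /sqn /ComplexField.Normc.normc; case: z => a b /=.
by rewrite sqr_sqrtr // addr_ge0 ?sqr_ge0.
Qed.

Lemma contR_sqn z : contR sqn z.
Proof.
move=> e e0; have z0 := nc_ge0 z.
exists (Num.min 1 (e / (2 * nc z + 2))).
  by rewrite lt_min ltr01 divr_gt0 //; lra.
move=> w; rewrite lt_min ltr_pdivlMr; last lra.
move=> /andP[w1 w2]; rewrite !sqnE.
have H1 := ncD (w - z) z; have H2 := ncD (z - w) w; rewrite !subrK (nc_dist z) in H1 H2.
have := nc_ge0 w; have := nc_ge0 (w - z) => d0 w0.
rewrite subr_sqr normrM.
have A1 : `|nc w - nc z| <= nc (w - z) by rewrite ler_norml; lra.
have A2 : `|nc w + nc z| <= 2 * nc z + 1 by rewrite ler_norml; lra.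
apply: le_lt_trans (ler_pM (normr_ge0 _) (normr_ge0 _) A1 A2) _; nra.
Qed.

Lemma contR_comp (f : R[i] -> R) (g : R -> R) z :
  contR f z -> {for f z, continuous g} -> contR (fun w => g (f w)) z.
Proof.
move=> Hf /cvgrPdist_lt Hg e /Hg /nbhs_ballP[d /= d0 Hd].
have [d' d'0 H] := Hf _ d0; exists d' => // w /H Hw.
by rewrite distrC; apply: Hd; rewrite /ball /= distrC.
Qed.

Lemma contRD (f g : R[i] -> R) z : contR f z -> contR g z ->
  contR (fun w => f w + g w) z.
Proof.
move=> Hf Hg e e0; have e2 : 0 < e / 2 by lra.
have [d d0 H] := Hf _ e2; have [d' d'0 H'] := Hg _ e2.
exists (Num.min d d'); first by rewrite lt_min d0.
move=> w; rewrite lt_min => /andP[/H h1 /H' h2].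
have := ler_normD (f w - f z) (g w - g z).
rewrite (_ : f w - f z + _ = f w + g w - (f z + g z)); last by ring.
lra.
Qed.

Lemma contRZ (a : R) (f : R[i] -> R) z : contR f z -> contR (fun w => a * f w) z.
Proof.
move=> Hf; apply: (contR_comp (g := fun x => a * x)) Hf _.
by apply: cvgM; [exact: cvg_cst | exact: cvg_id].
Qed.

Lemma evt_square (f : R[i] -> R) (M : R) : 0 <= M -> (forall z, contR f z) ->
  exists c, [/\ `|complex.Re c| <= M, `|complex.Im c| <= M &
    forall z, `|complex.Re z| <= M -> `|complex.Im z| <= M -> f z <= f c].
Proof.
move=> M0 Hf; pose g (p : R * R) := f (p.1 +i* p.2).
pose A := (`[- M, M] `*` `[- M, M])%classic : set (R * R).
have cA : compact A by apply: compact_setX; exact: segment_compact.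
have [||[x y]] := @compact_EVT_max _ _ g A _ cA.
- by exists (0, 0); split => /=; rewrite in_itv /=; lra.
- apply: continuous_subspaceT => p; apply/cvgrPdist_lt => e e0.
  have [d d0 Hd] := Hf (p.1 +i* p.2) e e0.
  have d2 : 0 < d / 2 by lra.
  exists (ball p.1 (d / 2), ball p.2 (d / 2)) => /=.
    by split; exact: nbhsx_ballx.
  move=> [a b] [/= Ha Hb].
  rewrite distrC; apply: Hd; apply: le_lt_trans (nc_le_ReIm _) _ => /=.
  move: Ha Hb; rewrite /ball /= distrC (distrC p.2); lra.
rewrite inE => -[/= Hx Hy] H; exists (x +i* y) => /=.
move: Hx Hy; rewrite !in_itv /= => Hx Hy.
rewrite !ler_norml; split=> // -[a b] /=; rewrite !ler_norml => Ha Hb.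
by apply: (H (a, b)); rewrite inE; split => /=; rewrite in_itv.
Qed.

(** Harmonic to second order: the average of f over the four points of a cross of
    radius r differs from f z by O(r ^ 3). *)
Definition harm (f : R[i] -> R) z : Prop :=
  contR f z /\ exists K d : R, [/\ 0 <= K, 0 < d & forall r : R, 0 < r < d ->
    `|f (z + r%:C) + f (z - r%:C) + f (z + 'i * r%:C) + f (z - 'i * r%:C)
      - 4 * f z| <= K * r ^+ 3].

Lemma ReMn z n : complex.Re (z *+ n) = complex.Re z *+ n.
Proof. by elim: n => [|n IH]; rewrite ?mulr0n // !mulrS ReD IH. Qed.

Lemma jet2_harm (f : R[i] -> R[i]) z : jet2 f z ->
  harm (fun w => complex.Re (f w)) z.
Proof.
move=> Hf; split.
  move=> e /(jet2_cont Hf)[d d0 H]; exists d => // w /H.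
  by apply: le_lt_trans; rewrite -ReN -ReD; exact: Re_le_nc.
have [A [B [K [d [K0 d0 H]]]]] := Hf.
exists (4 * K), d; split=> //; first lra.
move=> r /andP[r0 rd].
have nr : nc r%:C = r by rewrite ncR gtr0_norm.
have ni : nc 'i = 1 by rewrite /ComplexField.Normc.normc /= expr0n expr1n add0r sqrtr1.
have H1 := H r%:C; have H2 := H (- r%:C).
have H3 := H ('i * r%:C); have H4 := H (- ('i * r%:C)).
rewrite ?ncN ?ncM ?ni ?mul1r nr in H1 H2 H3 H4.
move: (H1 rd) (H2 rd) (H3 rd) (H4 rd) => {H1 H2 H3 H4 H}.
set e1 := (X in nc X <= _ -> _); move=> h1.
set e2 := (X in nc X <= _ -> _); move=> h2.
set e3 := (X in nc X <= _ -> _); move=> h3.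
set e4 := (X in nc X <= _ -> _); move=> h4.
have E : f (z + r%:C) + f (z - r%:C) + f (z + 'i * r%:C) + f (z - 'i * r%:C)
    - 4%:R * f z = e1 + e2 + e3 + e4.
  apply/eqP; rewrite -subr_eq0; apply/eqP.
  transitivity (2%:R * B * r%:C ^+ 2 * ('i ^+ 2 + 1)); last by rewrite sqr_i; ring.
  by rewrite /e1 /e2 /e3 /e4; ring.
have -> : complex.Re (f (z + r%:C)) + complex.Re (f (z - r%:C)) +
    complex.Re (f (z + 'i * r%:C)) + complex.Re (f (z - 'i * r%:C)) -
    4 * complex.Re (f z) = complex.Re (e1 + e2 + e3 + e4).
  by rewrite -E !mulr_natl !ReD ReN ReMn.
apply: le_trans (Re_le_nc _) _.
have := ncD (e1 + e2 + e3) e4; have := ncD (e1 + e2) e3; have := ncD e1 e2; lra.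
Qed.

(** ln |z|^2 is harmonic away from 0.  The product of |z + r|^2, |z - r|^2,
    |z + i r|^2 and |z - i r|^2 is |z ^ 4 - r ^ 4|^2, so on a cross the defect is
    of order r ^ 4. *)
Lemma ln_four_points (r : R) z : 0 < r -> 0 < sqn z ->
  0 < sqn (z + r%:C) -> 0 < sqn (z - r%:C) ->
  0 < sqn (z + 'i * r%:C) -> 0 < sqn (z - 'i * r%:C) ->
  ln (sqn (z + r%:C)) + ln (sqn (z - r%:C)) + ln (sqn (z + 'i * r%:C)) +
    ln (sqn (z - 'i * r%:C)) - 4 * ln (sqn z) <= 2 * r ^+ 4 / sqn z ^+ 2.
Proof.
move=> r0 z0 h1 h2 h3 h4.
have q0 : 0 < sqn z ^+ 4 by rewrite exprn_gt0.
have -> : 4 * ln (sqn z) = ln (sqn z ^+ 4) by rewrite lnXn // mulr_natl.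
rewrite -!lnM ?posrE ?mulr_gt0 //.
rewrite -ln_div ?posrE ?mulr_gt0 //.
have s2 : 0 < r ^+ 4 / sqn z ^+ 2 by rewrite divr_gt0 ?exprn_gt0.
have E : sqn (z + r%:C) * sqn (z - r%:C) * sqn (z + 'i * r%:C) *
    sqn (z - 'i * r%:C) / sqn z ^+ 4 <= (1 + r ^+ 4 / sqn z ^+ 2) ^+ 2.
  rewrite ler_pdivrMr //.
  have -> : (1 + r ^+ 4 / sqn z ^+ 2) ^+ 2 * sqn z ^+ 4 = (sqn z ^+ 2 + r ^+ 4) ^+ 2.
    by field; rewrite gt_eqF.
  case: (z) => x y; rewrite /sqn /= -subr_ge0.
  set X := (X in 0 <= X).
  have -> : X = 4 * r ^+ 4 * (x ^+ 2 - y ^+ 2) ^+ 2 by rewrite /X; ring.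
  apply: mulr_ge0; last exact: sqr_ge0.
  by apply: mulr_ge0 => //; exact: exprn_ge0 (ltW r0).
apply: (@le_trans _ _ (ln ((1 + r ^+ 4 / sqn z ^+ 2) ^+ 2))).
  rewrite ler_ln ?posrE //; last by rewrite exprn_gt0 //; lra.
  by rewrite divr_gt0 // !mulr_gt0.
rewrite lnXn; last lra.
have := @le_ln1Dx _ (r ^+ 4 / sqn z ^+ 2) ltac:(lra).
by rewrite mulr2n -mulrA; lra.
Qed.

Lemma contR_near (f : R[i] -> R) z (a : R) : contR f z -> a < f z ->
  exists2 d : R, 0 < d & forall w, nc (w - z) < d -> a < f w.
Proof.
move=> Hf az; have [|d d0 H] := Hf (f z - a); first by rewrite subr_gt0.
by exists d => // w /H; rewrite ltr_norml => /andP[? ?]; lra.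
Qed.

Lemma sqn_four_points (r : R) z :
  sqn (z + r%:C) + sqn (z - r%:C) + sqn (z + 'i * r%:C) + sqn (z - 'i * r%:C)
  - 4 * sqn z = 4 * r ^+ 2.
Proof. by case: z => x y; rewrite /sqn /=; ring. Qed.

Lemma nc_shift (r : R) z : 0 <= r ->
  [/\ nc (z + r%:C - z) = r, nc (z - r%:C - z) = r,
      nc (z + 'i * r%:C - z) = r & nc (z - 'i * r%:C - z) = r].
Proof.
move=> r0; have nr : nc r%:C = r by rewrite ncR ger0_norm.
have ni : nc 'i = 1 by rewrite /ComplexField.Normc.normc /= expr0n expr1n add0r sqrtr1.
have E w : z + w - z = w by ring.
by rewrite !E !ncN ncM ni mul1r nr.
Qed.

(** The comparison function of the maximum principle is u - e1 ln |z|^2 + e2 |z|^2,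
    up to a truncation of the logarithm near 0.  It is strictly subharmonic, since
    |z|^2 contributes 4 e2 r ^ 2 to the sum over a cross while the other errors are
    O(r ^ 3), so a local maximum is impossible. *)
Lemma no_interior_max (u : R[i] -> R) (e1 e2 p2 : R) z (d : R) :
  0 <= e1 -> 0 < e2 -> 0 < p2 -> p2 < sqn z -> 0 < d -> harm u z ->
  let v w := u w + (- e1 * ln (Num.max p2 (sqn w)) + e2 * sqn w) in
  (forall w, nc (w - z) < d -> v w <= v z) -> False.
Proof.
move=> e10 e20 p0 pz d0 [_ [K [d1 [K0 d10 Hu]]]] v Hmax.
have [d2 d20 H2] := contR_near (@contR_sqn z) pz.
have z0 : 0 < sqn z by lra.
pose C := K + 2 * e1 / sqn z ^+ 2.
have C0 : 0 <= C by rewrite addr_ge0 // divr_ge0 ?exprn_ge0 ?mulr_ge0 // ltW.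
pose m := Num.min (Num.min d d1) (Num.min d2 (Num.min 1 (2 * e2 / (C + 1)))).
have m0 : 0 < m.
  by rewrite !lt_min d0 d10 d20 ltr01 divr_gt0 //; lra.
pose r := m / 2; have r0 : 0 < r by rewrite /r; lra.
have : r < m by rewrite /r; lra.
rewrite !lt_min => /andP[/andP[rd rd1] /andP[rd2 /andP[r1]]].
rewrite ltr_pdivlMr; last lra.
move=> rC.
have [n1 n2 n3 n4] := @nc_shift r z (ltW r0).
have vE w : nc (w - z) = r -> [/\ p2 < sqn w, v w <= v z &
    v w = u w + (- e1 * ln (sqn w) + e2 * sqn w)].
  move=> nw; have pw : p2 < sqn w by apply: H2; rewrite nw.
  split=> //; first by apply: Hmax; rewrite nw.
  by rewrite /v max_r // ltW.
have [p1 l1 E1] := vE _ n1; have [p3 l2 E2] := vE _ n2.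
have [p4 l3 E3] := vE _ n3; have [p5 l4 E4] := vE _ n4.
have Ez : v z = u z + (- e1 * ln (sqn z) + e2 * sqn z).
  by rewrite /v max_r // ltW.
have := @ln_four_points r z r0 z0 ltac:(lra) ltac:(lra) ltac:(lra) ltac:(lra).
have := sqn_four_points r z.
have := Hu r ltac:(by rewrite r0).
rewrite ler_norml => /andP[h1 _] h2 h3.
have h4 : e1 * (ln (sqn (z + r%:C)) + ln (sqn (z - r%:C)) + ln (sqn (z + 'i * r%:C)) +
    ln (sqn (z - 'i * r%:C)) - 4 * ln (sqn z)) <= 2 * e1 / sqn z ^+ 2 * r ^+ 3.
  apply: le_trans (ler_wpM2l e10 h3) _.
  rewrite (_ : e1 * _ = (2 * e1 / sqn z ^+ 2 * r ^+ 3) * r); last first.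
    by field; rewrite gt_eqF.
  rewrite ler_piMr; [by []| |lra].
  by rewrite !mulr_ge0 ?invr_ge0 ?exprn_ge0 // ltW.
have h5 : C * r ^+ 3 < 4 * e2 * r ^+ 2.
  rewrite exprSr mulrA -(mulrC r) mulrA ltr_pM2r ?exprn_gt0 //; nra.
have h6 : e2 * (4 * r ^+ 2) = 4 * e2 * r ^+ 2 by ring.
move: h1 h4 h5; rewrite -h6 -h2 /C mulrDl.
rewrite E1 Ez in l1; rewrite E2 Ez in l2; rewrite E3 Ez in l3; rewrite E4 Ez in l4.
by nra.
Qed.

Lemma continuous_lnmax (p x : R) : 0 < p ->
  {for x, continuous (fun y : R => ln (Num.max p y))}.
Proof.
move=> p0; apply: (@continuous_comp _ _ _ (fun y => Num.max p y) (@ln R)).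
  by apply: continuous_max; [exact: cvg_cst | exact: cvg_id].
by apply: continuous_ln; rewrite lt_max p0.
Qed.

(** A bounded harmonic function u takes its largest value at any point, here 0.  If
    u z1 exceeded u 0, the comparison function on a large square would have its
    maximum near 0, where u is close to u 0, or on the boundary, where the logarithm
    makes it very negative; both are less than its value at z1. *)
Lemma liouville_at0 (u : R[i] -> R) (B : R) z1 :
  (forall z, harm u z) -> (forall z, `|u z| <= B) -> z1 != 0 -> u z1 <= u 0.
Proof.
move=> Hu HB z10.
have B0 : 0 <= B by apply: le_trans (HB 0).
rewrite leNgt; apply/negP => u01.
pose e := (u z1 - u 0) / 4; have e0 : 0 < e by rewrite /e; lra.
have [d d0 Hd] := (Hu 0).1 _ e0.
pose p := d / 2; have p0 : 0 < p by rewrite /p; lra.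
have pp : 0 < p ^+ 2 by rewrite exprn_gt0.
pose g z := ln (Num.max (p ^+ 2) (sqn z)).
pose e1 := e / (`|g z1 - ln (p ^+ 2)| + 1).
have e10 : 0 < e1 by rewrite divr_gt0 //; have := normr_ge0 (g z1 - ln (p ^+ 2)); lra.
pose K : R := `|g z1| + 2 * B / e1 + nc z1 + p.
have z0 := nc_ge0 z1.
have KB : 0 <= 2 * B / e1 by apply: divr_ge0; [exact: mulr_ge0 | exact: ltW].
have K0 : 0 <= K by rewrite /K; have := normr_ge0 (g z1); lra.
pose M := expR K; have M0 : 0 < M by exact: expR_gt0.
have MK : 1 + K <= M by exact: expR_ge1Dx.
pose e2 := e / (2 * M ^+ 2); have e20 : 0 < e2.
  by apply: divr_gt0 => //; apply: mulr_gt0 => //; exact: exprn_gt0.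
pose v w := u w + (- e1 * ln (Num.max (p ^+ 2) (sqn w)) + e2 * sqn w).
have cv z : contR v z.
  apply: contRD; first exact: (Hu z).1.
  apply: contRD; apply: contRZ; last exact: contR_sqn.
  by apply: (contR_comp (g := fun y => ln (Num.max (p ^+ 2) y))) (@contR_sqn z) _; exact: continuous_lnmax.
have [c [c1 c2 Hc]] := evt_square (ltW M0) cv.
have z1c : v z1 <= v c.
  have M1 : nc z1 <= M by rewrite /K in MK; have := normr_ge0 (g z1); lra.
  by apply: Hc; apply: le_trans M1; [exact: Re_le_nc | exact: Im_le_nc].
have v1 : u z1 - e1 * g z1 <= v z1.
  by rewrite /v -/(g z1); have := mulr_ge0 (ltW e20) (sqn_ge0 z1); lra.
have ec : e2 * sqn c <= e.
  have : sqn c <= 2 * M ^+ 2.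
    have -> : sqn c = `|complex.Re c| ^+ 2 + `|complex.Im c| ^+ 2 by rewrite !real_normK ?num_real.
    by have := lerXn2r 2 (normr_ge0 _) (ltW M0) c1; have := lerXn2r 2 (normr_ge0 _) (ltW M0) c2; lra.
  move=> /(ler_wpM2l (ltW e20)); rewrite /e2 divfK ?gt_eqF // mulr_gt0 //.
  by rewrite exprn_gt0.
have [pc|pc] := leP (sqn c) (p ^+ 2).
  (* The truncation is active at the maximum c, so c is close to 0. *)
  have uc : u c < u 0 + e.
    have : nc (c - 0) < d.
      rewrite subr0; move: pc; rewrite sqnE => pc.
      have : nc c <= p by rewrite -(ler_pXn2r (n := 2)) // nnegrE ?nc_ge0 // ltW.
      by rewrite /p; lra.
    by move/Hd; rewrite ltr_norml => /andP[_]; lra.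
  have vc : v c = u c - e1 * ln (p ^+ 2) + e2 * sqn c.
    by rewrite /v max_l //; ring.
  have : e1 * (g z1 - ln (p ^+ 2)) <= e.
    have q0 : 0 < `|g z1 - ln (p ^+ 2)| + 1 by have := normr_ge0 (g z1 - ln (p ^+ 2)); lra.
    rewrite /e1 mulrAC ler_pdivrMr //; apply: ler_wpM2l; first exact: ltW.
    by have := ler_norm (g z1 - ln (p ^+ 2)); lra.
  by rewrite /e in ec uc *; lra.
have [/andP[b1 b2]|bd] := boolP ((`|complex.Re c| < M) && (`|complex.Im c| < M)).
  pose dd := Num.min (M - `|complex.Re c|) (M - `|complex.Im c|).
  apply: (@no_interior_max u e1 e2 (p ^+ 2) c dd (ltW e10) e20 pp pc _ (Hu c)).
    by rewrite lt_min !subr_gt0 b1.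
  move=> w; rewrite lt_min => /andP[w1 w2]; apply: Hc.
    have := Re_le_nc (w - c); rewrite ReD ReN.
    have := ler_normD (complex.Re w - complex.Re c) (complex.Re c); rewrite subrK; lra.
  have := Im_le_nc (w - c); rewrite ImD ImN.
  have := ler_normD (complex.Im w - complex.Im c) (complex.Im c); rewrite subrK; lra.
(* The maximum c is on the boundary of the square. *)
have Mc : M ^+ 2 <= sqn c.
  have -> : sqn c = `|complex.Re c| ^+ 2 + `|complex.Im c| ^+ 2 by rewrite !real_normK ?num_real.
  move: bd; rewrite negb_and -!leNgt => /orP[b|b].
    have := lerXn2r 2 (ltW M0) (normr_ge0 _) b; have := sqr_ge0 `|complex.Im c|; lra.
  have := lerXn2r 2 (ltW M0) (normr_ge0 _) b; have := sqr_ge0 `|complex.Re c|; lra.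
have lM : 2 * K <= ln (sqn c).
  have -> : 2 * K = ln (M ^+ 2) by rewrite lnXn // /M expRK mulr_natl.
  by rewrite ler_ln // posrE; [rewrite exprn_gt0 | lra].
have vc : v c = u c - e1 * ln (sqn c) + e2 * sqn c.
  by rewrite /v max_r ?(ltW pc) //; ring.
have : 2 * B <= e1 * (ln (sqn c) - g z1).
  have -> : 2 * B = e1 * (2 * B / e1) by field; rewrite gt_eqF.
  apply: ler_wpM2l; first exact: ltW.
  by rewrite /K in lM; have := ler_norm (g z1); have := normr_ge0 (g z1); lra.
have := HB c; have := HB 0; rewrite !ler_norml /e in ec *; lra.
Qed.

(** The real parts of a f, for a = 1 and a = - i, are bounded harmonic functions, and
    each is largest at every point. *)
Theorem liouville (f : R[i] -> R[i]) (B : R) :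
  (forall z, jet2 f z) -> (forall z, nc (f z) <= B) -> forall z, f z = f 0.
Proof.
move=> Hf HB.
have key (a : R[i]) z w : complex.Re (a * f z) <= complex.Re (a * f w).
  have [-> //|zw] := eqVneq z w.
  have Ha s : jet2 (fun t => a * f (t + w)) s.
    apply: jet2M; first exact: jet2_cst.
    apply: jet2_comp (Hf _); apply: jet2D; [exact: jet2_id|exact: jet2_cst].
  have := @liouville_at0 (fun t => complex.Re (a * f (t + w))) (nc a * B) (z - w).
  rewrite subrK add0r; apply; last by rewrite subr_eq0.
    by move=> t; exact: jet2_harm.
  move=> t; apply: le_trans (Re_le_nc _) _; rewrite ncM.
  by apply: ler_wpM2l (HB _); exact: nc_ge0.
move=> z; apply: complex_eq.
  by apply/eqP; rewrite eq_le; have := key 1 z 0; have := key 1 0 z; rewrite !mul1r => -> ->.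
have E w : complex.Re (- 'i * f w) = complex.Im (f w).
  by case: (f w) => a b /=; ring.
by apply/eqP; rewrite eq_le; have := key (- 'i) z 0; have := key (- 'i) 0 z; rewrite !E => -> ->.
Qed.
End Liouville.
(** * The normalised exponential *)
HB.lock Definition cex (R : realType) (z : R[i]) : R[i] := e2pi z.
Lemma e2piE (R : realType) : @e2pi R = @cex R.
Proof. by rewrite cex.unlock. Qed.

Section Exponential.
Variable R : realType.
Implicit Types (z w h l : R[i]) (u v : nat -> R[i]).
Notation nc := (@ComplexField.Normc.normc R).
Arguments ComplexField.Normc.normc : simpl never.

Lemma cexD z w : cex (z + w) = cex z * cex w.
Proof. by rewrite cex.unlock /e2pi mulrDr cexp_add. Qed.

Lemma cex0 : cex 0 = 1 :> R[i].
Proof. by rewrite cex.unlock /e2pi mulr0 cexp0. Qed.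

Lemma cex_neq0 z : cex z != 0.
Proof. by rewrite cex.unlock; exact: cexp_neq0. Qed.

Lemma cexN z : cex (- z) = (cex z)^-1.
Proof.
apply: (mulfI (cex_neq0 z)).
by rewrite -cexD subrr cex0 mulfV ?cex_neq0.
Qed.

Lemma cexMn z n : cex (n%:R * z) = cex z ^+ n.
Proof.
elim: n => [|n IH]; first by rewrite mul0r cex0.
by rewrite -natr1 mulrDl mul1r cexD IH exprSr.
Qed.

Lemma cex_half : cex (1 / 2) = -1 :> R[i].
Proof.
have -> : (1 / 2 : R[i]) = (1 / 2)%:C by rewrite rmorphM fmorphV rmorph1 rmorph_nat.
rewrite cex.unlock /e2pi (_ : _ * _ = 0 +i* pi); last first.
  by apply/eqP; rewrite eq_complex /=; apply/andP; split; apply/eqP; field.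
by rewrite /cexp expR0 mul1r cospi sinpi; apply/eqP; rewrite eq_complex /= oppr0 !eqxx.
Qed.

Lemma cex1 : cex 1 = 1 :> R[i].
Proof.
have -> : (1 : R[i]) = 1 / 2 + 1 / 2 by field.
by rewrite cexD cex_half mulrNN mul1r; field.
Qed.

Lemma cex_nat n : cex n%:R = 1 :> R[i].
Proof. by have := cexMn 1 n; rewrite mulr1 cex1 expr1n. Qed.

Lemma cex_int (k : int) : cex k%:~R = 1 :> R[i].
Proof.
by case: k => n; rewrite ?NegzE ?rmorphN ?cexN cex_nat // invr1.
Qed.

Lemma cex_addint z (k : int) : cex (z + k%:~R) = cex z.
Proof. by rewrite cexD cex_int mulr1. Qed.

Lemma nc_cex z : nc (cex z) = expR (- (2 * pi * complex.Im z)).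
Proof.
rewrite cex.unlock /e2pi nc_cexp; congr expR; case: z => a b /=; ring.
Qed.

Lemma nc_cex_lt1 z : 0 < complex.Im z -> nc (cex z) < 1.
Proof.
move=> z0; rewrite nc_cex expR_lt1 oppr_lt0 !mulr_gt0 //; exact: pi_gt0.
Qed.

Lemma cex_jet2 z : jet2 (@cex R) z.
Proof.
rewrite cex.unlock; apply: (@jet2_comp _ (fun w => (0 +i* (2 * pi)) * w) (@cexp R)).
  by apply: jet2M; [exact: jet2_cst | exact: jet2_id].
exact: cexp_jet2.
Qed.

Lemma cex_eq1 z : cex z = 1 -> exists k : int, z = k%:~R.
Proof.
move=> H; have : nc (cex z) = 1 by rewrite H nc1.
rewrite nc_cex => E; have {E} /expR_inj/eqP : expR (- (2 * pi * complex.Im z)) = expR 0.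
  by rewrite expR0.
rewrite oppr_eq0 !mulf_eq0 pnatr_eq0 /= gt_eqF ?pi_gt0 //= => /eqP z0.
exists (Num.floor (complex.Re z)).
pose x := complex.Re z - (Num.floor (complex.Re z))%:~R.
have Hx : cex x%:C = 1.
  rewrite -H; have -> : z = x%:C + (Num.floor (complex.Re z))%:~R.
    apply: complex_eq; rewrite ?ReD ?ImD /x /= ?z0.
      by rewrite -(rmorph_int (real_complex R)) /= subrK.
    by rewrite -(rmorph_int (real_complex R)) /= addr0.
  by rewrite cex_addint.
have x0 : 0 <= x by rewrite subr_ge0 ge_floor.
have x1 : x < 1 by have := floorD1_gt (complex.Re z); rewrite rmorphD /= /x; lra.
have Hc : cos (2 * (pi * x)) = 1.
  move: Hx; rewrite cex.unlock /e2pi (_ : _ * _ = 0 +i* (2 * (pi * x))); last first.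
    by apply/eqP; rewrite eq_complex /=; apply/andP; split; apply/eqP; ring.
  by rewrite /cexp expR0 mul1r => -[].
have Hs : sin (pi * x) = 0.
  apply/eqP; rewrite -sqrf_eq0; apply/eqP.
  move: Hc; rewrite mulr_natl mulr2n cosD -!expr2.
  by have := cos2Dsin2 (pi * x); lra.
have [x00|x00] := eqVneq x 0.
  apply: complex_eq; rewrite -(rmorph_int (real_complex R)) /= ?z0 //.
  by move: x00; rewrite /x => /eqP; rewrite subr_eq0 => /eqP.
have : 0 < sin (pi * x).
  apply: sin_gt0_pi; rewrite mulr_gt0 ?pi_gt0 //=; last by rewrite lt_def x00.
  by rewrite gtr_pMr ?pi_gt0.
by rewrite Hs ltxx.
Qed.

Definition ph (r : R) : R[i] := cex r%:C.

Lemma phD r s : ph (r + s) = ph r * ph s.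
Proof. by rewrite /ph rmorphD cexD. Qed.

Lemma phN r : ph (- r) = (ph r)^-1.
Proof. by rewrite /ph rmorphN cexN. Qed.

Lemma ph0 : ph 0 = 1.
Proof. exact: cex0. Qed.

Lemma ph_neq0 r : ph r != 0.
Proof. exact: cex_neq0. Qed.

Lemma phMn n r : ph (n%:R * r) = ph r ^+ n.
Proof. by rewrite /ph rmorphM rmorph_nat cexMn. Qed.

Lemma ph_half : ph (1 / 2) = -1.
Proof. by rewrite /ph rmorphM fmorphV rmorph1 rmorph_nat cex_half. Qed.

Lemma ph_int (k : int) : ph k%:~R = 1.
Proof. by rewrite /ph rmorph_int cex_int. Qed.

Lemma ph_addint r (k : int) : ph (r + k%:~R) = ph r.
Proof. by rewrite phD ph_int mulr1. Qed.

Lemma ph_eq1 r : ph r = 1 -> exists k : int, r = k%:~R.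
Proof.
move=> /cex_eq1[k]; rewrite -(rmorph_int (real_complex R)) => /complexI ->.
by exists k.
Qed.

Lemma nc_ph r : nc (ph r) = 1.
Proof. by rewrite /ph nc_cex /= mulr0 oppr0 expR0. Qed.

Lemma ph_quarter : ph (1 / 4) = 'i.
Proof.
rewrite /ph cex.unlock /e2pi (_ : _ * _ = 0 +i* (pi / 2)); last first.
  by apply/eqP; rewrite eq_complex /=; apply/andP; split; apply/eqP; field.
by rewrite /cexp expR0 mul1r cos_pihalf sin_pihalf.
Qed.

(** * The Euler product *)

(** Euler's expansion of the product of the 1 - q ^ n w over n >= 0 as a power series
    in w.  The recurrence is the functional equation f(w) = (1 - w) f(q w) read on
    coefficients, and for |q| < 1 the series is entire, so the product is regular in w. *)
Fixpoint euler_coeff (q : R[i]) j : R[i] :=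
  if j is j'.+1 then - euler_coeff q j' * q ^+ j' / (1 - q ^+ j) else 1.

Lemma one_sub_neq0 q n : nc q < 1 -> 1 - q ^+ n.+1 != 0.
Proof.
move=> q1; rewrite subr_eq0 eq_sym; apply/eqP => /(congr1 nc).
rewrite ncX nc1 => E; have : nc q ^+ n.+1 <= nc q.
  by rewrite exprS ler_piMr ?nc_ge0 // exprn_ile1 ?nc_ge0 // ltW.
by rewrite E; lra.
Qed.

Lemma eventually_decr_bounded (a : nat -> R) n0 : (forall n, 0 <= a n) ->
  (forall n, (n0 <= n)%N -> a n.+1 <= a n) ->
  exists2 B, 0 <= B & forall n, a n <= B.
Proof.
move=> a0 H; exists (\sum_(k < n0.+1) a k); first exact: sumr_ge0.
have le1 n : (n <= n0)%N -> a n <= \sum_(k < n0.+1) a k.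
  move=> nn; rewrite (bigD1 (Ordinal (nn : (n < n0.+1)%N))) //= lerDl.
  exact: sumr_ge0.
elim=> [|n IH]; first exact: le1.
by have [/le1 //|nn] := leqP n.+1 n0; apply: le_trans (H _ nn) IH.
Qed.

Lemma euler_bound (q : R[i]) (r : R) : nc q < 1 -> 0 <= r ->
  psbound (euler_coeff q) r.
Proof.
move=> q1 r0; have q0 := nc_ge0 q.
have e0 : 0 < (1 - nc q) / (r + 1) by rewrite divr_gt0; lra.
have [n0 Hn] := expr_cvg0 (introT andP (conj q0 q1)) e0.
apply: (@eventually_decr_bounded _ n0).
  by move=> n; rewrite mulr_ge0 ?nc_ge0 ?exprn_ge0.
move=> n /Hn; rewrite ltr_pdivlMr; last lra.
move=> h.
have d0 : 1 - nc q <= nc (1 - q ^+ n.+1).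
  have := ncD (1 - q ^+ n.+1) (q ^+ n.+1); rewrite subrK nc1 ncX => h1.
  have : nc q ^+ n.+1 <= nc q by rewrite exprS ler_piMr // exprn_ile1 // ltW.
  lra.
have d1 : 0 < nc (1 - q ^+ n.+1) by lra.
have k0 := exprn_ge0 n q0; have s0 := exprn_ge0 n r0; have c0 := nc_ge0 (euler_coeff q n).
rewrite [euler_coeff _ _]/= !ncM ncN ncX ncV -/(q ^+ n.+1).
rewrite (_ : _ * r ^+ n.+1 = (nc (euler_coeff q n) * r ^+ n) *
   ((nc q ^+ n * r) / nc (1 - q ^+ n.+1))); last first.
  by rewrite (exprS r); field; rewrite gt_eqF.
rewrite ler_piMr ?mulr_ge0 // ler_pdivrMr // mul1r; nra.
Qed.

End Exponential.
HB.lock Definition Eu (R : realType) (w q : R[i]) : R[i] := pser (euler_coeff q) w.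
Section EulerProduct.
Variable R : realType.
Implicit Types (z w h l : R[i]) (u v : nat -> R[i]).
Notation nc := (@ComplexField.Normc.normc R).


Lemma Eu_cvg w q : nc q < 1 ->
  cvgC (psums (fun k => euler_coeff q k * w ^+ k)) (Eu w q).
Proof.
rewrite Eu.unlock => q1; have w0 := nc_ge0 w; apply: (@pserP _ _ (nc w + 1)); [lra|lra|].
by apply: euler_bound => //; lra.
Qed.

Lemma Eu_step w q : nc q < 1 -> Eu w q = (1 - w) * Eu (q * w) q.
Proof.
move=> q1; have C1 := Eu_cvg w q1; have C2 := Eu_cvg (q * w) q1.
have C3 := cvgCD (cvgC_sub (f := S) (fun n => leqnSn n) C2) (cvgC_csumZ (- w) C2).
rewrite mulrBl mul1r -mulNr.
apply: cvgC_unique (cvgC_sub (f := S) (fun n => leqnSn n) C1) _.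
apply: (cvgC_eventually (n0 := 0)) C3 => n _.
rewrite /psums !big_ord_recl -addrA; congr (_ + _).
rewrite -big_split /=; apply: eq_bigr => k _.
have N := one_sub_neq0 k q1.
by rewrite /bump /= add1n !exprMn !exprS -/(q * q ^+ k) in N *; field.
Qed.

Lemma Eu0 q : nc q < 1 -> Eu 0 q = 1.
Proof.
rewrite Eu.unlock => q1; apply: csum_eq; apply: (cvgC_eventually (n0 := 1)) (cvgC_cst _) => n n0.
rewrite /psums -(subnKC n0) big_split_ord /= big_ord1 expr0 mulr1.
by rewrite big1 ?addr0 // => k _; rewrite expr0n mulr0.
Qed.

Lemma Eu_jet2 w q : nc q < 1 -> jet2 (fun w => Eu w q) w.
Proof.
rewrite Eu.unlock => q1; have w0 := nc_ge0 w; apply: (@pser_jet2 _ _ (nc w + 1)); [lra|lra|].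
by apply: euler_bound => //; lra.
Qed.

Definition eprod (w q : R[i]) n : R[i] := \prod_(k < n) (1 - q ^+ k * w).

Lemma Eu_eprod w q n : nc q < 1 -> Eu w q = eprod w q n * Eu (q ^+ n * w) q.
Proof.
move=> q1; elim: n => [|n IH]; first by rewrite /eprod big_ord0 expr0 !mul1r.
by rewrite IH [Eu (q ^+ n * w) q](Eu_step _ q1) /eprod big_ord_recr /= !mulrA exprS.
Qed.

Lemma cvgC_cont (f : R[i] -> R[i]) u l : contC f l -> cvgC u l ->
  cvgC (fun n => f (u n)) (f l).
Proof.
move=> Hf Hu e /Hf[d d0 H]; have [n0 Hn] := Hu _ d0.
by exists n0 => n /Hn/H.
Qed.

Lemma expr_cvgC0 q w : nc q < 1 -> cvgC (fun n => q ^+ n * w) 0.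
Proof.
move=> q1 e e0; have w0 := nc_ge0 w; have q0 := nc_ge0 q.
have e1 : 0 < e / (nc w + 1) by rewrite divr_gt0; lra.
have [n0 H] := expr_cvg0 (introT andP (conj q0 q1)) e1.
exists n0 => n /H; rewrite ltr_pdivlMr; last lra.
by rewrite subr0 ncM ncX; have := exprn_ge0 n q0; nra.
Qed.

Lemma Eu_tail w q : nc q < 1 -> cvgC (fun n => Eu (q ^+ n * w) q) 1.
Proof.
move=> q1; rewrite -(Eu0 q1); apply: (@cvgC_cont (fun w => Eu w q)).
  exact/jet2_cont/Eu_jet2.
exact: expr_cvgC0.
Qed.

Lemma eprod_cvg w q : nc q < 1 -> cvgC (eprod w q) (Eu w q).
Proof.
move=> q1; have T := Eu_tail w q1.
have Ti : cvgC (fun n => (Eu (q ^+ n * w) q)^-1) 1.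
  rewrite -invr1; apply: (@cvgC_cont (fun w => w^-1)) T.
  by apply/jet2_cont/jet2_inv; exact: oner_neq0.
have [|n0 H] := T (1 / 2); first lra.
have := cvgCM (cvgC_cst (Eu w q)) Ti; rewrite mulr1.
apply: (cvgC_eventually (n0 := n0)) => n /H Hn.
rewrite (Eu_eprod w n q1) mulfK //; apply/eqP => E0.
by move: Hn; rewrite E0 sub0r ncN nc1; lra.
Qed.

(** At a zero w, the tail factor Eu (q ^ n w) tends to 1, so one of the finitely many
    factors before it vanishes. *)
Lemma Eu_eq0 w q : nc q < 1 -> Eu w q = 0 -> exists n, q ^+ n * w = 1.
Proof.
move=> q1 E0; have [|n0 H] := Eu_tail w q1 (e := 1 / 2); first lra.
have := Eu_eprod w n0 q1; rewrite E0 => /esym/eqP.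
rewrite mulf_eq0 => /orP[/prodf_eq0[k _]|/eqP E].
  by rewrite subr_eq0 => /eqP E; exists k.
by have := H n0 (leqnn _); rewrite E sub0r ncN nc1; lra.
Qed.

(** * Infinite products as power series *)

(** The product of the 1 - v x ^ (a + s n) is also a power series in x, with the
    stationary limits of the coefficients of the partial products as coefficients.
    This is the q-expansion of the products, and their regularity in tau. *)
Section ProductSeries.
Variables (v : R[i]) (a s : nat).
Hypotheses (v1 : nc v <= 1) (a0 : (0 < a)%N) (s0 : (0 < s)%N).

Definition fpoly k : {poly R[i]} := \prod_(n < k) (1 - v *: 'X^(a + s * n)).
(** It dominates fpoly coefficientwise, which bounds the coefficients of fpoly
    uniformly in k by values of mpoly. *)
Definition mpoly k : {poly R} := \prod_(n < k) (1 + 'X^(a + s * n)).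

Lemma fpoly_eval k x : (fpoly k).[x] = eprod (v * x ^+ a) (x ^+ s) k.
Proof.
rewrite /fpoly horner_prod; apply: eq_bigr => n _.
by rewrite hornerD hornerN hornerZ hornerXn hornerC exprD exprM; ring.
Qed.

Lemma fpoly_mpoly k j : nc (fpoly k)`_j <= (mpoly k)`_j.
Proof.
elim: k j => [|k IH] j.
  by rewrite /fpoly /mpoly !big_ord0 !coef1 nc_nat.
rewrite /fpoly /mpoly !big_ord_recr /= -/(fpoly k) -/(mpoly k).
rewrite mulrBr mulrDr !mulr1 -scalerAr coefB coefD coefZ !coefMXn.
apply: le_trans (ncD _ _) _; apply: lerD => //; rewrite ncN.
case: ifP => _; first by rewrite mulr0 nc0.
by rewrite ncM; apply: le_trans (IH _); rewrite ler_piMl ?nc_ge0.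
Qed.

Lemma mpoly_coef_le k j (r : R) : 0 <= r -> (mpoly k)`_j * r ^+ j <= (mpoly k).[r].
Proof.
move=> r0; have M0 i : 0 <= (mpoly k)`_i by apply: le_trans (fpoly_mpoly k i); exact: nc_ge0.
have kn : (j < maxn j.+1 (size (mpoly k)))%N by rewrite leq_max leqnn.
rewrite (horner_coef_wide r (leq_maxr j.+1 (size (mpoly k)))).
rewrite (bigD1 (Ordinal kn)) //= lerDl.
by apply: sumr_ge0 => i _; rewrite mulr_ge0 ?exprn_ge0.
Qed.

Lemma mpoly_eval_le k (r : R) : 0 <= r < 1 -> (mpoly k).[r] <= expR (1 / (1 - r)).
Proof.
move=> /andP[r0 r1].
apply: (@le_trans _ _ (expR (\sum_(n < k) r ^+ n))).
  rewrite /mpoly horner_prod; elim: k => [|k IH]; first by rewrite !big_ord0 expR0.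
  rewrite !big_ord_recr /= expRD !hornerE; apply: ler_pM => //.
  - by apply: prodr_ge0 => n _; rewrite !hornerE addr_ge0 // exprn_ge0.
  - by rewrite addr_ge0 // exprn_ge0.
  apply: le_trans (expR_ge1Dx _); rewrite lerD2l; apply: ler_wiXn2l => //.
    exact: ltW.
  by apply: leq_trans (leq_addl _ _); rewrite leq_pmull.
rewrite ler_expR; have := @geo_sum_le R 1 r 0 k ler01 _.
rewrite r0 r1 expr0 mulr1 => /(_ isT); apply: le_trans.
by apply: ler_sum => n _; rewrite mul1r.
Qed.

Definition prod_coeff j : R[i] := (fpoly j)`_j.

Lemma fpoly_stable k j : (j <= k)%N -> (fpoly k)`_j = prod_coeff j.
Proof.
move=> /subnKC <-; elim: (k - j)%N => [|n IH]; first by rewrite addn0.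
rewrite addnS /fpoly big_ord_recr /= -/(fpoly (j + n)).
rewrite mulrBr mulr1 -scalerAr coefB coefZ coefMXn IH ifT ?mulr0 ?subr0 //.
have H : (j + n <= s * (j + n))%N by rewrite leq_pmull.
by lia.
Qed.

Lemma prod_coeff0 : prod_coeff 0 = 1.
Proof. by rewrite /prod_coeff /fpoly big_ord0 coef1. Qed.

Lemma prod_coeff_bound (r : R) : 0 <= r < 1 -> psbound prod_coeff r.
Proof.
move=> r01; have /andP[r0 r1] := r01; exists (expR (1 / (1 - r))); first exact: expR_ge0.
move=> j; apply: le_trans (mpoly_eval_le j r01); apply: le_trans (mpoly_coef_le j j r0).
by apply: ler_wpM2r; rewrite ?exprn_ge0 //; exact: fpoly_mpoly.
Qed.

Lemma Eu_pser x : nc x < 1 -> Eu (v * x ^+ a) (x ^+ s) = pser prod_coeff x.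
Proof.
move=> x1; have x0 := nc_ge0 x.
have q1 : nc (x ^+ s) < 1.
  rewrite ncX; apply: le_lt_trans (x1); rewrite -{2}(expr1 (nc x)).
  by apply: ler_wiXn2l => //; exact: ltW.
apply: cvgC_unique (eprod_cvg _ q1) _.
pose r := (nc x + 1) / 2; have r0 : 0 < r by rewrite /r; lra.
have r01 : 0 <= r < 1 by apply/andP; rewrite /r; lra.
have xr : nc x < r by rewrite /r; lra.
pose t := nc x / r; pose B := expR (1 / (1 - r)).
have t1 : t < 1 by rewrite ltr_pdivrMr // mul1r.
have t0 : 0 <= t by rewrite divr_ge0 // ltW.
have B0 : 0 <= B by exact: expR_ge0.
have cb k j : nc ((fpoly k)`_j * x ^+ j) <= B * t ^+ j.
  rewrite ncM ncX expr_div_n mulrA ler_pdivlMr ?exprn_gt0 // mulrAC.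
  apply: ler_wpM2r; first exact: exprn_ge0.
  apply: le_trans (mpoly_eval_le k r01); apply: le_trans (mpoly_coef_le k j (ltW r0)).
  by apply: ler_wpM2r; rewrite ?exprn_ge0 ?fpoly_mpoly // ltW.
have C1 := pserP r0 xr (prod_coeff_bound r01).
have D k : nc (pser prod_coeff x - eprod (v * x ^+ a) (x ^+ s) k) <=
    2 * B * t ^+ k / (1 - t).
  pose u j := prod_coeff j * x ^+ j + - ((fpoly k)`_j * x ^+ j).
  have G : gdom u (2 * B) t.
    split; [lra|by rewrite t0|move=> j].
    apply: le_trans (ncD _ _) _; rewrite ncN /prod_coeff.
    by have := cb j j; have := cb k j; lra.
  have C2 : cvgC (psums (fun j => - ((fpoly k)`_j * x ^+ j))) (- (fpoly k).[x]).
    apply: (cvgC_eventually (n0 := size (fpoly k))) (cvgC_cst _) => n nn.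
    by rewrite (horner_coef_wide x nn) /psums sumrN.
  rewrite -fpoly_eval -(csum_eq (cvgC_csumD C1 C2)).
  have := csum_tail k G; rewrite (_ : psums u k = 0) ?subr0 //.
  rewrite /psums big1 // => j _.
  by rewrite /u (fpoly_stable (ltnW (ltn_ord j))) subrr.
move=> e e0; have e1 : 0 < e * (1 - t) / (2 * B + 1).
  by rewrite divr_gt0 ?mulr_gt0 //; lra.
have [n0 H] := expr_cvg0 (introT andP (conj t0 t1)) e1.
exists n0 => n /H; rewrite ltr_pdivlMr; last lra.
move=> h; rewrite nc_dist; apply: le_lt_trans (D n) _.
rewrite ltr_pdivrMr; last lra.
by have := exprn_ge0 n t0; nra.
Qed.

End ProductSeries.
End EulerProduct.
Section ThetaProduct.
Variable R : realType.
Implicit Types (z w h l : R[i]) (u v : nat -> R[i]).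
Notation nc := (@ComplexField.Normc.normc R).
Arguments ComplexField.Normc.normc : simpl never.
(** * The theta product *)

Definition Sg z t : R[i] := Eu (cex z) (cex t) * Eu (cex (t - z)) (cex t).

Lemma Im_mulR (r : R) z : complex.Im (r%:C * z) = r * complex.Im z.
Proof. by case: z => a b /=; ring. Qed.

Lemma nc_gt0_of z : z != 0 -> 0 < nc z.
Proof. by rewrite nc_gt0. Qed.

Section Theta.
Variable t : R[i].
Hypothesis t_gt0 : 0 < complex.Im t.

Let q_lt1 : nc (cex t) < 1.
Proof. exact: nc_cex_lt1. Qed.

Lemma Sg_refl z : Sg (t - z) t = Sg z t.
Proof. by rewrite /Sg subKr mulrC. Qed.

Lemma Sg_add1 z : Sg (z + 1) t = Sg z t.
Proof.
have E w : cex (w - 1) = cex w by have := cex_addint w (-1); rewrite rmorphN1.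
by rewrite /Sg opprD addrA E cexD cex1 mulr1.
Qed.

(** Moving z by t exchanges one factor of each product, by the functional equation of
    Eu at cex z and at cex (- z). *)
Lemma Sg_addt z : Sg (z + t) t = - cex (- z) * Sg z t.
Proof.
rewrite /Sg; have -> : t - (z + t) = - z by ring.
have -> : cex (z + t) = cex t * cex z by rewrite addrC cexD.
have -> : cex (t - z) = cex t * cex (- z) by rewrite cexD.
have E1 := Eu_step (cex z) q_lt1; have E2 := Eu_step (cex (- z)) q_lt1.
have wi : cex (- z) * cex z = 1 by rewrite -cexD addNr cex0.
have [w1|w1] := eqVneq (1 - cex z) 0.
  have wi1 : 1 - cex (- z) = 0.
    move/eqP: w1; rewrite subr_eq0 => /eqP w1; rewrite -w1 mulr1 in wi.
    by rewrite wi subrr.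
  by rewrite E1 E2 w1 wi1 !(mul0r, mulr0).
apply: (mulfI w1); rewrite mulrA -E1 E2 !mulrA.
congr (_ * _); rewrite mulrC; congr (_ * _).
transitivity (- cex (- z) + cex (- z) * cex z); first by rewrite wi; ring.
by ring.
Qed.

Lemma Sg_eq0 z : Sg z t = 0 -> exists j k : int, z = j%:~R + k%:~R * t.
Proof.
move=> /eqP; rewrite mulf_eq0 => /orP[] /eqP /(Eu_eq0 q_lt1)[n].
  rewrite -cexMn -cexD => /cex_eq1[j E]; exists j, (- n%:Z).
  by rewrite rmorphN /= -E -pmulrn; ring.
rewrite -cexMn -cexD => /cex_eq1[j E]; exists (- j), (n.+1%:Z).
by rewrite rmorphN /= -E -pmulrn -natr1; ring.
Qed.

Lemma Sg_jet2 z : jet2 (fun z => Sg z t) z.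
Proof.
apply: jet2M.
  by apply: (@jet2_comp _ (@cex R) (fun w => Eu w (cex t))); [exact: cex_jet2 | exact: Eu_jet2].
apply: (@jet2_comp _ (fun z => cex (t - z)) (fun w => Eu w (cex t))); last exact: Eu_jet2.
apply: (@jet2_comp _ (fun z => t - z) (@cex R)); last exact: cex_jet2.
apply: (@jet2_ext _ (fun z => t + (- 1) * z) _ _ 1) => // [w _|]; first by rewrite mulN1r.
by apply: jet2D; [exact: jet2_cst | apply: jet2M; [exact: jet2_cst | exact: jet2_id]].
Qed.

Definition twopii : R[i] := 0 +i* (2 * pi).

(** The quotient of the theta product by its simple zero at the origin, with the
    removable singularity filled in. *)
Definition Sg1 z : R[i] := - twopii * expm1_quot (twopii * z) *
  (Eu (cex t * cex z) (cex t) * Eu (cex (t - z)) (cex t)).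

Lemma Sg_Sg1 z : Sg z t = z * Sg1 z.
Proof.
rewrite /Sg (Eu_step _ q_lt1) /Sg1.
have -> : 1 - cex z = - (twopii * z * expm1_quot (twopii * z)).
  by rewrite -cexp_sub1 opprB cex.unlock.
by ring.
Qed.

Lemma Sg1_jet2 z : jet2 Sg1 z.
Proof.
apply: jet2M.
  apply: jet2M; first exact: jet2_cst.
  apply: (@jet2_comp _ (fun z => twopii * z) (@expm1_quot R)); last exact: expm1_quot_jet2.
  by apply: jet2M; [exact: jet2_cst | exact: jet2_id].
apply: jet2M.
  apply: (@jet2_comp _ (fun z => cex t * cex z) (fun w => Eu w (cex t))); last exact: Eu_jet2.
  by apply: jet2M; [exact: jet2_cst | exact: cex_jet2].
apply: (@jet2_comp _ (fun z => cex (t - z)) (fun w => Eu w (cex t))); last exact: Eu_jet2.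
apply: (@jet2_comp _ (fun z => t - z) (@cex R)); last exact: cex_jet2.
apply: (@jet2_ext _ (fun z => t + (- 1) * z) _ _ 1) => // [w _|]; first by rewrite mulN1r.
by apply: jet2D; [exact: jet2_cst | apply: jet2M; [exact: jet2_cst | exact: jet2_id]].
Qed.

Lemma twopii_neq0 : twopii != 0.
Proof. by rewrite /twopii eq_complex /= eqxx /= mulf_neq0 // ?gt_eqF ?pi_gt0. Qed.

Lemma Euq_neq0 : Eu (cex t) (cex t) != 0.
Proof.
apply/eqP => /(Eu_eq0 q_lt1)[n]; rewrite -exprSr => /(congr1 nc).
rewrite ncX nc1 => E; have q0 := nc_ge0 (cex t).
have : nc (cex t) ^+ n.+1 <= nc (cex t).
  by rewrite exprS ler_piMr // exprn_ile1 // ltW.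
by rewrite E; have := q_lt1; lra.
Qed.

Lemma Sg1_neq0 : Sg1 0 != 0.
Proof.
rewrite /Sg1 mulr0 expm1_quot0 cex0 subr0 !mulr1.
by rewrite !mulf_neq0 ?oppr_eq0 ?twopii_neq0 ?Euq_neq0.
Qed.

Definition theta_like (f : R[i] -> R[i]) : Prop :=
  (forall z, f (z + 1) = f z) /\ (forall z, f (z + t) = - cex (- z) * f z).

Lemma theta_zero (f : R[i] -> R[i]) (j k : int) z : theta_like f ->
  f z = 0 -> f (z + j%:~R + k%:~R * t) = 0.
Proof.
move=> [f1 ft] z0.
have s1 w (n : nat) : f w = 0 -> f (w + n%:R) = 0 /\ f (w - n%:R) = 0.
  move=> w0; elim: n => [|n [IH1 IH2]]; first by rewrite subr0 addr0.
  split; first by rewrite -natr1 addrA f1 IH1.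
  by rewrite -natr1 opprD addrA -f1 subrK IH2.
have st w (n : nat) : f w = 0 -> f (w + n%:R * t) = 0 /\ f (w - n%:R * t) = 0.
  move=> w0; elim: n => [|n [IH1 IH2]]; first by rewrite mul0r subr0 addr0.
  split; first by rewrite -natr1 mulrDl mul1r addrA ft IH1 ?mulr0.
  have /eqP := ft (w - n.+1%:R * t).
  have -> : w - n.+1%:R * t + t = w - n%:R * t by rewrite -natr1; ring.
  rewrite IH2 // eq_sym mulf_eq0 oppr_eq0 (negbTE (cex_neq0 _)) /=.
  by move/eqP.
have H1 : f (z + j%:~R) = 0.
  case: j => n; first by have [] := s1 z n z0.
  by rewrite NegzE rmorphN /=; have [] := s1 z n.+1 z0.
case: k => n; first by have [] := st _ n H1.
by rewrite NegzE rmorphN /= mulNr; have [] := st _ n.+1 H1.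
Qed.

(** The theta product has simple zeros exactly at the lattice points, and so f, which
    vanishes at 0 and has the same automorphy, is divisible by it.  The quotient is
    elliptic, hence bounded by its values on a period parallelogram, and constant by
    the theorem of Liouville. *)
Lemma theta_unique (f g : R[i] -> R[i]) : theta_like f ->
  (forall z, f z = z * g z) -> (forall z, jet2 f z) -> jet2 g 0 ->
  forall z, f z = g 0 / Sg1 0 * Sg z t.
Proof.
move=> Hf fg fj gj; have [f1 ft] := Hf.
have S0 : Sg 0 t = 0 by rewrite Sg_Sg1 mul0r.
have St : theta_like (fun z => Sg z t) by split; [exact: Sg_add1 | exact: Sg_addt].
have f0 : f 0 = 0 by rewrite fg mul0r.
pose H z := if Sg z t == 0 then g 0 / Sg1 0 else f z / Sg z t.
have H1 z : H (z + 1) = H z by rewrite /H Sg_add1 f1.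
have Ht z : H (z + t) = H z.
  rewrite /H Sg_addt ft mulf_eq0 oppr_eq0 (negbTE (cex_neq0 _)) /=.
  case: eqP => // /eqP N; rewrite -mulf_div divff ?mul1r //.
  by rewrite oppr_eq0 cex_neq0.
have Hn1 z (n : nat) : H (z + n%:R) = H z.
  by elim: n => [|n IH]; rewrite ?addr0 // -natr1 addrA H1.
have Hnt z (n : nat) : H (z + n%:R * t) = H z.
  by elim: n => [|n IH]; rewrite ?mul0r ?addr0 // -natr1 mulrDl mul1r addrA Ht.
have HZ1 z (j : int) : H (z + j%:~R) = H z.
  case: j => n; first exact: Hn1.
  by rewrite NegzE rmorphN /= -[in RHS](subrK (n.+1%:R) z) Hn1.
have HZt z (j : int) : H (z + j%:~R * t) = H z.
  case: j => n; first exact: Hnt.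
  by rewrite NegzE rmorphN /= mulNr -[in RHS](subrK (n.+1%:R * t) z) Hnt.
have Hlat z : Sg z t = 0 -> forall w, H (w + z) = H w.
  by move=> /Sg_eq0[j [k ->]] w; rewrite addrA HZt HZ1.
have Hj0 : jet2 H 0.
  have [d d0 Hd] := jet2_cont (Sg1_jet2 0) (nc_gt0_of Sg1_neq0).
  apply: (@jet2_ext _ (fun z => g z / Sg1 z) _ 0 d d0) => [w|].
    rewrite subr0 => wd; have S1 : Sg1 w != 0.
      apply/eqP => E; move: (Hd w); rewrite subr0 E sub0r ncN ltxx => /(_ wd).
      by [].
    rewrite /H Sg_Sg1 mulf_eq0 (negbTE S1) orbF.
    case: eqP => [->|/eqP w0]; first by [].
    by rewrite fg -mulf_div divff // mul1r.
  apply: jet2M gj _; apply: jet2V; [exact: Sg1_neq0 | exact: Sg1_jet2].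
have Hj z : jet2 H z.
  have [z0|z0] := eqVneq (Sg z t) 0.
    have E w : H (w - z) = H w by rewrite -(Hlat z z0) subrK.
    apply: (@jet2_ext _ (fun w => H (w - z)) _ z 1) => //.
    apply: (@jet2_comp _ (fun w => w - z) H); last by rewrite subrr.
    by apply: jet2D; [exact: jet2_id | exact: jet2_cst].
  have [d d0 Hd] := jet2_cont (Sg_jet2 z) (nc_gt0_of z0).
  apply: (@jet2_ext _ (fun z => f z / Sg z t) _ z d d0) => [w wd|].
    rewrite /H ifF //; apply/eqP => E.
    by move: (Hd w wd); rewrite E sub0r ncN ltxx.
  apply: jet2M (fj z) _; apply: jet2V => //; exact: Sg_jet2.
have [B HB] : exists B, forall z, nc (H z) <= B.
  have cH z : contR (fun w => nc (H w)) z.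
    move=> e /(jet2_cont (Hj z))[d d0 Hd]; exists d => // w /Hd; apply: le_lt_trans.
    rewrite ler_norml; have := ncD (H w - H z) (H z).
    by have := ncD (H z - H w) (H w); rewrite !subrK (nc_dist (H z)); lra.
  pose M := 1 + nc t; have M0 : 0 <= M by have := nc_ge0 t; rewrite /M; lra.
  have [c [_ _ Hc]] := evt_square M0 cH; exists (nc (H c)) => z.
  have [w [<- w1 w2]] : exists w, [/\ H w = H z, `|complex.Re w| <= M & `|complex.Im w| <= M].
    pose y := complex.Im z / complex.Im t; pose k := Num.floor y.
    pose z1 := z + (- k)%:~R * t.
    pose j := Num.floor (complex.Re (z - y%:C * t)).
    exists (z1 + (- j)%:~R); rewrite HZ1 HZt.
    have Y1 : 0 <= y - k%:~R < 1.
      by rewrite subr_ge0 floor_le /=; have := floorD1_gt y; rewrite rmorphD /= -/k; lra.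
    have J1 : 0 <= complex.Re (z - y%:C * t) - j%:~R < 1.
      rewrite subr_ge0 floor_le /=; have := floorD1_gt (complex.Re (z - y%:C * t)).
      by rewrite rmorphD /= -/j; lra.
    have Dec : z1 + (- j)%:~R = (z - y%:C * t - j%:~R) + (y - k%:~R)%:C * t.
      by rewrite /z1 rmorphB /= rmorph_int !rmorphN /=; ring.
    have P1 : nc ((y - k%:~R)%:C * t) <= nc t.
      by rewrite ncM ncR ger0_norm ?ler_piMl ?nc_ge0 //; lra.
    have I1 : complex.Im (z - y%:C * t - j%:~R) = 0.
      rewrite -(rmorph_int (real_complex R)) /=.
      by rewrite !ImD !ImN Im_mulR /y divfK ?gt_eqF //= subrr subr0.
    have R1 : complex.Re (z - y%:C * t - j%:~R) = complex.Re (z - y%:C * t) - j%:~R.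
      by rewrite -(rmorph_int (real_complex R)) ReD ReN.
    rewrite Dec; split=> //.
      rewrite ReD R1; have := Re_le_nc ((y - k%:~R)%:C * t).
      by rewrite /M !ler_norml; lra.
    rewrite ImD I1 add0r; have := Im_le_nc ((y - k%:~R)%:C * t).
    by rewrite /M; lra.
  exact: Hc.
move=> z; have HC := liouville Hj HB z.
have H0 : H 0 = g 0 / Sg1 0 by rewrite /H S0 eqxx.
rewrite -H0 -HC /H; case: eqP => [z0|/eqP z0]; last by rewrite divfK.
rewrite z0 mulr0; have [j [k ->]] := Sg_eq0 z0.
by have := theta_zero j k Hf f0; rewrite add0r.
Qed.
End Theta.
End ThetaProduct.
Section SiegelProducts.
Variable R : realType.
Implicit Types (z w h l : R[i]) (u v : nat -> R[i]).
Notation nc := (@ComplexField.Normc.normc R).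
Arguments ComplexField.Normc.normc : simpl never.
(** * Siegel products and their transformation laws *)

Lemma qpowE (t : R[i]) (x : R) : qpow t x = cex (x%:C * t).
Proof. by rewrite /qpow e2piE. Qed.

(** The Siegel product with characteristic (x1, x2): E_{g,h} is sieg (g / N) (h / N).
    Real characteristics let SL2(Z) act by right multiplication on (x1, x2). *)
Definition sieg (x1 x2 : R) (t : R[i]) : R[i] :=
  cex ((B2 x1 / 2)%:C * t) * Sg (x1%:C * t + x2%:C) t.

Lemma B2C (x : R) : (B2 x / 2)%:C = (x%:C ^+ 2 - x%:C + 6%:R^-1) / 2%:R.
Proof. by rewrite /B2 rmorphM fmorphV rmorph_nat rmorphD rmorphB rmorphXn fmorphV rmorph_nat. Qed.

Lemma half_planeV (t : R[i]) : 0 < complex.Im t -> 0 < complex.Im (- t^-1).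
Proof.
case: t => a b /= b0; rewrite opprK divr_gt0 //.
by apply: ltr_wpDl; [exact: sqr_ge0 | exact: exprn_gt0].
Qed.

Lemma half_plane_neq0 (t : R[i]) : 0 < complex.Im t -> t != 0.
Proof. by apply: contraTneq => ->; rewrite ltxx. Qed.

Section Laws.
Variable t : R[i].
Hypothesis t_gt0 : 0 < complex.Im t.

Lemma sieg_T x1 x2 : sieg x1 x2 (t + 1) = ph (B2 x1 / 2) * sieg x1 (x1 + x2) t.
Proof.
have St z : Sg z (t + 1) = Sg z t.
  have E : cex (t + 1 - z) = cex (t - z).
    have -> : t + 1 - z = (t - z) + 1 by ring.
    by rewrite cexD cex1 mulr1.
  by rewrite /Sg E [cex (t + 1)]cexD cex1 mulr1.
have E1 : cex ((B2 x1 / 2)%:C * (t + 1)) = ph (B2 x1 / 2) * cex ((B2 x1 / 2)%:C * t).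
  by rewrite -cexD mulrDr mulr1 addrC.
have E2 : x1%:C * (t + 1) + x2%:C = x1%:C * t + (x1 + x2)%:C.
  by rewrite rmorphD /=; ring.
by rewrite /sieg St E1 E2 mulrA.
Qed.

Lemma sieg_per2 x1 x2 : sieg x1 (x2 + 1) t = sieg x1 x2 t.
Proof. by rewrite /sieg rmorphD rmorph1 addrA Sg_add1. Qed.

Lemma sieg_per1 x1 x2 : sieg (x1 + 1) x2 t = ph (1 / 2 - x2) * sieg x1 x2 t.
Proof.
have E : (x1 + 1)%:C * t + x2%:C = (x1%:C * t + x2%:C) + t.
  by rewrite rmorphD rmorph1 /=; ring.
rewrite /sieg E Sg_addt // phD ph_half.
have -> : (B2 (x1 + 1) / 2)%:C * t = (B2 x1 / 2)%:C * t + x1%:C * t.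
  by rewrite !B2C rmorphD rmorph1; field.
rewrite cexD opprD cexD /ph rmorphN.
have E1 : cex (x1%:C * t) * cex (- (x1%:C * t)) = 1 by rewrite -cexD subrr cex0.
set a := cex _; set b := cex (x1%:C * t) in E1 *; set c := cex (- _) in E1 *.
set d := cex _; set s := Sg _ _.
transitivity (- (b * c) * (a * d * s)); first by ring.
by rewrite E1; ring.
Qed.

Lemma sieg_perZ2 x1 x2 (k : int) : sieg x1 (x2 + k%:~R) t = sieg x1 x2 t.
Proof.
have H y (n : nat) : sieg x1 (y + n%:R) t = sieg x1 y t.
  by elim: n => [|n IH]; rewrite ?addr0 // -natr1 addrA sieg_per2.
case: k => n; first exact: H.
by rewrite NegzE rmorphN /= -[in RHS](subrK (n.+1%:R) x2) H.
Qed.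

Lemma sieg_perZ1 x1 x2 (k : int) :
  sieg (x1 + k%:~R) x2 t = ph (k%:~R * (1 / 2 - x2)) * sieg x1 x2 t.
Proof.
have H y (n : nat) : sieg (y + n%:R) x2 t = ph (n%:R * (1 / 2 - x2)) * sieg y x2 t.
  elim: n => [|n IH]; first by rewrite addr0 mul0r ph0 mul1r.
  by rewrite -natr1 addrA sieg_per1 IH mulrA -phD; congr (ph _ * _); ring.
case: k => n; first exact: H.
rewrite NegzE rmorphN /= -[in RHS](subrK (n.+1%:R) x1) H mulrA -phD.
by rewrite mulNr addNr ph0 mul1r.
Qed.

Lemma sieg_refl x1 x2 : sieg (1 - x1) (- x2) t = sieg x1 x2 t.
Proof.
have E : (1 - x1)%:C * t + (- x2)%:C = t - (x1%:C * t + x2%:C).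
  by rewrite rmorphB rmorphN rmorph1 /=; ring.
rewrite /sieg E Sg_refl; congr (cex (_%:C * _) * _).
by rewrite /B2; ring.
Qed.

(** The theta product vanishes at lattice points only, that is, at integral
    characteristics. *)
Lemma sieg_neq0 x1 x2 :
  ~ (exists j k : int, x1 = j%:~R /\ x2 = k%:~R) -> sieg x1 x2 t != 0.
Proof.
move=> H; rewrite mulf_neq0 ?cex_neq0 //; apply/eqP => /(Sg_eq0 t_gt0)[j [k E]].
apply: H; exists k, j.
have E1 : x1 = k%:~R.
  have := congr1 (@complex.Im R) E.
  rewrite -!(rmorph_int (real_complex R)) !ImD !Im_mulR /= addr0 add0r.
  by apply: mulIf; rewrite gt_eqF.
split=> //; move: E; rewrite E1 rmorph_int addrC => /addIr.
by rewrite -(rmorph_int (real_complex R)) => /complexI.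
Qed.

(** As a function of z = x2 t - x1, the theta product for - 1 / t, multiplied by a
    Gaussian factor, satisfies the quasi-periodicity of the theta product for t.
    They are proportional by uniqueness, with a constant that depends on t only, not
    on the characteristic. *)
Lemma sieg_S0 : exists2 C : R[i], C != 0 & forall x1 x2,
  sieg x1 x2 (- t^-1) = C * ph ((x1 + x2) / 2 - x1 * x2) * sieg x2 (- x1) t.
Proof.
have t0 := half_plane_neq0 t_gt0; have u_gt0 := half_planeV t_gt0.
set u := - t^-1 in u_gt0 *.
pose e z := - (z ^+ 2 + z - t * z) / (2%:R * t).
pose f z := Sg (t^-1 * z) u * cex (e z).
pose g z := t^-1 * Sg1 u (t^-1 * z) * cex (e z).
have jl z : jet2 (fun z => t^-1 * z) z.
  by apply: jet2M; [exact: jet2_cst | exact: jet2_id].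
have je z : jet2 (fun z => cex (e z)) z.
  apply: (@jet2_comp _ e (@cex R)); last exact: cex_jet2.
  apply: (@jet2_ext _ (fun z => - (2%:R * t)^-1 * (z * z + (1 - t) * z)) _ z 1) => // [w _|].
    by rewrite /e; field.
  apply: jet2M; first exact: jet2_cst.
  apply: jet2D; first by apply: jet2M; exact: jet2_id.
  by apply: jet2M; [exact: jet2_cst | exact: jet2_id].
have Hf : theta_like t f.
  split=> z; rewrite /f.
    have -> : t^-1 * z = t^-1 * (z + 1) + u by rewrite /u; ring.
    rewrite Sg_addt // (_ : e (z + 1) = e z + - (t^-1 * (z + 1)) + 1 / 2%:R).
      by rewrite !cexD cex_half; ring.
    by rewrite /e; field.
  have -> : t^-1 * (z + t) = t^-1 * z + 1 by field.
  rewrite Sg_add1 (_ : e (z + t) = e z + - z + 1 / 2%:R - 1).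
    have E w : cex (w - 1) = cex w by have := cex_addint w (-1); rewrite rmorphN1.
    by rewrite E !cexD cex_half; ring.
  by rewrite /e; field.
have fg z : f z = z * g z by rewrite /f Sg_Sg1 // /g; ring.
have fj z : jet2 f z.
  apply: jet2M (je z).
  by apply: (@jet2_comp _ (fun z => t^-1 * z) (fun z => Sg z u)) (jl z) _; exact: Sg_jet2.
have gj : jet2 g 0.
  apply: jet2M (je 0); apply: jet2M; first exact: jet2_cst.
  by apply: (@jet2_comp _ (fun z => t^-1 * z) (Sg1 u)) (jl 0) _; exact: Sg1_jet2.
have key := theta_unique t_gt0 Hf fg fj gj.
pose C0 := g 0 / Sg1 t 0.
have C00 : C0 != 0.
  apply: mulf_neq0; last by rewrite invr_eq0 Sg1_neq0.
  rewrite /g mulr0; apply: mulf_neq0; last exact: cex_neq0.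
  by apply: mulf_neq0; [rewrite invr_eq0 | exact: Sg1_neq0].
pose c := cex (- (t + t^-1) / 12%:R).
exists (C0 * c); first by rewrite mulf_neq0 ?cex_neq0.
move=> x1 x2; rewrite /sieg.
pose z := x2%:C * t + (- x1)%:C.
have Ez : x1%:C * u + x2%:C = t^-1 * z.
  by rewrite /u /z rmorphN /=; field.
have Sz : Sg (t^-1 * z) u = C0 * Sg z t * cex (- e z).
  by rewrite -key /f -mulrA -cexD subrr cex0 mulr1.
rewrite Ez Sz -/z.
have Ee : cex ((B2 x1 / 2)%:C * u) * cex (- e z) =
    c * ph ((x1 + x2) / 2 - x1 * x2) * cex ((B2 x2 / 2)%:C * t).
  rewrite /c /ph -!cexD; congr cex.
  rewrite !B2C /e /z /u rmorphN rmorphB !rmorphM rmorphD fmorphV rmorph_nat /=.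
  by field.
set s := Sg z t; set p := cex _ in Ee *; set q := cex (- _) in Ee *.
transitivity (C0 * s * (p * q)); first by ring.
by rewrite Ee; ring.
Qed.

End Laws.

(** * Expansion at infinity *)

Lemma psbound_scale a c (r : R) : psbound c r -> psbound (fun k => a * c k) r.
Proof.
move=> [B B0 H]; exists (nc a * B); first by rewrite mulr_ge0 ?nc_ge0.
by move=> k; rewrite ncM -mulrA; apply: ler_wpM2l (nc_ge0 _) _ _ (H k).
Qed.

Lemma pser_scale a c (r : R) z : 0 < r -> nc z < r -> psbound c r ->
  pser (fun k => a * c k) z = a * pser c z.
Proof.
move=> r0 zr Hc; apply: csum_eq.
apply: (cvgC_eventually (n0 := 0)) (cvgC_csumZ a (pserP r0 zr Hc)) => n _.
by apply: eq_bigr => k _; rewrite mulrA.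
Qed.

Lemma sieg_pser (a n : nat) (x2 : R) : (a < n)%N -> exists c,
  [/\ forall r : R, 0 <= r < 1 -> psbound c r,
      c 0%N = (if a == 0%N then 1 - ph x2 else 1) &
      forall t, 0 < complex.Im t ->
      sieg (a%:R / n%:R) x2 t =
        cex ((B2 (a%:R / n%:R) / 2)%:C * t) * pser c (cex (n%:R^-1 * t))].
Proof.
move=> an; have n0 : (0 < n)%N by case: (n) an.
have nn : (n%:R : R[i]) != 0 by rewrite pnatr_eq0 -lt0n.
have p1 x : nc (ph x) <= 1 by rewrite nc_ph.
have gen (a1 a2 : nat) (K : R[i]) : (0 < a1)%N -> (0 < a2)%N ->
   exists c, [/\ forall r : R, 0 <= r < 1 -> psbound c r, c 0%N = K &
     forall x, nc x < 1 -> K * (Eu (ph x2 * x ^+ a1) (x ^+ n) *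
       Eu (ph (- x2) * x ^+ a2) (x ^+ n)) = pser c x].
  move=> a10 a20; pose c1 := prod_coeff (ph x2) a1 n.
  pose c2 := prod_coeff (ph (- x2)) a2 n.
  have b1 r : 0 <= r < 1 -> psbound c1 r by exact: prod_coeff_bound.
  have b2 r : 0 <= r < 1 -> psbound c2 r by exact: prod_coeff_bound.
  have b12 (r : R) : 0 <= r < 1 -> psbound (cauchy_prod c1 c2) r.
    move=> /andP[r0 r1]; apply: (@psbound_le _ _ ((r + 1) / 2)); first lra.
    apply: (@psbound_cauchy _ _ _ ((r + 3) / 4)); first lra.
      by apply: b1; lra.
    by apply: b2; lra.
  exists (fun k => K * cauchy_prod c1 c2 k); split.
  - by move=> r /b12; exact: psbound_scale.
  - by rewrite /cauchy_prod big_ord1 /c1 /c2 !prod_coeff0 !mulr1.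
  move=> x x1; have x0 := nc_ge0 x.
  rewrite (@pser_scale _ _ ((nc x + 1) / 2)); [|lra|lra|by apply: b12; lra].
  rewrite (@pser_cauchy _ _ _ ((nc x + 1) / 2)); [|lra|by apply: b1; lra|by apply: b2; lra].
  by rewrite (Eu_pser (p1 _) a10 n0 x1) (Eu_pser (p1 _) a20 n0 x1).
have X t : 0 < complex.Im t -> nc (cex (n%:R^-1 * t)) < 1.
  move=> t0; apply: nc_cex_lt1.
  have -> : (n%:R^-1 : R[i]) = (n%:R^-1)%:C by rewrite fmorphV rmorph_nat.
  by rewrite Im_mulR mulr_gt0 // invr_gt0 ltr0n.
have Xq (t : R[i]) : cex (n%:R^-1 * t) ^+ n = cex t.
  have <- := cexMn (n%:R^-1 * t) n.
  by congr cex; field.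
have Xa (t : R[i]) : cex (n%:R^-1 * t) ^+ a = cex ((a%:R / n%:R)%:C * t).
  have <- := cexMn (n%:R^-1 * t) a.
  by congr cex; rewrite mulrA rmorphM fmorphV !rmorph_nat.
case: (posnP a) => [a0|a0].
  have [c [Hc c0 Hx]] := gen n n (1 - ph x2) n0 n0.
  exists c; split=> // t t0.
  rewrite -(Hx _ (X _ t0)) Xq /sieg /Sg a0 mul0r rmorph0 mul0r add0r.
  rewrite (Eu_step (cex x2%:C) (nc_cex_lt1 t0)).
  have -> : cex (t - x2%:C) = ph (- x2) * cex t by rewrite addrC cexD /ph rmorphN.
  by rewrite (mulrC (cex t)) -mulrA.
have na : (0 < n - a)%N by rewrite subn_gt0.
have [c [Hc c0 Hx]] := gen a (n - a)%N 1 a0 na.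
exists c; split=> // t t0.
rewrite -(Hx _ (X _ t0)) Xq mul1r /sieg /Sg; congr (_ * (Eu _ _ * Eu _ _)).
  by rewrite Xa addrC cexD.
have -> : cex (n%:R^-1 * t) ^+ (n - a) = cex t * cex (- ((a%:R / n%:R)%:C * t)).
  apply: (mulIf (cex_neq0 ((a%:R / n%:R)%:C * t))).
  by rewrite -{1}Xa -exprD subnK ?(ltnW an) // Xq -mulrA -cexD addNr cex0 mulr1.
by rewrite opprD cexD /ph rmorphN [in LHS]cexD; ring.
Qed.

End SiegelProducts.
Section WeberFunctions.
Variable R : realType.
Implicit Types (z w h l : R[i]) (u v : nat -> R[i]).
Notation nc := (@ComplexField.Normc.normc R).
Arguments ComplexField.Normc.normc : simpl never.
(** * Continuation along segments of the half-plane *)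

Lemma half_plane_open t : 0 < complex.Im t ->
  forall w, nc (w - t) < complex.Im t -> 0 < complex.Im w.
Proof.
move=> t0 w; have := Im_le_nc (w - t); rewrite ImD ImN.
by rewrite ler_norml => /andP[]; lra.
Qed.

(** Along the segment from t0 to t the real part of f cannot cross 1 / 2.  This applies
    to functions whose values are square or cube roots of unity. *)
Lemma discrete_const (f : R[i] -> R[i]) t0 :
  (forall t, 0 < complex.Im t -> contC f t) ->
  (forall t, 0 < complex.Im t -> f t = 1 \/ complex.Re (f t) <= 0) ->
  0 < complex.Im t0 -> f t0 = 1 -> forall t, 0 < complex.Im t -> f t = 1.
Proof.
move=> Hc Hd t00 f0 t tgt0; have [//|ft] := Hd t tgt0.
pose p (s : R) := t0 + s%:C * (t - t0).
pose phi (s : R) := complex.Re (f (p s)).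
have pIm s : 0 <= s <= 1 -> 0 < complex.Im (p s).
  move=> s01; rewrite /p ImD Im_mulR ImD ImN; nra.
have cphi : {within `[0 : R, 1], continuous phi}%classic.
  apply: continuous_in_subspaceT => s; rewrite inE /= in_itv /= => s01.
  apply/cvgrPdist_lt => e e0.
  have [d d0 Hd'] := Hc _ (pIm _ s01) e e0.
  have K0 : 0 < nc (t - t0) + 1 by have := nc_ge0 (t - t0); lra.
  apply/nbhs_ballP; exists (d / (nc (t - t0) + 1)); first exact: divr_gt0.
  move=> s' /=; rewrite /ball /= ltr_pdivlMr // distrC => hs.
  rewrite distrC -ReN -ReD; apply: le_lt_trans (Re_le_nc _) _; apply: Hd'.
  have -> : p s' - p s = (s' - s)%:C * (t - t0) by rewrite /p rmorphB /=; ring.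
  rewrite ncM ncR; apply: le_lt_trans hs; apply: ler_wpM2l => //; lra.
have p0 : phi 0 = 1 by rewrite /phi /p rmorph0 mul0r addr0 f0.
have p1 : phi 1 <= 0 by rewrite /phi /p rmorph1 mul1r addrCA subrr addr0.
have [|s] := IVT (v := 1 / 2) ler01 cphi.
  by rewrite p0 ge_min le_max; apply/andP; split; apply/orP; [right | left]; lra.
rewrite in_itv /= => s01 E; have [E1|E1] := Hd _ (pIm _ s01).
  by move: E; rewrite /phi E1 /= => E; exfalso; lra.
by move: E; rewrite /phi => E; exfalso; lra.
Qed.

Lemma i_gt0 : 0 < complex.Im ('i : R[i]).
Proof. by rewrite /= ltr01. Qed.

Lemma invi : - 'i^-1 = 'i :> R[i].
Proof.
have i0 : ('i : R[i]) != 0 by rewrite eq_complex /= eqxx oner_eq0.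
by apply: (mulIf i0); rewrite mulNr mulVf // -expr2 sqr_i.
Qed.

(** * The Weber functions *)

(** web0 and web1 are Weber's functions f and f_1, and web2 is f_2 over sqrt 2.  They
    are square roots of the Siegel products at the 2-torsion characteristics, up to
    a factor 2 for web2. *)
Definition web (s : R[i]) (t : R[i]) : R[i] := cex ((- 1 / 48%:R) * t) * Eu (s * cex (1 / 2%:R * t)) (cex t).
Definition web0 := web (-1).
Definition web1 := web 1.
Definition web2 (t : R[i]) : R[i] := cex (1 / 24%:R * t) * Eu (- cex t) (cex t).

Lemma cex_half2 t : cex (1 / 2%:R * t) * cex (1 / 2%:R * t) = cex t :> R[i].
Proof. by rewrite -cexD; congr cex; field. Qed.

Section Weber.
Variable t : R[i].
Hypothesis t_gt0 : 0 < complex.Im t.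
Let q_lt1 : nc (cex t) < 1.
Proof. exact: nc_cex_lt1. Qed.
Let h_lt1 : nc (cex (1 / 2%:R * t)) < 1.
Proof.
apply: nc_cex_lt1; rewrite (_ : (1 / 2%:R : R[i]) = (1 / 2)%:C).
  by rewrite Im_mulR mulr_gt0 //; lra.
by rewrite rmorphM fmorphV rmorph1 rmorph_nat.
Qed.

Lemma Eu_neq0 w : nc w < 1 -> Eu w (cex t) != 0.
Proof.
move=> w1; apply/eqP => /(Eu_eq0 q_lt1)[n] /(congr1 nc).
rewrite ncM ncX nc1 => E; have q0 := nc_ge0 (cex t); have w0 := nc_ge0 w.
have : nc (cex t) ^+ n <= 1 by rewrite exprn_ile1 // ltW.
by have := exprn_ge0 n q0; nra.
Qed.

Lemma web_neq0 s : s = 1 \/ s = -1 -> web s t != 0.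
Proof.
move=> s1; rewrite mulf_neq0 ?cex_neq0 // Eu_neq0 // ncM.
by case: s1 => ->; rewrite ?ncN nc1 mul1r.
Qed.

Lemma web2_neq0 : web2 t != 0.
Proof. by rewrite mulf_neq0 ?cex_neq0 // Eu_neq0 // ncN. Qed.

Lemma B2_half : B2 (1 / 2 : R) = - 1 / 12. Proof. by rewrite /B2; field. Qed.
Lemma B2_0 : B2 (0 : R) = 1 / 6. Proof. by rewrite /B2; field. Qed.

Lemma sieg_web1 : sieg (1 / 2) 0 t = web1 t ^+ 2.
Proof.
rewrite /sieg B2_half /web1 /web (mul1r (cex _)) /Sg rmorph0 addr0.
have E : (1 / 2 : R)%:C = 1 / 2%:R by rewrite rmorphM fmorphV rmorph1 rmorph_nat.
rewrite E (_ : t - 1 / 2%:R * t = 1 / 2%:R * t); last by field.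
rewrite exprMn -expr2; congr (_ * _).
rewrite expr2 -cexD; congr cex.
rewrite (_ : (- 1 / 12 / 2 : R) = - 1 / 24); last by field.
by rewrite rmorphM fmorphV rmorphN rmorph1 rmorph_nat; field.
Qed.

Lemma sieg_web0 : sieg (1 / 2) (1 / 2) t = web0 t ^+ 2.
Proof.
rewrite /sieg B2_half /web0 /web /Sg.
have E : (1 / 2 : R)%:C = 1 / 2%:R by rewrite rmorphM fmorphV rmorph1 rmorph_nat.
rewrite E (_ : t - (1 / 2%:R * t + 1 / 2%:R) = 1 / 2%:R * t + 1 / 2%:R - 1); last by field.
have E1 w : cex (w - 1) = cex w by have := cex_addint w (-1); rewrite rmorphN1.
have E2 : cex (1 / 2%:R * t + 1 / 2%:R) = - 1 * cex (1 / 2%:R * t).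
  by rewrite addrC cexD cex_half.
rewrite E1 E2 exprMn -expr2; congr (_ * _).
rewrite expr2 -cexD; congr cex.
rewrite (_ : (- 1 / 12 / 2 : R) = - 1 / 24); last by field.
by rewrite rmorphM fmorphV rmorphN rmorph1 rmorph_nat; field.
Qed.

Lemma sieg_web2 : sieg 0 (1 / 2) t = 2%:R * web2 t ^+ 2.
Proof.
rewrite /sieg B2_0 /web2 /Sg rmorph0 mul0r add0r.
have E : (1 / 2 : R)%:C = 1 / 2%:R by rewrite rmorphM fmorphV rmorph1 rmorph_nat.
rewrite E.
have E1 : cex (t - 1 / 2%:R) = - cex t.
  rewrite cexD cexN cex_half invrN invr1; ring.
rewrite E1 cex_half (Eu_step (-1) q_lt1) exprMn mulrN mulr1.
have -> : cex (1 / 24%:R * t) ^+ 2 = cex ((1 / 6 / 2)%:C * t).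
  rewrite expr2 -cexD; congr cex.
  rewrite (_ : (1 / 6 / 2 : R) = 1 / 12); last by field.
  by rewrite rmorphM fmorphV rmorph1 rmorph_nat; field.
by ring.
Qed.

(** With q = s ^ 2: the first two factors give the product of the 1 - q ^ (2 n + 1), which
    multiplied by the product of the 1 + q ^ (n + 1) is 1, by an identity of Euler that
    holds up to doubling for the partial products. *)
Lemma Eu_prod3 (s : R[i]) : s * s = cex t ->
  Eu s (cex t) * Eu (- s) (cex t) * Eu (- cex t) (cex t) = 1.
Proof.
set q := cex t => sq.
have q21 : nc (q * q) < 1 by rewrite ncM; have := nc_ge0 q; have := q_lt1; rewrite -/q; nra.
have P1 n : eprod s q n * eprod (- s) q n = eprod q (q * q) n.
  rewrite /eprod -big_split /=; apply: eq_bigr => k _.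
  transitivity (1 - q ^+ k * q ^+ k * (s * s)); first by ring.
  by rewrite sq exprMn.
have P2 n : eprod q (q * q) n * eprod (q * q) (q * q) n = eprod q q n.*2.
  elim: n => [|n IH]; first by rewrite /eprod !big_ord0 mul1r.
  have eS (w p : R[i]) m : eprod w p m.+1 = eprod w p m * (1 - p ^+ m * w).
    by rewrite /eprod big_ord_recr.
  rewrite doubleS !eS -IH.
  have -> : (q * q) ^+ n = q ^+ n.*2 by rewrite -expr2 -exprM mul2n.
  by rewrite exprS; ring.
have P3 n : eprod q q n * eprod (- q) q n = eprod (q * q) (q * q) n.
  rewrite /eprod -big_split /=; apply: eq_bigr => k _.
  by rewrite exprMn; ring.
have E1 : Eu s q * Eu (- s) q = Eu q (q * q).
  apply: cvgC_unique (cvgCM (eprod_cvg s q_lt1) (eprod_cvg (- s) q_lt1)) _.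
  by apply: (cvgC_eventually (n0 := 0)) (eprod_cvg q q21) => n _; rewrite P1.
have E2 : Eu q (q * q) * Eu (q * q) (q * q) = Eu q q.
  apply: cvgC_unique (cvgCM (eprod_cvg q q21) (eprod_cvg (q * q) q21)) _.
  have dn n : (n <= n.*2)%N by rewrite -addnn leq_addr.
  apply: (cvgC_eventually (n0 := 0)) (cvgC_sub (f := double) dn (eprod_cvg q q_lt1)) => n _.
  by rewrite P2.
have E3 : Eu q q * Eu (- q) q = Eu (q * q) (q * q).
  apply: cvgC_unique (cvgCM (eprod_cvg q q_lt1) (eprod_cvg (- q) q_lt1)) _.
  by apply: (cvgC_eventually (n0 := 0)) (eprod_cvg (q * q) q21) => n _; rewrite P3.
have N0 : Eu (q * q) (q * q) != 0.
  apply/eqP => /(Eu_eq0 q21)[n] /(congr1 nc); rewrite -exprSr ncX nc1 => E.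
  have : nc (q * q) ^+ n.+1 <= nc (q * q) by rewrite exprS ler_piMr ?nc_ge0 // exprn_ile1 ?nc_ge0 // ltW.
  by rewrite E; lra.
apply: (mulfI N0); rewrite mulr1 -[in RHS]E3 -E2 E1; ring.
Qed.

Lemma web_prod : web0 t * web1 t * web2 t = 1.
Proof.
have := Eu_prod3 (cex_half2 t); rewrite /web0 /web1 /web /web2 (mul1r (cex _)) (mulN1r (cex _)).
set a := Eu _ _; set b := Eu _ _; set c := Eu _ _ => E.
have E2 : cex (- 1 / 48%:R * t) * cex (- 1 / 48%:R * t) * cex (1 / 24%:R * t) = 1.
  by rewrite -!cexD (_ : _ + _ = 0); [exact: cex0 | field].
transitivity (cex (- 1 / 48%:R * t) * cex (- 1 / 48%:R * t) * cex (1 / 24%:R * t) *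
  (a * b * c)); first by ring.
by rewrite E2 E mulr1.
Qed.

Lemma web_T s : web s (t + 1) = ph (- 1 / 48) * web (- s) t.
Proof.
rewrite /web [cex (t + 1)]cexD cex1 mulr1.
have -> : cex (1 / 2%:R * (t + 1)) = - cex (1 / 2%:R * t).
  by rewrite mulrDr mulr1 cexD cex_half; ring.
rewrite mulrDr mulr1 cexD (mulrN s) (mulNr s).
by rewrite /ph rmorphM fmorphV rmorphN rmorph1 rmorph_nat; ring.
Qed.

Lemma web2_T : web2 (t + 1) = ph (1 / 24) * web2 t.
Proof.
rewrite /web2 [cex (t + 1)]cexD cex1 mulr1 mulrDr mulr1 cexD.
by rewrite /ph rmorphM fmorphV rmorph1 rmorph_nat; ring.
Qed.
End Weber.

Lemma cex_lin_jet2 (a : R[i]) t : jet2 (fun t => cex (a * t)) t.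
Proof.
apply: (@jet2_comp _ (fun t => a * t) (@cex R)); last exact: cex_jet2.
by apply: jet2M; [exact: jet2_cst | exact: jet2_id].
Qed.

Lemma pser_cex_jet2 c (a : R) t : (forall r : R, 0 <= r < 1 -> psbound c r) ->
  0 < a -> 0 < complex.Im t -> jet2 (fun t => pser c (cex (a%:C * t))) t.
Proof.
move=> Hc a0 t0.
apply: (@jet2_comp _ (fun t => cex (a%:C * t)) (pser c)); first exact: cex_lin_jet2.
have x1 : nc (cex (a%:C * t)) < 1 by apply: nc_cex_lt1; rewrite Im_mulR mulr_gt0.
have x0 := nc_ge0 (cex (a%:C * t)).
apply: (@pser_jet2 _ _ ((nc (cex (a%:C * t)) + 1) / 2)); [lra|lra|].
by apply: Hc; lra.
Qed.

Lemma sieg_jet2 (a n : nat) (x2 : R) t : (a < n)%N -> 0 < complex.Im t ->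
  jet2 (sieg (a%:R / n%:R) x2) t.
Proof.
move=> an t0; have [c [Hc _ Hs]] := sieg_pser x2 an.
apply: (@jet2_ext _ (fun t => cex ((B2 (a%:R / n%:R) / 2)%:C * t) *
   pser c (cex ((n%:R^-1)%:C * t))) _ t _ t0) => [w wt|].
  by rewrite (Hs _ (half_plane_open t0 wt)) fmorphV rmorph_nat.
apply: jet2M; first exact: cex_lin_jet2.
by apply: pser_cex_jet2 => //; rewrite invr_gt0 ltr0n; case: (n) an.
Qed.

Lemma web_pser s : s = 1 \/ s = -1 -> exists c,
  [/\ forall r : R, 0 <= r < 1 -> psbound c r, c 0%N = 1 &
  forall t, 0 < complex.Im t ->
    web s t = cex ((- 1 / 48)%:C * t) * pser c (cex ((2%:R^-1)%:C * t))].
Proof.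
move=> s1; have ns : nc s <= 1 by case: s1 => ->; rewrite ?ncN nc1.
exists (prod_coeff s 1 2); split.
- by move=> r; exact: prod_coeff_bound.
- exact: prod_coeff0.
move=> t t0; rewrite -(Eu_pser ns) //; last first.
  by apply: nc_cex_lt1; rewrite Im_mulR mulr_gt0.
rewrite expr1 expr2 -cexD /web.
have E1 : (- 1 / 48)%:C = (- 1 / 48%:R) :> R[i].
  by rewrite rmorphM fmorphV rmorphN rmorph1 rmorph_nat.
have E2 : (2%:R^-1)%:C = 1 / 2%:R :> R[i] by rewrite fmorphV rmorph_nat mul1r.
by rewrite E1 E2 cexD cex_half2.
Qed.

Lemma web2_pser : exists c,
  [/\ forall r : R, 0 <= r < 1 -> psbound c r, c 0%N = 1 &
  forall t, 0 < complex.Im t ->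
    web2 t = cex ((1 / 24)%:C * t) * pser c (cex ((1%:R^-1)%:C * t))].
Proof.
have ns : nc (-1) <= 1 by rewrite ncN nc1.
exists (prod_coeff (-1) 1 1); split.
- by move=> r; exact: prod_coeff_bound.
- exact: prod_coeff0.
move=> t t0; have E2 : (1%:R^-1)%:C * t = t by rewrite invr1 rmorph1 mul1r.
rewrite E2 -(Eu_pser ns) //; last exact: nc_cex_lt1.
have E1 : (1 / 24)%:C = (1 / 24%:R) :> R[i].
  by rewrite rmorphM fmorphV rmorph1 rmorph_nat.
by rewrite E1 !expr1 mulN1r.
Qed.

Lemma web_jet2 s t : s = 1 \/ s = -1 -> 0 < complex.Im t -> jet2 (web s) t.
Proof.
move=> /web_pser[c [Hc _ Hs]] t0.
apply: (@jet2_ext _ (fun t => cex ((- 1 / 48)%:C * t) *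
   pser c (cex ((2%:R^-1)%:C * t))) _ t _ t0) => [w wt|].
  by rewrite (Hs _ (half_plane_open t0 wt)).
apply: jet2M; first exact: cex_lin_jet2.
by apply: pser_cex_jet2 => //; rewrite invr_gt0.
Qed.

Lemma web2_jet2 t : 0 < complex.Im t -> jet2 web2 t.
Proof.
move=> t0; have [c [Hc _ Hs]] := web2_pser.
apply: (@jet2_ext _ (fun t => cex ((1 / 24)%:C * t) *
   pser c (cex ((1%:R^-1)%:C * t))) _ t _ t0) => [w wt|].
  by rewrite (Hs _ (half_plane_open t0 wt)).
apply: jet2M; first exact: cex_lin_jet2.
by apply: pser_cex_jet2 => //; rewrite invr_gt0.
Qed.

Lemma inv_half_jet2 t : 0 < complex.Im t -> jet2 (fun t : R[i] => - t^-1) t.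
Proof.
move=> t0; apply: (@jet2_ext _ (fun t => - 1 * t^-1) _ t 1) => // [w _|].
  by rewrite mulN1r.
by apply: jet2M; [exact: jet2_cst | apply: jet2_inv; exact: half_plane_neq0].
Qed.

Let one_or : (1 : R[i]) = 1 \/ (1 : R[i]) = -1. Proof. by left. Qed.
Let mone_or : (-1 : R[i]) = 1 \/ (-1 : R[i]) = -1. Proof. by right. Qed.

Lemma cube_root_re (z : R[i]) : z ^+ 3 = 1 -> z = 1 \/ complex.Re z <= 0.
Proof.
move=> z3; have /eqP : (z - 1) * (z ^+ 2 + z + 1) = 0.
  by transitivity (z ^+ 3 - 1); [ring | rewrite z3 subrr].
rewrite mulf_eq0 subr_eq0 => /orP[/eqP ->|/eqP]; first by left.
case: z {z3} => a b; rewrite expr2 => -[/= E1 E2]; right.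
have : b * (2 * a + 1) = 0 by rewrite -E2; ring.
by move=> /eqP; rewrite mulf_eq0 => /orP[] /eqP b0; [rewrite b0 in E1; nra | lra].
Qed.

Lemma sqr_root_re (z : R[i]) : z ^+ 2 = 1 -> z = 1 \/ complex.Re z <= 0.
Proof.
move=> /eqP; rewrite sqrf_eq1 => /orP[] /eqP ->; first by left.
by right => /=; lra.
Qed.

(** The constant of the S-law.  S permutes the three 2-torsion characteristics, and the
    product of the three Siegel products there is 2 whatever t, since f f_1 f_2 is
    sqrt 2.  So the cube of the constant, suitably normalised, is 1; it is continuous
    in t, and it is 1 at the fixed point i of S. *)
Lemma sieg_S (t : R[i]) (x1 x2 : R) : 0 < complex.Im t ->
  sieg x1 x2 (- t^-1) = - 'i * ph ((x1 + x2) / 2 - x1 * x2) * sieg x2 (- x1) t.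
Proof.
move: t x1 x2; pose D t := (web0 (- t^-1) / web0 t) ^+ 2.
have key t : 0 < complex.Im t -> D t ^+ 3 = 1 /\ forall x1 x2 : R,
  sieg x1 x2 (- t^-1) = D t * - 'i * ph ((x1 + x2) / 2 - x1 * x2) * sieg x2 (- x1) t.
  move=> t0; have u0 := half_planeV t0.
  have [C C0 HC] := sieg_S0 t0.
  have N1 (y1 y2 : R) := sieg_perZ2 t y1 y2 (-1).
  have A1 := HC (1 / 2) (1 / 2); have A2 := HC (1 / 2) 0; have A3 := HC 0 (1 / 2).
  have E1 : (1 / 2 + 1 / 2) / 2 - 1 / 2 * (1 / 2) = 1 / 4 :> R by field.
  have E2 : (1 / 2 + 0) / 2 - 1 / 2 * 0 = 1 / 4 :> R by field.
  have E3 : (0 + 1 / 2) / 2 - 0 * (1 / 2) = 1 / 4 :> R by field.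
  have M : - (1 / 2) = 1 / 2 + (-1)%:~R :> R by rewrite rmorphN1; field.
  rewrite E1 ph_quarter M (N1 (1 / 2)) !sieg_web0 // in A1.
  rewrite E2 ph_quarter M (N1 0) sieg_web1 // sieg_web2 // in A2.
  rewrite E3 ph_quarter oppr0 sieg_web1 // sieg_web2 // in A3.
  have w0 := web_neq0 t0 mone_or; have DC : D t = C * 'i.
    by rewrite /D expr_div_n A1 mulfK // expf_neq0.
  have ii : 'i * - 'i = 1 :> R[i] by rewrite mulrN -expr2 sqr_i opprK.
  have Cii : C * 'i * - 'i = C by rewrite -mulrA ii mulr1.
  split; last by move=> x1 x2; rewrite HC DC Cii.
  have P1 := web_prod t0; have P2 := web_prod u0.
  have P3 : web0 (- t^-1) ^+ 2 * web1 (- t^-1) ^+ 2 * (2%:R * web2 (- t^-1) ^+ 2) = 2%:R.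
    by transitivity (2%:R * (web0 (- t^-1) * web1 (- t^-1) * web2 (- t^-1)) ^+ 2);
      [ring | rewrite P2; ring].
  have n2 : (2%:R : R[i]) != 0 by rewrite pnatr_eq0.
  apply: (mulIf n2); rewrite mul1r -[in RHS]P3 A1 A2 A3 -DC.
  transitivity (D t ^+ 3 * 2%:R * (web0 t * web1 t * web2 t) ^+ 2); last by ring.
  by rewrite P1 expr1n mulr1.
move=> t x1 x2 t0; suff D1 : D t = 1 by have [_ H] := key t t0; rewrite H D1 mul1r.
have w0 s : 0 < complex.Im s -> web0 s != 0 by move=> s0; apply: web_neq0 => //; right.
apply: (@discrete_const D 'i) => // [s s0|s s0|].
- apply: jet2_cont; rewrite /D; apply: (@jet2_comp _ (fun t => web0 (- t^-1) / web0 t) (fun w => w ^+ 2)).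
    apply: jet2M; last by apply: jet2V; [exact: w0 | exact: web_jet2].
    by apply: (jet2_comp (inv_half_jet2 s0)); apply: web_jet2 => //; exact: half_planeV.
  by apply: (@jet2_ext _ (fun w => w * w) _ _ 1) => //; apply: jet2M; exact: jet2_id.
- by apply: cube_root_re; have [] := key s s0.
by rewrite /D invi divff ?expr1n // w0 // i_gt0.
Qed.

Lemma web0_S t : 0 < complex.Im t -> web0 (- t^-1) = web0 t.
Proof.
move=> t0; have w0 s : 0 < complex.Im s -> web0 s != 0 by move=> s0; apply: web_neq0 => //; right.
suff /(congr1 (fun x => x * web0 t)) : web0 (- t^-1) / web0 t = 1.
  by rewrite divfK ?w0 // mul1r.
apply: (@discrete_const (fun t => web0 (- t^-1) / web0 t) 'i) => // [s s0|s s0|].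
- apply: jet2_cont; apply: jet2M; last by apply: jet2V; [exact: w0 | exact: web_jet2].
  by apply: (jet2_comp (inv_half_jet2 s0)); apply: web_jet2 => //; exact: half_planeV.
- apply: sqr_root_re; rewrite expr_div_n -!sieg_web0 ?half_planeV // sieg_S //.
  have -> : (1 / 2 + 1 / 2) / 2 - 1 / 2 * (1 / 2) = 1 / 4 :> R by field.
  have -> : - (1 / 2) = 1 / 2 + (-1)%:~R :> R by rewrite rmorphN1; field.
  rewrite sieg_perZ2 // ph_quarter mulNr -expr2 sqr_i opprK (mul1r (sieg _ _ _)) divff //.
  by rewrite sieg_web0 // expf_neq0 // w0.
by rewrite invi divff // w0 // i_gt0.
Qed.

Lemma cvgC_real_ge0 (x : nat -> R) l : (forall n, 0 <= x n) ->
  cvgC (fun n => (x n)%:C) l -> 0 <= complex.Re l /\ complex.Im l = 0.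
Proof.
move=> x0 Hl; split.
  rewrite leNgt; apply/negP => l0; have [|n0 H] := Hl (- complex.Re l); first lra.
  have := H n0 (leqnn _); have := Re_le_nc ((x n0)%:C - l); rewrite ReD ReN /=.
  by rewrite ler_norml => /andP[_]; have := x0 n0; lra.
apply/eqP/negPn/negP => l0; have [|n0 H] := Hl `|complex.Im l|; first by rewrite normr_gt0.
have := H n0 (leqnn _); have := Im_le_nc ((x n0)%:C - l); rewrite ImD ImN /=.
by rewrite add0r normrN; lra.
Qed.

Lemma Eu_real (w q : R) : w <= 1 -> 0 <= q < 1 ->
  0 <= complex.Re (Eu w%:C q%:C) /\ complex.Im (Eu w%:C q%:C) = 0.
Proof.
move=> w1 /andP[q0 q1]; have q1' : nc q%:C < 1 by rewrite ncR ger0_norm.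
apply: (@cvgC_real_ge0 (fun n => \prod_(k < n) (1 - q ^+ k * w))).
  move=> n; apply: prodr_ge0 => k _; have := exprn_ge0 k q0.
  have : q ^+ k <= 1 by rewrite exprn_ile1 // ltW.
  nra.
apply: (cvgC_eventually (n0 := 0)) (eprod_cvg w%:C q1') => n _.
rewrite /eprod rmorph_prod; apply: eq_bigr => k _.
by rewrite rmorphB rmorph1 rmorphM rmorphXn.
Qed.

Lemma cex_imag (r : R) : cex (r%:C * 'i) = (expR (- (2 * pi * r)))%:C.
Proof.
rewrite cex.unlock /e2pi (_ : _ * _ = (- (2 * pi * r))%:C); last first.
  by apply/eqP; rewrite eq_complex /=; apply/andP; split; apply/eqP; ring.
by rewrite /cexp /= cos0 sin0 mulr1.
Qed.

Lemma prod_real (a : R) z : 0 <= a -> 0 <= complex.Re z /\ complex.Im z = 0 ->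
  0 <= complex.Re (a%:C * z) /\ complex.Im (a%:C * z) = 0.
Proof.
move=> a0 [z0 z1]; rewrite Im_mulR z1 mulr0; split=> //.
by case: z z0 z1 => x y /= z0 ->; rewrite mul0r subr0 mulr_ge0.
Qed.

Lemma web1_i : 0 <= complex.Re (web1 'i) /\ complex.Im (web1 'i) = 0.
Proof.
rewrite /web1 /web (mul1r (cex _)).
have E1 : (- 1 / 48%:R) = (- 1 / 48)%:C :> R[i].
  by rewrite rmorphM fmorphV rmorphN rmorph1 rmorph_nat.
have E2 : 1 / 2%:R = (1 / 2)%:C :> R[i] by rewrite rmorphM fmorphV rmorph1 rmorph_nat.
have E3 : cex 'i = cex (1%:C * 'i) :> R[i] by rewrite mul1r.
have p0 := @pi_gt0 R.
rewrite E1 E2 E3 !cex_imag; apply: prod_real; first exact: expR_ge0.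
by apply: Eu_real; rewrite ?expR_ge0 ?expR_le1 ?expR_lt1; lra.
Qed.

Lemma web2_i : 0 <= complex.Re (web2 'i) /\ complex.Im (web2 'i) = 0.
Proof.
rewrite /web2.
have E2 : 1 / 24%:R = (1 / 24)%:C :> R[i] by rewrite rmorphM fmorphV rmorph1 rmorph_nat.
have E3 : cex 'i = cex (1%:C * 'i) :> R[i] by rewrite mul1r.
have p0 := @pi_gt0 R.
rewrite E2 E3 !cex_imag; apply: prod_real; first exact: expR_ge0.
rewrite -rmorphN; have e0 := expR_ge0 (- (2 * pi * 1) : R).
by apply: Eu_real; rewrite ?expR_ge0 ?expR_lt1; lra.
Qed.

Definition sqrt2 : R[i] := (Num.sqrt 2)%:C.

Lemma sqrt2_sq : sqrt2 ^+ 2 = 2%:R.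
Proof. by rewrite /sqrt2 -rmorphXn sqr_sqrtr ?rmorph_nat. Qed.

Lemma sqrt2_neq0 : sqrt2 != 0.
Proof. by rewrite -sqrf_eq0 sqrt2_sq pnatr_eq0. Qed.

(** Squaring turns this into the S-law of Siegel products, so the two sides agree up to
    a sign that does not depend on t.  At t = i both are nonnegative reals, being
    products of reals, so the sign is 1. *)
Lemma web1_S t : 0 < complex.Im t -> web1 (- t^-1) = sqrt2 * web2 t.
Proof.
move=> t0; pose r t := web1 (- t^-1) / (sqrt2 * web2 t).
have w2 s : 0 < complex.Im s -> sqrt2 * web2 s != 0.
  by move=> s0; rewrite mulf_neq0 ?sqrt2_neq0 ?web2_neq0.
suff E : r t = 1 by rewrite -[LHS](divfK (w2 t t0)) -/(r t) E mul1r.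
have r2 s : 0 < complex.Im s -> r s ^+ 2 = 1.
  move=> s0; rewrite /r expr_div_n -sieg_web1 ?half_planeV // sieg_S // exprMn sqrt2_sq.
  have -> : (1 / 2 + 0) / 2 - 1 / 2 * 0 = 1 / 4 :> R by field.
  have -> : - (1 / 2) = 1 / 2 + (-1)%:~R :> R by rewrite rmorphN1; field.
  rewrite sieg_perZ2 // ph_quarter mulNr -expr2 sqr_i opprK (mul1r (sieg _ _ _)) sieg_web2 // divff //.
  by rewrite -sqrt2_sq -exprMn expf_neq0 // w2.
apply: (@discrete_const r 'i) => // [s s0|s s0|].
- apply: jet2_cont; apply: jet2M; last first.
    apply: jet2V; first exact: w2.
    by apply: jet2M; [exact: jet2_cst | exact: web2_jet2].
  by apply: (jet2_comp (inv_half_jet2 s0)); apply: web_jet2 => //; exact: half_planeV.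
- exact/sqr_root_re/r2.
have /eqP := r2 _ i_gt0; rewrite sqrf_eq1 => /orP[/eqP //|/eqP E].
have W : web1 'i = - (sqrt2 * web2 'i).
  by rewrite -[LHS](divfK (w2 _ i_gt0)) -{1}invi -/(r 'i) E mulN1r.
have [a1 a2] := web1_i; have [b1 b2] := prod_real (sqrtr_ge0 2) web2_i.
have : web1 'i != 0 by apply: web_neq0; [exact: i_gt0 | left].
suff -> : web1 'i = 0 by rewrite eqxx.
apply: complex_eq => //=.
by have := congr1 (@complex.Re R) W; rewrite ReN -/sqrt2 in b1 *; lra.
Qed.

Lemma web2_S t : 0 < complex.Im t -> web2 (- t^-1) = sqrt2^-1 * web1 t.
Proof.
move=> t0; have := web1_S (half_planeV t0); rewrite invrN opprK invrK => ->.
by rewrite mulKf // sqrt2_neq0.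
Qed.

End WeberFunctions.
(** * Generation of the modular group *)

Lemma int_mul_eq1 (a d : int) : a * d = 1 -> (a = 1 /\ d = 1) \/ (a = -1 /\ d = -1).
Proof.
move=> ad; have /eqP : (`|a| * `|d| = 1)%N by rewrite -abszM ad.
rewrite muln_eq1 => /andP[/eqP a1 /eqP d1].
have [a2|a2] : a = 1 \/ a = -1 by lia.
  by left; move: ad; rewrite a2 mul1r.
by right; move: ad; rewrite a2; lia.
Qed.

(** T and S acting on the left generate SL2(Z): they run the Euclidean algorithm on the
    first column. *)
Lemma SL2_ind (P : int -> int -> int -> int -> Prop) :
  P 1 0 0 1 ->
  (forall a b c d, a * d - b * c = 1 -> P a b c d -> P (a + c) (b + d) c d) ->
  (forall a b c d, a * d - b * c = 1 -> P (a + c) (b + d) c d -> P a b c d) ->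
  (forall a b c d, a * d - b * c = 1 -> P a b c d -> P (- c) (- d) a b) ->
  forall a b c d, a * d - b * c = 1 -> P a b c d.
Proof.
move=> P1 PT PTi PS.
have PTn (n : nat) a b c d : a * d - b * c = 1 ->
    (P a b c d <-> P (a + n%:Z * c) (b + n%:Z * d) c d).
  elim: n => [|n IH] det; first by rewrite !mul0r !addr0.
  have det' : (a + n%:Z * c) * d - (b + n%:Z * d) * c = 1 by rewrite -[RHS]det; ring.
  have -> : a + n.+1%:Z * c = a + n%:Z * c + c by rewrite -addn1 PoszD; ring.
  have -> : b + n.+1%:Z * d = b + n%:Z * d + d by rewrite -addn1 PoszD; ring.
  split; first by move/(IH det); exact: PT.
  by move/(PTi _ _ _ _ det')/(IH det).
have PTz (t : int) a b c d : a * d - b * c = 1 ->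
    (P a b c d <-> P (a + t * c) (b + t * d) c d).
  case: t => n det; first exact: PTn.
  rewrite NegzE; set a' := a + _; set b' := b + _.
  have det' : a' * d - b' * c = 1 by rewrite -[RHS]det /a' /b'; ring.
  have H := PTn n.+1 a' b' c d det'.
  have Ea : a' + n.+1%:Z * c = a by rewrite /a'; ring.
  have Eb : b' + n.+1%:Z * d = b by rewrite /b'; ring.
  by rewrite Ea Eb in H; split; move/H.
have PSi a b c d : a * d - b * c = 1 -> P (- c) (- d) a b -> P a b c d.
  move=> det H.
  have H1 := PS (- c) (- d) a b ltac:(lia) H.
  have H2 := PS (- a) (- b) (- c) (- d) ltac:(lia) H1.
  by have := PS (- - c) (- - d) (- a) (- b) ltac:(lia) H2; rewrite !opprK.
suff H (n : nat) a b c d : (`|c| <= n)%N -> a * d - b * c = 1 -> P a b c d.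
  by move=> a b c d; exact: (H `|c|%N).
elim: n a b c d => [|n IH] a b c d cn det.
  have c0 : c = 0 by lia.
  subst c; have [[-> ->]|[-> ->]] : (a = 1 /\ d = 1) \/ (a = -1 /\ d = -1).
    by apply: int_mul_eq1; rewrite -[RHS]det mulr0 subr0.
    have := (PTz b 1 0 0 1 ltac:(lia)).1 P1.
    by rewrite mulr0 addr0 add0r mulr1.
  have H1 := PS 1 0 0 1 ltac:(lia) P1.
  have H2 := PS (- 0) (- 1) 1 0 ltac:(lia) H1.
  have := (PTz (- b) (- 1) (- 0) (- 0) (- 1) ltac:(lia)).1 H2.
  by rewrite oppr0 mulr0 addr0 add0r mulrN mulr1 opprK.
have [c0|c0] := eqVneq c 0; first by apply: IH => //; rewrite c0.
pose t := (a %/ c)%Z; pose r := (a %% c)%Z.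
have ED : a = t * c + r := divz_eq a c.
have r1 : (`|r| < `|c|)%N by have := ltz_mod a c0; have := modz_ge0 a c0; rewrite -/r; lia.
apply/(PTz (- t) _ _ _ _ det).
have -> : a + - t * c = r by rewrite ED; ring.
have det' : r * d - (b + - t * d) * c = 1 by rewrite -[RHS]det ED; ring.
apply: (PSi) => //; apply: IH; first by lia.
by rewrite -[RHS]det'; ring.
Qed.

(** The subgroup of matrices with even upper right entry is generated by -1, T ^ 2 and
    the transpose of T.  The Euclidean algorithm on (a, c) may subtract only even
    multiples of c from a, which suffices if the remainder is centred. *)
Lemma Gamma02_ind (P : int -> int -> int -> int -> Prop) :
  P 1 0 0 1 ->
  (forall a h c d, a * d - h * 2 * c = 1 -> P a h c d -> P (- a) (- h) (- c) (- d)) ->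
  (forall a h c d, a * d - h * 2 * c = 1 ->
     (P a h c d <-> P (a + 2 * c) (h + d) c d)) ->
  (forall a h c d, a * d - h * 2 * c = 1 ->
     (P a h c d <-> P a h (c + a) (d + h * 2))) ->
  forall a h c d, a * d - h * 2 * c = 1 -> P a h c d.
Proof.
move=> P1 PN PT PV.
have PTz (t : int) a h c d : a * d - h * 2 * c = 1 ->
    (P a h c d <-> P (a + t * (2 * c)) (h + t * d) c d).
  have H (n : nat) a1 h1 : a1 * d - h1 * 2 * c = 1 ->
      (P a1 h1 c d <-> P (a1 + n%:Z * (2 * c)) (h1 + n%:Z * d) c d).
    elim: n => [|n IH] det; first by rewrite !mul0r !addr0.
    rewrite (IH det); set a' := a1 + _; set b' := h1 + _.
    have det' : a' * d - b' * 2 * c = 1 by rewrite -[RHS]det /a' /b'; ring.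
    rewrite (PT _ _ _ _ det').
    have -> : a1 + n.+1%:Z * (2 * c) = a' + 2 * c by rewrite /a' -addn1 PoszD; ring.
    by have -> : h1 + n.+1%:Z * d = b' + d by rewrite /b' -addn1 PoszD; ring.
  case: t => n det; first exact: H.
  rewrite NegzE; set a' := a + _; set b' := h + _.
  have det' : a' * d - b' * 2 * c = 1 by rewrite -[RHS]det /a' /b'; ring.
  rewrite (H n.+1 _ _ det').
  have -> : a' + n.+1%:Z * (2 * c) = a by rewrite /a'; ring.
  by have -> : b' + n.+1%:Z * d = h by rewrite /b'; ring.
have PVz (t : int) a h c d : a * d - h * 2 * c = 1 ->
    (P a h c d <-> P a h (c + t * a) (d + t * (h * 2))).
  have H (n : nat) c1 d1 : a * d1 - h * 2 * c1 = 1 ->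
      (P a h c1 d1 <-> P a h (c1 + n%:Z * a) (d1 + n%:Z * (h * 2))).
    elim: n => [|n IH] det; first by rewrite !mul0r !addr0.
    rewrite (IH det); set a' := c1 + _; set b' := d1 + _.
    have det' : a * b' - h * 2 * a' = 1 by rewrite -[RHS]det /a' /b'; ring.
    rewrite (PV _ _ _ _ det').
    have -> : c1 + n.+1%:Z * a = a' + a by rewrite /a' -addn1 PoszD; ring.
    by have -> : d1 + n.+1%:Z * (h * 2) = b' + h * 2 by rewrite /b' -addn1 PoszD; ring.
  case: t => n det; first exact: H.
  rewrite NegzE; set a' := c + _; set b' := d + _.
  have det' : a * b' - h * 2 * a' = 1 by rewrite -[RHS]det /a' /b'; ring.
  rewrite (H n.+1 _ _ det').
  have -> : a' + n.+1%:Z * a = c by rewrite /a'; ring.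
  by have -> : b' + n.+1%:Z * (h * 2) = d by rewrite /b'; ring.
have base a h d : a * d = 1 -> P a h 0 d.
  have B1 h' : P 1 h' 0 1.
    have := (PTz h' 1 0 0 1 ltac:(lia)).1 P1.
    by rewrite !mulr0 addr0 add0r mulr1.
  case/int_mul_eq1 => -[-> ->] //.
  by have := PN 1 (- h) 0 1 ltac:(lia) (B1 _); rewrite oppr0 opprK.
suff H (n : nat) a h c d : (`|a| <= n)%N -> a * d - h * 2 * c = 1 -> P a h c d.
  by move=> a h c d; exact: (H `|a|%N).
elim: n a h c d => [|n IH] a h c d an det.
  have a0 : a = 0 by lia.
  by exfalso; rewrite a0 in det; lia.
have a0 : a != 0 by apply/eqP => a0; rewrite a0 in det; lia.
pose t := (c %/ a)%Z; pose r := (c %% a)%Z.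
have ED : c = t * a + r := divz_eq c a.
have r1 : 0 <= r by exact: modz_ge0.
have r2 : r < `|a| by exact: ltz_mod.
apply/(PVz (- t) _ _ _ _ det).
have -> : c + - t * a = r by rewrite ED; ring.
set d' := d + _.
have det' : a * d' - h * 2 * r = 1 by rewrite -[RHS]det /d' ED; ring.
have [r0|r0] := eqVneq r 0.
  by rewrite r0; apply: base; rewrite -[RHS]det' r0; ring.
(* m is the remainder of a modulo 2 r; m - 2 r replaces it when m > r. *)
pose m := (a %% (2 * r))%Z; pose s := (a %/ (2 * r))%Z.
have EA : a = s * (2 * r) + m := divz_eq a (2 * r).
have m1 : 0 <= m by apply: modz_ge0; lia.
have m2 : m < 2 * r by have := @ltz_mod a (2 * r) ltac:(lia); lia.
have [mr|mr] := leP m r.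
  apply/(PTz (- s) _ _ _ _ det').
  have -> : a + - s * (2 * r) = m by rewrite {1}EA; ring.
  apply: IH; first by lia.
  by rewrite -[RHS]det' [in RHS]EA; ring.
apply/(PTz (- (s + 1)) _ _ _ _ det').
have -> : a + - (s + 1) * (2 * r) = m - 2 * r by rewrite {1}EA; ring.
apply: IH; first by lia.
by rewrite -[RHS]det' [in RHS]EA; ring.
Qed.

(** * The multiplier of the Siegel functions *)

Lemma all_iota_inZp n (P : 'I_n.+2 -> bool) :
  all (fun k => P (inZp k)) (iota 0 n.+2) -> forall x, P x.
Proof.
move=> /allP H x; have := H x; rewrite mem_iota /= add0n ltn_ord.
by rewrite valZpK => /(_ isT).
Qed.

(** The multiplier system of eta ^ 2 has values e(k / 12), with k determined modulo 12
    by its classes modulo 3 and 4, which are these functions of the matrix.  Their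
    behaviour under left multiplication by T and S is a finite check. *)
Definition eta2_exp3 (a b c d : 'Z_3) : 'Z_3 := b * d * (1 - c ^+ 2) + c * (a + d).
Definition eta2_exp4 (a b c d : 'Z_4) : 'Z_4 :=
  if odd c then c * (a + d + 1) else d * (b - c + 3%:R) + 1.

Lemma eta2_exp3_rec (a b c d : 'Z_3) : a * d - b * c = 1 ->
  eta2_exp3 (a + c) (b + d) c d = eta2_exp3 a b c d + 1 /\
  eta2_exp3 (- c) (- d) a b = eta2_exp3 a b c d.
Proof.
suff : (a * d - b * c == 1) ==>
    ((eta2_exp3 (a + c) (b + d) c d == eta2_exp3 a b c d + 1) &&
     (eta2_exp3 (- c) (- d) a b == eta2_exp3 a b c d)).
  by move=> /implyP H /eqP /H /andP[/eqP -> /eqP ->].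
move: d; apply: all_iota_inZp; move: c; apply: all_iota_inZp.
move: b; apply: all_iota_inZp; move: a; apply: all_iota_inZp.
by vm_compute.
Qed.

Lemma eta2_exp4_rec (a b c d : 'Z_4) : a * d - b * c = 1 ->
  eta2_exp4 (a + c) (b + d) c d = eta2_exp4 a b c d + 1 /\
  eta2_exp4 (- c) (- d) a b = eta2_exp4 a b c d + 1.
Proof.
suff : (a * d - b * c == 1) ==>
    ((eta2_exp4 (a + c) (b + d) c d == eta2_exp4 a b c d + 1) &&
     (eta2_exp4 (- c) (- d) a b == eta2_exp4 a b c d + 1)).
  by move=> /implyP H /eqP /H /andP[/eqP -> /eqP ->].
move: d; apply: all_iota_inZp; move: c; apply: all_iota_inZp.
move: b; apply: all_iota_inZp; move: a; apply: all_iota_inZp.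
by vm_compute.
Qed.

(** The multiplier of Weber's f_1 on a matrix with entries a, 2 h, c, d is e(k / 24), and
    this is the class of k modulo 8.  It has the same behaviour under the generators
    as k, again by a finite check. *)
Definition web1_exp (a h c : 'Z_8) : 'Z_8 :=
  (if (a == 3%:R) || (a == 5%:R) then 4%:R else 0) - a * (h + c).

Definition web1_check (a h c d : 'Z_8) : bool :=
  (a * d - h * 2%:R * c == 1) ==>
  [&& web1_exp (a + 2%:R * c) (h + d) c == web1_exp a h c - 1,
      web1_exp a h (c + a) == web1_exp a h c - 1 &
      web1_exp (- a) (- h) (- c) == web1_exp a h c].

Lemma web1_exp_rec (a h c d : 'Z_8) : a * d - h * 2%:R * c = 1 ->
  [/\ web1_exp (a + 2%:R * c) (h + d) c = web1_exp a h c - 1,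
      web1_exp a h (c + a) = web1_exp a h c - 1 &
      web1_exp (- a) (- h) (- c) = web1_exp a h c].
Proof.
suff : web1_check a h c d.
  by move=> /implyP H /eqP /H /and3P[/eqP -> /eqP -> /eqP ->].
move: d; apply: all_iota_inZp; move: c; apply: all_iota_inZp.
move: h; apply: all_iota_inZp; move: a; apply: all_iota_inZp.
by vm_compute.
Qed.

Section Mobius.
Variable R : realType.
Implicit Types (t : R[i]) (a b c d : int).
Notation nc := (@ComplexField.Normc.normc R).

Definition mob a b c d t : R[i] := (a%:~R * t + b%:~R) / (c%:~R * t + d%:~R).

Lemma mob_den c d t : 0 < complex.Im t -> c%:~R * t + d%:~R = 0 -> c = 0 /\ d = 0.
Proof.
rewrite -!(rmorph_int (real_complex R)) => t0 E.
have := congr1 (@complex.Im R) E; rewrite ImD Im_mulR /= addr0 => /eqP.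
rewrite mulf_eq0 (gt_eqF t0) orbF intr_eq0 => /eqP c0; split=> //.
move: E; rewrite c0 rmorph0 mul0r add0r => /complexI /eqP.
by rewrite intr_eq0 => /eqP.
Qed.

Lemma mob_den_neq0 a b c d t : 0 < complex.Im t -> a * d - b * c = 1 ->
  c%:~R * t + d%:~R != 0.
Proof.
move=> t0 det; apply/eqP => /(mob_den t0)[c0 d0]; move: det.
by rewrite c0 d0 !mulr0 subrr.
Qed.

Lemma mob_T a b c d t : 0 < complex.Im t -> a * d - b * c = 1 ->
  mob (a + c) (b + d) c d t = mob a b c d t + 1.
Proof.
move=> t0 det; have N := mob_den_neq0 t0 det.
by rewrite /mob !rmorphD /=; field.
Qed.

Lemma mob_S a b c d t : mob (- c) (- d) a b t = - (mob a b c d t)^-1.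
Proof. by rewrite /mob invf_div !rmorphN /= -mulNr; congr (_ / _); ring. Qed.

Lemma mob_1 t : mob 1 0 0 1 t = t.
Proof. by rewrite /mob mul1r addr0 mul0r add0r divr1. Qed.

Lemma mob_Im a b c d t : 0 < complex.Im t -> a * d - b * c = 1 ->
  0 < complex.Im (mob a b c d t).
Proof.
move=> t0; move: a b c d; apply: SL2_ind => [|a b c d det H|a b c d det H|a b c d det H].
- by rewrite mob_1.
- by rewrite mob_T // ImD /= addr0.
- by move: H; rewrite mob_T // ImD /= addr0.
by rewrite mob_S; exact: half_planeV.
Qed.

Lemma mob_comp a b c d a' b' c' d' t : 0 < complex.Im t -> a' * d' - b' * c' = 1 ->
  mob a b c d (mob a' b' c' d' t) =
  mob (a * a' + b * c') (a * b' + b * d') (c * a' + d * c') (c * b' + d * d') t.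
Proof.
move=> t0 det; have N := mob_den_neq0 t0 det; rewrite /mob.
set A := a'%:~R * t + b'%:~R; set B := c'%:~R * t + d'%:~R in N *.
have -> : a%:~R * (A / B) + b%:~R = (a%:~R * A + b%:~R * B) / B by field.
have -> : c%:~R * (A / B) + d%:~R = (c%:~R * A + d%:~R * B) / B by field.
rewrite -mulf_div divff ?invr_eq0 // mulr1 /A /B !rmorphD !rmorphM /=.
by congr (_ / _); ring.
Qed.

(** With this phase factor (x1, x2) transforms by right multiplication with the matrix,
    and the only other multiplier is that of eta ^ 2, whatever the characteristic. *)
Definition sgf (x1 x2 : R) t : R[i] := ph (x2 * (x1 - 1) / 2) * sieg x1 x2 t.

Lemma sgf_T x1 x2 t : 0 < complex.Im t ->
  sgf x1 x2 (t + 1) = ph (1 / 12) * sgf x1 (x1 + x2) t.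
Proof.
move=> t0; rewrite /sgf sieg_T // [LHS]mulrA [RHS]mulrA -[in LHS]phD -[in RHS]phD.
congr (ph _ * _).
by rewrite /B2; field.
Qed.

Lemma ph_m3_12 : ph (- 3 / 12) = - 'i :> R[i].
Proof.
have -> : - 3 / 12 = - (1 / 4) :> R by field.
rewrite phN ph_quarter.
by apply: (mulIf (_ : 'i != 0)); rewrite ?mulVf ?mulNr -?expr2 ?sqr_i ?opprK // eq_complex /= eqxx oner_eq0.
Qed.

Lemma sgf_S x1 x2 t : 0 < complex.Im t ->
  sgf x1 x2 (- t^-1) = ph (- 3 / 12) * sgf x2 (- x1) t.
Proof.
move=> t0; rewrite /sgf sieg_S // -ph_m3_12.
move: (sieg x2 (- x1) t) => s; rewrite !mulrA -!phD; congr (ph _ * _).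
by field.
Qed.

Lemma Zp_intr_eq0 n (k : int) : (1 < n)%N -> k%:~R = 0 :> 'Z_n -> (n%:Z %| k)%Z.
Proof.
move=> n1; have H (m : nat) : m%:R = 0 :> 'Z_n -> (n %| m)%N.
  by move=> /(congr1 val) /=; rewrite val_Zp_nat // => /eqP.
case: k => m; first by move/H.
rewrite NegzE rmorphN /= => /eqP; rewrite oppr_eq0 => /eqP /H E.
by rewrite dvdzE abszN.
Qed.

Lemma sieg_mob a b c d : a * d - b * c = 1 -> exists k : int,
  [/\ k%:~R = eta2_exp3 a%:~R b%:~R c%:~R d%:~R,
      k%:~R = eta2_exp4 a%:~R b%:~R c%:~R d%:~R &
      forall x1 x2 t, 0 < complex.Im t -> sgf x1 x2 (mob a b c d t) =
        ph (k%:~R / 12) *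
        sgf (x1 * a%:~R + x2 * c%:~R) (x1 * b%:~R + x2 * d%:~R) t].
Proof.
have det3 (x y z w : int) n : x * w - y * z = 1 ->
    x%:~R * w%:~R - y%:~R * z%:~R = 1 :> 'Z_n.
  by move=> E; rewrite -!rmorphM -rmorphB /= E.
move: a b c d; apply: SL2_ind => [|a b c d det|a b c d det|a b c d det].
- exists 0; split; first by apply/eqP; vm_compute.
    by apply/eqP; vm_compute.
  by move=> x1 x2 t t0; rewrite mob_1 mul0r ph0 mul1r !mulr1 !mulr0 addr0 add0r.
- move=> [k [k3 k4 H]]; exists (k + 1); rewrite !rmorphD /= k3 k4; split.
  + by have [-> _] := eta2_exp3_rec (det3 _ _ _ _ 3 det).
  + by have [-> _] := eta2_exp4_rec (det3 _ _ _ _ 4 det).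
  move=> x1 x2 t t0; rewrite mob_T // sgf_T ?mob_Im // H // mulrA -phD.
  by congr (_ * _); [congr ph; field | congr sgf; ring].
- move=> [k [k3 k4 H]]; exists (k - 1); rewrite !rmorphB /= k3 k4; split.
  + by have [+ _] := eta2_exp3_rec (det3 _ _ _ _ 3 det); rewrite !rmorphD /= => ->; rewrite addrK.
  + by have [+ _] := eta2_exp4_rec (det3 _ _ _ _ 4 det); rewrite !rmorphD /= => ->; rewrite addrK.
  move=> x1 x2 t t0.
  have := H x1 (x2 - x1) t t0; rewrite mob_T // sgf_T ?mob_Im // addrC subrK => E.
  apply: (mulfI (ph_neq0 (1 / 12 : R))); rewrite E [RHS]mulrA -[in RHS]phD.
  by congr (_ * _); [congr ph; field | congr sgf; rewrite !rmorphD /=; ring].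
move=> [k [k3 k4 H]]; exists (k - 3); rewrite !rmorphB /= k3 k4; split.
- have [_] := eta2_exp3_rec (det3 _ _ _ _ 3 det); rewrite !rmorphN /= => ->.
  by rewrite (_ : 3%:~R = 0) ?subr0 //; apply/val_inj.
- have [_] := eta2_exp4_rec (det3 _ _ _ _ 4 det); rewrite !rmorphN /= => ->.
  by congr (_ + _); apply/val_inj.
move=> x1 x2 t t0; rewrite mob_S sgf_S ?mob_Im // H // mulrA -phD.
by congr (_ * _); [congr ph; field | congr sgf; rewrite !rmorphN /=; ring].
Qed.

(** * The multipliers of the Weber functions *)

Definition webf (i : 'Z_3) : R[i] -> R[i] :=
  if i == 0 then @web0 R else if i == 1 then @web1 R else @web2 R.

(** T and S permute f, f_1 and f_2 up to constants. *)
Lemma webf_mob a b c d i : a * d - b * c = 1 -> exists j, exists2 K : R[i], K != 0 &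
  forall t, 0 < complex.Im t -> webf i (mob a b c d t) = K * webf j t.
Proof.
move=> det; move: a b c d det i.
have fT (i : 'Z_3) : exists j : 'Z_3, exists2 K : R[i], K != 0 &
    forall t, 0 < complex.Im t -> webf i (t + 1) = K * webf j t.
  rewrite /webf; case: eqP => _.
    exists 1, (ph (- 1 / 48)); first exact: ph_neq0.
    by move=> t t0; rewrite /web0 web_T // opprK.
  case: eqP => _; first by exists 0, (ph (- 1 / 48)); [exact: ph_neq0 | move=> t t0; rewrite /web1 web_T].
  by exists 2%:R, (ph (1 / 24)); [exact: ph_neq0 | move=> t t0; rewrite web2_T].
have fTi (i : 'Z_3) : exists j : 'Z_3, exists2 K : R[i], K != 0 &
    forall t, 0 < complex.Im t -> webf i t = K * webf j (t + 1).
  have inv (x y z : R[i]) : x != 0 -> y = x * z -> z = x^-1 * y by move=> x0 ->; rewrite mulKf.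
  rewrite /webf; case: eqP => _.
    exists 1, (ph (- 1 / 48))^-1; first by rewrite invr_eq0 ph_neq0.
    by move=> t t0; apply: inv; [exact: ph_neq0 | rewrite /= /web1 web_T].
  case: eqP => _.
    exists 0, (ph (- 1 / 48))^-1; first by rewrite invr_eq0 ph_neq0.
    by move=> t t0; apply: inv; [exact: ph_neq0 | rewrite /= /web0 web_T // opprK].
  exists 2%:R, (ph (1 / 24))^-1; first by rewrite invr_eq0 ph_neq0.
  by move=> t t0; apply: inv; [exact: ph_neq0 | rewrite /= web2_T].
have fS (i : 'Z_3) : exists j : 'Z_3, exists2 K : R[i], K != 0 &
    forall t, 0 < complex.Im t -> webf i (- t^-1) = K * webf j t.
  rewrite /webf; case: eqP => _.
    by exists 0, 1; [exact: oner_neq0 | move=> t t0; rewrite web0_S // mul1r].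
  case: eqP => _; first by exists 2%:R, (sqrt2 R); [exact: sqrt2_neq0 | move=> t t0; rewrite web1_S].
  by exists 1, (sqrt2 R)^-1; [rewrite invr_eq0 sqrt2_neq0 | move=> t t0; rewrite web2_S].
apply: SL2_ind => [|a b c d det H|a b c d det H|a b c d det H] i.
- by exists i, 1; [exact: oner_neq0 | move=> t t0; rewrite mob_1 mul1r].
- have [j [K K0 HK]] := fT i; have [l [K' K'0 HK']] := H j.
  exists l, (K * K'); first exact: mulf_neq0.
  by move=> t t0; rewrite mob_T // HK ?mob_Im // HK' // mulrA.
- have [j [K K0 HK]] := fTi i; have [l [K' K'0 HK']] := H j.
  exists l, (K * K'); first exact: mulf_neq0.
  by move=> t t0; rewrite HK ?mob_Im // -mob_T // HK' // mulrA.
have [j [K K0 HK]] := fS i; have [l [K' K'0 HK']] := H j.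
exists l, (K * K'); first exact: mulf_neq0.
by move=> t t0; rewrite mob_S HK ?mob_Im // HK' // mulrA.
Qed.

(** t / (t + 1) is S T^-1 S t, and the factors sqrt 2 and 1 / sqrt 2 of the two S-laws
    cancel. *)
Lemma web1_V t : 0 < complex.Im t -> web1 (t / (t + 1)) = ph (- 1 / 24) * web1 t.
Proof.
move=> t0; have N := half_plane_neq0 t0.
have s0 := half_planeV t0.
have I1 : complex.Im (- 1 : R[i]) = 0 by rewrite /= oppr0.
have E1 : 0 < complex.Im (- t^-1 - 1) by rewrite ImD I1 addr0.
have N1 : t + 1 != 0.
  by apply: half_plane_neq0; rewrite ImD /= addr0.
have -> : t / (t + 1) = - (- t^-1 - 1)^-1.
  by rewrite (_ : - t^-1 - 1 = - ((t + 1) / t)) ?invrN ?opprK ?invf_div //; field.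
rewrite web1_S //; have := web2_T (- t^-1 - 1); rewrite subrK => E2.
have := web2_S t0; rewrite E2 => E3.
have -> : web2 (- t^-1 - 1) = ph (- 1 / 24) * ((sqrt2 R)^-1 * web1 t).
  rewrite -E3 mulrA -phD; have -> : - 1 / 24 + 1 / 24 = 0 :> R by field.
  by rewrite ph0 mul1r.
by rewrite mulrCA mulVKf // sqrt2_neq0.
Qed.

Lemma web1_T2 t : 0 < complex.Im t -> web1 (t + 2%:R) = ph (- 1 / 24) * web1 t.
Proof.
move=> t0; have t1 : 0 < complex.Im (t + 1) by rewrite ImD /= addr0.
have -> : t + 2%:R = t + 1 + 1 by ring.
rewrite /web1 web_T // web_T // opprK mulrA -phD.
by congr (ph _ * _); field.
Qed.

Lemma web1_mob a h c d : a * d - h * 2 * c = 1 -> exists2 k : int,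
  k%:~R = web1_exp a%:~R h%:~R c%:~R &
  forall t, 0 < complex.Im t -> web1 (mob a (h * 2) c d t) = ph (k%:~R / 24) * web1 t.
Proof.
have det8 (x y z w : int) : x * w - y * 2 * z = 1 ->
    x%:~R * w%:~R - y%:~R * 2%:R * z%:~R = 1 :> 'Z_8.
  by move=> E; rewrite -[RHS](rmorph1 (intr : int -> 'Z_8)) -E rmorphB !rmorphM.
move: a h c d; apply: Gamma02_ind => [|a h c d det|a h c d det|a h c d det].
- exists 0; first by apply/eqP; vm_compute.
  by move=> t t0; rewrite mul0r mob_1 mul0r ph0 mul1r.
- move=> [k k8 H]; exists k.
    by rewrite k8 !rmorphN /=; have [_ _ ->] := web1_exp_rec (det8 _ _ _ _ det).
  move=> t t0; rewrite -H //; congr web1; rewrite /mob mulNr !rmorphN /=.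
  by rewrite !mulNr -!opprD invrN mulrNN.
- have shift t : 0 < complex.Im t -> mob (a + 2 * c) ((h + d) * 2) c d t =
      mob a (h * 2) c d t + 2%:R.
    move=> t0; have N := mob_den_neq0 t0 det.
    rewrite /mob !(rmorphD, rmorphM) /=; field; exact: N.
  have [E1 _ _] := web1_exp_rec (det8 _ _ _ _ det).
  split=> [[k k8 H]|[k k8 H]].
    exists (k - 1); first by rewrite rmorphB /= k8 !(rmorphD, rmorphM) /= E1.
    move=> t t0; rewrite shift // web1_T2 ?mob_Im // H // mulrA -phD rmorphB /=.
    by congr (ph _ * _); field.
  exists (k + 1); first by rewrite rmorphD /= k8 !(rmorphD, rmorphM) /= E1 subrK.
  move=> t t0; have := H t t0; rewrite shift // web1_T2 ?mob_Im // => E.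
  apply: (mulfI (ph_neq0 (- 1 / 24 : R))); rewrite E [RHS]mulrA -[in RHS]phD rmorphD /=.
  by congr (ph _ * _); field.
have tV (t : R[i]) : 0 < complex.Im t -> 0 < complex.Im (t / (t + 1)).
  have -> : t / (t + 1) = mob 1 0 1 1 t by rewrite /mob !mul1r addr0.
  by move=> t0; apply: mob_Im.
have shift t : 0 < complex.Im t -> mob a (h * 2) (c + a) (d + h * 2) t =
    (mob a (h * 2) c d t) / (mob a (h * 2) c d t + 1).
  move=> t0; have N := mob_den_neq0 t0 det.
  have det' : a * (d + h * 2) - h * 2 * (c + a) = 1 by rewrite -[RHS]det; ring.
  have N' := mob_den_neq0 t0 det'; rewrite /mob.
  have E : (c + a)%:~R * t + (d + h * 2)%:~R =
      (a%:~R * t + (h * 2)%:~R) + (c%:~R * t + d%:~R) by rewrite !rmorphD /=; ring.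
  rewrite E in N' *; set A := a%:~R * t + _ in N' *; set B := c%:~R * t + _ in N N' *.
  by field; rewrite N N'.
have [_ E1 _] := web1_exp_rec (det8 _ _ _ _ det).
split=> [[k k8 H]|[k k8 H]].
  exists (k - 1); first by rewrite rmorphB /= k8 !(rmorphD, rmorphM) /= E1.
  move=> t t0; rewrite shift // web1_V ?mob_Im // H // mulrA -phD rmorphB /=.
  by congr (ph _ * _); field.
exists (k + 1); first by rewrite rmorphD /= k8 !(rmorphD, rmorphM) /= E1 subrK.
move=> t t0; have := H t t0; rewrite shift // web1_V ?mob_Im // => E.
apply: (mulfI (ph_neq0 (- 1 / 24 : R))); rewrite E [RHS]mulrA -[in RHS]phD rmorphD /=.
by congr (ph _ * _); field.
Qed.

End Mobius.
(** * The divisors m of N and their levels *)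

Section Levels.
Local Open Scope nat_scope.
Implicit Types N m n d : nat.

Lemma ell_max N m d : 0 < N -> m %| N -> d ^ 2 %| N %/ m -> d <= ell N m.
Proof.
move=> N0 mN dN; have m0 := dvdn_gt0 N0 mN.
have q0 : 0 < N %/ m by rewrite divn_gt0 // dvdn_leq.
have dlt : d < N.+1.
  rewrite ltnS; apply: leq_trans (leq_div N m); apply: leq_trans (dvdn_leq q0 dN).
  by case: (d) => // k; rewrite expnS expn1 leq_pmulr.
by rewrite /ell; apply: (@leq_bigmax_cond _ (fun d : 'I_N.+1 => d ^ 2 %| N %/ m) val (Ordinal dlt)).
Qed.

Lemma ell_gt0 N m : 0 < N -> m %| N -> 0 < ell N m.
Proof. by move=> N0 mN; apply: ell_max => //; rewrite exp1n dvd1n. Qed.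

Lemma ell_sqr N m : 0 < N -> m %| N -> ell N m ^ 2 %| N %/ m.
Proof.
move=> N0 mN; rewrite /ell.
have P1 : Ordinal (N0 : 1 < N.+1) ^ 2 %| N %/ m by rewrite exp1n dvd1n.
have P0 : 0 < #|[pred d : 'I_N.+1 | d ^ 2 %| N %/ m]|.
  by apply/card_gt0P; exists (Ordinal (N0 : 1 < N.+1)).
by have [i Pi ->] := eq_bigmax_cond (fun d : 'I_N.+1 => val d) P0.
Qed.

Lemma sqr_dvd_ell N d : 0 < N -> d ^ 2 %| N -> d %| ell N 1.
Proof.
move=> N0 dN; have LN := ell_sqr N0 (dvd1n N); rewrite divn1 in LN.
set L := ell N 1 in LN *.
have d0 : 0 < d by case: (posnP d) dN N0 => // ->; rewrite exp0n // dvd0n => /eqP ->.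
have L0 : 0 < L := ell_gt0 N0 (dvd1n N).
have g0 : 0 < gcdn d L by rewrite gcdn_gt0 d0.
set g := gcdn d L in g0.
pose d' := d %/ g; pose L' := L %/ g.
have Ed : d = d' * g by rewrite divnK // dvdn_gcdl.
have EL : L = L' * g by rewrite divnK // dvdn_gcdr.
have co : coprime d' L'.
  by rewrite /coprime -(eqn_pmul2r g0) muln_gcdl -Ed -EL mul1n.
have H : (d' * L' * g) ^ 2 %| N.
  move: dN LN; rewrite {1}Ed {1}EL !expnMn => H1 H2.
  have gN : g ^ 2 %| N by apply: dvdn_trans H1; exact: dvdn_mull.
  rewrite -(divnK gN) !dvdn_pmul2r ?expn_gt0 ?g0 // in H1 H2 *.
  by rewrite Gauss_dvd ?coprimeXl ?coprimeXr // H1.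
have := @ell_max N 1 (d' * L' * g) N0 (dvd1n _).
rewrite divn1 => /(_ H); rewrite -/L -mulnA -EL -{2}(mul1n L) leq_pmul2r // => d'1.
have -> : d = g.
  rewrite Ed; move: d0 d'1; rewrite {1}Ed muln_gt0 => /andP[].
  by move=> d'0 _ d'1; have -> : d' = 1; [by apply/eqP; rewrite eqn_leq d'1 d'0|rewrite mul1n].
exact: dvdn_gcdr.
Qed.

Section Divisor.
Variables N m : nat.
Hypotheses (N_gt0 : 0 < N) (mD : m \in proper_divisors N).
Let l := ell N m.
Let M := mpp N m.

Lemma pd_dvd : m %| N.
Proof. by move: mD; rewrite mem_filter -dvdn_divisors // => /andP[]. Qed.

Lemma pd_gt0 : 0 < m. Proof. exact: dvdn_gt0 N_gt0 pd_dvd. Qed.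

Lemma l_gt0 : 0 < l. Proof. exact: ell_gt0 N_gt0 pd_dvd. Qed.

Lemma pd_sqr : l ^ 2 %| N %/ m. Proof. exact: ell_sqr N_gt0 pd_dvd. Qed.

(** The factorization N = m l M of the level, with l = ell N m and M = m'', underlies all
    manipulations of characteristics. *)
Lemma level_eq : m * l * M = N.
Proof.
rewrite mulnC /M /mpp divnK // mulnC -[X in _ %| X](divnK pd_dvd) dvdn_pmul2r ?pd_gt0 //.
by apply: dvdn_trans pd_sqr; rewrite expnS dvdn_mulr.
Qed.

Lemma M_gt0 : 0 < M.
Proof. by move: N_gt0; rewrite -level_eq muln_gt0 => /andP[]. Qed.

Lemma l_dvd_M : l %| M.
Proof.
have := pd_sqr; rewrite -[X in X %/ m]level_eq -mulnA mulKn ?pd_gt0 //.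
by rewrite expnS expn1 dvdn_pmul2l ?l_gt0.
Qed.

Lemma M_gt1 : 1 < M.
Proof.
rewrite ltn_neqAle M_gt0 andbT eq_sym; apply/negP => /eqP M1.
have l1 : l = 1 by apply/eqP; rewrite -dvdn1 -M1 l_dvd_M.
have E := level_eq; rewrite M1 l1 !muln1 in E.
by move: mD; rewrite mem_filter E eqxx.
Qed.

Lemma Np_eq : Np N m = m * M.
Proof. by rewrite /Np -/l -[X in X %/ l]level_eq -mulnA mulnCA mulKn ?l_gt0. Qed.

Lemma l_dvd_L : l %| ell N 1.
Proof.
apply: sqr_dvd_ell => //; apply: dvdn_trans pd_sqr _.
by rewrite -[X in _ %| X](divnK pd_dvd) dvdn_mulr.
Qed.

(** l divides M, so l is 1 or 2, and 2 is excluded as l divides L. *)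
Lemma level2 : odd (ell N 1) -> M = 2 -> l = 1.
Proof.
move=> Lodd M2; have := l_dvd_M; rewrite M2.
have : odd l by apply: dvdn_odd l_dvd_L Lodd.
by case: l => [|[|[|k]]] // _ /dvdn_leq => /(_ isT).
Qed.
End Divisor.

Lemma not4 N : 0 < N -> odd (ell N 1) -> ~~ (4 %| N).
Proof. by move=> N0 Lo; apply/negP => /(@sqr_dvd_ell N 2 N0) /dvdn_odd /(_ Lo). Qed.

(** * Inverses modulo n *)

Lemma delta_lt n al : 1 < n -> delta n al < n.
Proof. by move=> n1; rewrite /delta -[X in _ < X](Zp_cast n1). Qed.

Lemma deltaP n al : 1 < n -> coprime al n -> al * delta n al = 1 %[mod n].
Proof.
move=> n1 co; have U : (al%:R : 'Z_n) \is a GRing.unit.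
  by rewrite unitZpE // coprime_sym.
have : ((al%:R : 'Z_n) * (delta n al)%:R = 1)%R.
  by rewrite /delta natr_Zp mulrV.
by rewrite -natrM => /(congr1 val); rewrite /= val_Zp_nat // => ->; rewrite Zp_cast.
Qed.

Lemma modn_inj_coprime n al x y : coprime al n -> al * x = al * y %[mod n] ->
  x = y %[mod n].
Proof.
move=> co E; apply/eqP.
have [xy|/ltnW xy] := leqP x y.
  move/eqP: E; rewrite eq_sym eqn_mod_dvd ?leq_mul2l ?xy ?orbT // -mulnBr Gauss_dvdr; last by rewrite coprime_sym.
  by rewrite eq_sym eqn_mod_dvd.
move/eqP: E; rewrite eqn_mod_dvd ?leq_mul2l ?xy ?orbT // -mulnBr Gauss_dvdr; last by rewrite coprime_sym.
by rewrite eqn_mod_dvd.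
Qed.

Lemma delta_unique n al de : 1 < n -> coprime al n -> de < n ->
  al * de = 1 %[mod n] -> de = delta n al.
Proof.
move=> n1 co dn E; have := @modn_inj_coprime n al de (delta n al) co.
by rewrite E deltaP // !modn_small ?delta_lt // => ->.
Qed.

Lemma delta_gt0 n al : 1 < n -> coprime al n -> 0 < delta n al.
Proof.
move=> n1 co; case: (posnP (delta n al)) (deltaP n1 co) => // ->.
by rewrite muln0 mod0n modn_small.
Qed.

Lemma delta_opp n al : 1 < n -> coprime al n -> al < n ->
  delta n (n - al) = n - delta n al.
Proof.
move=> n1 co aln; have d0 := delta_gt0 n1 co; have dn := delta_lt al n1.
have co' : coprime (n - al) n.
  have En : (n - al) + al = n by rewrite subnK // ltnW.
  by rewrite /coprime -{2}En gcdnDl gcdnC -(gcdnDl al) addnC En gcdnC; move: co; rewrite /coprime gcdnC.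
apply/esym/delta_unique => //; first by rewrite ltn_subrL d0 ltnW.
set de := delta n al in d0 dn *.
have E : (n - al) * (n - de) + (al + de) * n = al * de + n * n.
  rewrite mulnBl !mulnBr.
  have H1 : al * de <= n * de by rewrite leq_mul2r (ltnW aln) orbT.
  have H2 : n * de <= n * n by rewrite leq_mul2l (ltnW dn) orbT.
  have H3 : al * n <= n * n by rewrite leq_mul2r (ltnW aln) orbT.
  have H4 : al * de <= al * n by rewrite leq_mul2l (ltnW dn) orbT.
  have H5 : al * n - al * de <= n * n - n * de.
    by rewrite -!mulnBr leq_mul2r (ltnW aln) orbT.
  nia.
have := congr1 (modn^~ n) E; rewrite addnC modnMDl addnC modnMDl => ->.
exact: deltaP.
Qed.

End Levels.

(** * Multiplication by a unit on half a system of units *)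

Section Half.
Variables (M : nat) (S : {set 'I_M}) (a : int).
Hypotheses (M_gt1 : (1 < M)%N) (SP : half_units S).

Definition resid (al : nat) : nat := `|(a * al%:Z %% M%:Z)%Z|%N.
Definition quo (al : nat) : int := (a * al%:Z %/ M%:Z)%Z.

Lemma resid_eq al : a * al%:Z = quo al * M%:Z + (resid al)%:Z.
Proof.
rewrite /quo /resid gez0_abs; first exact: divz_eq.
by rewrite modz_ge0 // eqz_nat; case: (M) M_gt1.
Qed.

Lemma resid_lt al : (resid al < M)%N.
Proof.
by rewrite -ltz_nat /resid gez0_abs ?modz_ge0 ?ltz_pmod // ?ltz_nat ?eqz_nat; lia.
Qed.


Lemma coprime_pos al : coprime al M -> (0 < al)%N.
Proof. by case: al => //; rewrite /coprime gcd0n; lia. Qed.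

Lemma S_coprime (s : 'I_M) : s \in S -> coprime s M.
Proof. exact: SP.1. Qed.

Lemma S_opp_neq (s s' : 'I_M) : (2 < M)%N -> s \in S -> s' \in S -> (s + s')%N != M.
Proof.
move=> M2 sS s'S; apply/eqP => E.
have [x [_ U]] := SP.2 s (S_coprime sS).
have E1 : x = s by apply: U; split=> //; left.
have E2 : x = s' by apply: U; split=> //; right; rewrite addnC E modnn mod0n.
have Es : s' = s by rewrite -E1.
move: E; rewrite Es addnn -muln2 => E.
have sM : (s %| M)%N by rewrite -[X in (_ %| X)%N]E dvdn_mulr.
have := S_coprime sS; rewrite /coprime; move/gcdn_idPl: sM => -> /eqP s1.
by move: E M2; rewrite s1; lia.
Qed.

Lemma rep_ex (r : nat) : coprime r M -> (r < M)%N ->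
  exists2 s : 'I_M, s \in S & (s == r :> nat) || (s + r == M)%N.
Proof.
move=> co rM; have [s [[sS E] _]] := SP.2 r co; exists s => //.
have r0 := coprime_pos co.
case: E => [|E]; first by rewrite !modn_small // => ->; rewrite eqxx.
apply/orP; right; have : (M %| s + r)%N by rewrite /dvdn E mod0n.
case/dvdnP => k; have := ltn_ord s => sM Ek; apply/eqP.
have : (k < 2)%N by rewrite -(ltn_pmul2r (ltnW M_gt1)) -Ek; lia.
by case: k Ek => [|[|k]] //; lia.
Qed.

Lemma rep_uniq (s s' : 'I_M) : s \in S -> s' \in S ->
  (s = s' %[mod M] \/ s + s' = 0 %[mod M])%N -> s = s'.
Proof.
move=> sS s'S E; have [x [_ U]] := SP.2 s' (S_coprime s'S).
by rewrite -(U s) // -(U s') //; split=> //; left.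
Qed.

Lemma big_units (V : Type) (idx : V) (op : Monoid.com_law idx) (f : nat -> V) : (2 < M)%N ->
  \big[op/idx]_(1 <= al < M.+1 | coprime al M) f al =
  \big[op/idx]_(s in S) op (f s) (f (M - s)%N).
Proof.
move=> M2; pose opp (s : 'I_M) : 'I_M := insubd s (M - s)%N.
have oppE s : s \in S -> opp s = (M - s)%N :> nat.
  move=> sS; rewrite val_insubd; have := coprime_pos (S_coprime sS).
  by have := ltn_ord s; move=> ? ?; rewrite ifT //; lia.
have oppI : {in S &, injective opp}.
  move=> s s' sS s'S /(congr1 (@nat_of_ord M)); rewrite !oppE // => E; apply: val_inj => /=.
  by have := ltn_ord s; have := ltn_ord s'; lia.
rewrite big_split /=.
have -> : \big[op/idx]_(s in S) f (M - s)%N = \big[op/idx]_(s in S) f (opp s).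
  by apply: eq_bigr => s sS; rewrite oppE.
rewrite [X in op _ X](_ : _ = \big[op/idx]_(s in opp @: S) f s); last by rewrite big_imset.
have -> : \big[op/idx]_(1 <= al < M.+1 | coprime al M) f al =
          \big[op/idx]_(0 <= al < M | coprime al M) f al.
  rewrite big_mkcond big_nat_recr ?(ltnW M_gt1) //= /coprime gcdnn ifF; last by lia.
  rewrite Monoid.mulm1 [RHS]big_mkcond [RHS](@big_cat_nat _ _ _ 1) ?(ltnW M_gt1) //=.
  by rewrite big_nat1 gcd0n ifF ?Monoid.mul1m //; lia.
rewrite big_mkord.
rewrite (bigID (mem S)) /=; congr (op _ _); apply: eq_bigl => s.
  by apply/andP/idP => [[]//|sS]; split=> //; exact: S_coprime.
apply/andP/imsetP => [[co nS]|[s' s'S ->]].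
  have [s' s'S /orP[/eqP/val_inj E|/eqP E]] := rep_ex co (ltn_ord s).
    by rewrite -E s'S in nS.
  by exists s' => //; apply: val_inj; rewrite /= oppE //; lia.
have s'0 := coprime_pos (S_coprime s'S); have s'M := ltn_ord s'.
split; last first.
  apply/negP => oS; have := S_opp_neq M2 s'S oS; rewrite oppE //.
  by rewrite subnKC ?eqxx // ltnW.
rewrite oppE //; have := S_coprime s'S; rewrite /coprime.
have EM := subnK (ltnW s'M); rewrite -[X in gcdn _ X == _]EM gcdnDr.
by rewrite -[X in _ -> gcdn _ X == _]EM gcdnDl gcdnC.
Qed.

Lemma card_half : (2 < M)%N -> (2 * #|S|)%N = totient M.
Proof.
move=> M2; have := big_units addn (fun=> 1%N) M2.
rewrite sum_nat_const muln2 -mul2n => <-.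
rewrite totient_count_coprime big_mkcond big_nat_recr ?(ltnW M_gt1) //= /coprime gcdnn.
rewrite ifF; last by lia.
rewrite addn0 [in RHS](@big_cat_nat _ _ _ 1) ?(ltnW M_gt1) //= big_nat1 gcdn0.
have -> : (M == 1)%N = false by lia.
by rewrite add0n; apply: eq_bigr => i _; rewrite gcdnC; case: (_ == _).
Qed.

Hypothesis aM : coprimez a M.

Lemma resid_coprime al : coprime al M -> coprime (resid al) M.
Proof.
move=> co; have : coprimez (resid al)%:Z M%:Z.
  have -> : (resid al)%:Z = - quo al * M%:Z + a * al%:Z by rewrite resid_eq; lia.
  by rewrite coprimez_sym /coprimez gcdzMDl -/(coprimez _ _) coprimezMr coprimez_sym aM coprimez_sym.
by [].
Qed.

(** The permutation of S induced by multiplication by a on units modulo sign. *)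
Definition hperm (s : 'I_M) : 'I_M :=
  odflt s [pick s' in S | (s' == resid s :> nat) || (s' + resid s == M)%N].

Lemma hpermP s : s \in S -> hperm s \in S /\
  (hperm s = resid s :> nat \/ (hperm s + resid s)%N = M).
Proof.
move=> sS; rewrite /hperm; case: pickP => [s' /andP[s'S /orP[]/eqP E]|].
- by split=> //; left.
- by split=> //; right.
have [s' s'S E] := rep_ex (resid_coprime (S_coprime sS)) (resid_lt s).
by move/(_ s'); rewrite s'S E.
Qed.

Lemma hperm_inj : {in S &, injective hperm}.
Proof.
move=> s s' sS s'S E; apply: rep_uniq => //.
have [_ H] := hpermP sS; have [_ H'] := hpermP s'S; rewrite E in H.
have [Es Es'] := (resid_eq s, resid_eq s').
have co : coprimez M a by rewrite coprimez_sym.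
have dn (x : nat) : (M%:Z %| x%:Z)%Z -> (x = 0 %[mod M])%N.
  by rewrite /dvdz /= => /eqP ->; rewrite mod0n.
have [D|D] : resid s = resid s' \/ (resid s + resid s')%N = M by lia.
- left; have : (M%:Z %| s%:Z - s'%:Z)%Z.
    rewrite -(Gauss_dvdzr _ co); apply/dvdzP; exists (quo s - quo s').
    by rewrite mulrBr Es Es' D; ring.
  case/dvdzP => k Ek; have [sM s'M] := (ltn_ord s, ltn_ord s').
  have : k = 0 by nia.
  by move=> k0; rewrite !modn_small //; move: Ek; rewrite k0; lia.
right; apply: dn; rewrite -(Gauss_dvdzr _ co); apply/dvdzP.
exists (quo s + quo s' + 1).
by rewrite PoszD mulrDr Es Es' [RHS]mulrDl mul1r -[X in _ = _ + X%:Z]D PoszD; ring.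
Qed.

Lemma hperm_imset : hperm @: S = S.
Proof.
apply/eqP; rewrite eqEcard card_in_imset ?leqnn ?andbT; last exact: hperm_inj.
by apply/fintype.subsetP => _ /imsetP[s sS ->]; case: (hpermP sS).
Qed.

Lemma big_hperm (V : Type) (idx : V) (op : Monoid.com_law idx) (f : nat -> V) :
  \big[op/idx]_(s in S) f (hperm s) = \big[op/idx]_(s in S) f s.
Proof. by rewrite -[in RHS]hperm_imset big_imset //; exact: hperm_inj. Qed.

Lemma big_resid (V : Type) (idx : V) (op : Monoid.com_law idx) (f : nat -> V) :
  (forall r, (0 < r < M)%N -> coprime r M -> f (M - r)%N = f r) ->
  \big[op/idx]_(s in S) f (resid s) = \big[op/idx]_(s in S) f s.
Proof.
move=> fE; rewrite -big_hperm; apply: eq_bigr => s sS.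
have [hS [->//|H]] := hpermP sS; have hc := S_coprime hS.
have -> : resid s = (M - hperm s)%N by lia.
by apply: fE => //; rewrite coprime_pos //= ltn_ord.
Qed.


Definition nneg : nat := #|[set s in S | hperm s != resid s :> nat]|.

(** Gauss's lemma: multiplying the congruences a s = +- s' over s in S and cancelling the
    product of S leaves a ^ #|S| = (-1) ^ nneg, where #|S| is half of phi(M). *)
Lemma gauss_pow (K : comUnitRingType) : M%:R = 0 :> K ->
  (a%:~R : K) ^+ #|S| = (-1) ^+ nneg.
Proof.
move=> MK.
have unitS s : s \in S -> (val s)%:R \is a @GRing.unit K.
  move=> sS; have := deltaP M_gt1 (S_coprime sS); rewrite (modn_small M_gt1) => E.
  apply/unitrPr; exists (delta M s)%:R; rewrite -natrM (divn_eq (s * _) M) E.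
  by rewrite natrD natrM MK mulr0 add0r.
have U : \prod_(s in S) (val s)%:R \is a @GRing.unit K.
  by elim/big_ind: _ => [||s sS]; [exact: unitr1|by move=> x y ux uy; rewrite unitrM ux uy|exact: unitS].
apply: (mulIr U).
have E (s : 'I_M) : s \in S -> a%:~R * (val s)%:R =
    (if hperm s != resid s :> nat then -1 else 1) * (val (hperm s))%:R :> K.
  move=> sS; have -> : a%:~R * (val s)%:R = (resid s)%:R :> K.
    have := congr1 (fun x : int => x%:~R : K) (resid_eq s).
    by rewrite rmorphM rmorphD rmorphM /= -!pmulrn MK mulr0 add0r.
  case: (hpermP sS) => _; case: (eqVneq (nat_of_ord (hperm s)) (resid s)) => [E _|ne] /=.
    by rewrite mul1r E.
  case=> [E|H]; first by rewrite E eqxx in ne.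
  by apply/eqP; rewrite mulN1r -addr_eq0 -natrD addnC H MK.
rewrite -prodr_const -big_split /= (eq_bigr _ E) big_split /=.
rewrite (big_hperm _ (fun x => x%:R : K)); congr (_ * _).
rewrite -big_mkcondr /= prodr_const /nneg; congr (_ ^+ _); apply: eq_card => s.
by rewrite !inE.
Qed.

(** From a s = q M + r with a and M odd, q has the parity of s + r, which is that of
    s + s' or, if the sign is negative, of s + s' + 1; the sum of s + s' over S is
    even since s' runs over S as well. *)
Lemma quo_nneg : odd M -> (a %% 2 = 1)%Z ->
  (2 %| \sum_(s in S) quo s - nneg%:Z)%Z.
Proof.
move=> Mo ao.
have E (s : 'I_M) : s \in S -> exists k,
   quo s = 2 * k + (val s)%:Z - (val (hperm s))%:Z + (hperm s != resid s :> nat)%:Z.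
  move=> sS; have := resid_eq s; have aE := divz_eq a 2; rewrite ao in aE.
  have ME : M%:Z = 2 * (M./2)%:Z + 1 by have := odd_double_half M; rewrite Mo; lia.
  case: (hpermP sS) => _ H.
  set u := (a %/ 2)%Z in aE; set v := (M./2)%:Z in ME.
  have [H'|H'] : (resid s)%:Z = (val (hperm s))%:Z /\ (hperm s != resid s :> nat) = false \/
      (resid s)%:Z = M%:Z - (val (hperm s))%:Z /\ (hperm s != resid s :> nat) = true.
    case: (eqVneq (nat_of_ord (hperm s)) (resid s)) => [E|ne]; [left|right].
      by split=> //; rewrite -E.
    by split=> //; case: H => [E|H]; [rewrite E eqxx in ne|rewrite -[X in X%:Z - _]H PoszD addrAC subrr add0r].
    case: H' => -> ->; rewrite aE ME => Eq.
    exists (u * (val s)%:Z - quo s * v); move: Eq; rewrite /= ; lia.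
  case: H' => -> ->; rewrite aE ME => Eq.
  exists (u * (val s)%:Z - quo s * v - v + (val (hperm s))%:Z - 1); move: Eq; rewrite /=; lia.
have [k kE] : exists k : 'I_M -> int, forall s, s \in S ->
   quo s = 2 * k s + (val s)%:Z - (val (hperm s))%:Z + (hperm s != resid s :> nat)%:Z.
  exists (fun s : 'I_M => xget 0 [set k : int | quo s = 2 * k + (val s)%:Z - (val (hperm s))%:Z + (hperm s != resid s :> nat)%:Z]).
  by move=> s /E[k Ek]; case: xgetP => [x -> //|/(_ k)].
rewrite (eq_bigr _ kE) big_split sumrB big_split /=.
rewrite (big_hperm _ (fun x => x%:Z)) -mulr_sumr.
have -> : \sum_(s in S) (hperm s != resid s :> nat)%:Z = nneg%:Z.
  rewrite -(big_morph Posz PoszD erefl) /nneg; congr Posz; rewrite -sum1_card [RHS]big_mkcond /=.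
  rewrite [LHS]big_mkcond /=; apply: eq_bigr => s _; rewrite inE.
  by case: (s \in S) => //=; case: (_ != _).
by apply/dvdzP; exists (\sum_(s in S) k s); ring.
Qed.

(** Here s and s' are odd, M = 2 mod 4 and a = 1 mod 4.  From a s = q M + r with r = s' or
    M - s' one gets 2 q = s - s' mod 4, and the sum of s - s' over S is 0. *)
Lemma quo_even : (M %% 4 = 2)%N -> (a %% 4 = 1)%Z -> (2 %| \sum_(s in S) quo s)%Z.
Proof.
move=> M4 a4.
have E (s : 'I_M) : s \in S -> exists k, 2 * quo s = 4 * k + s%:Z - (hperm s)%:Z.
  move=> sS; have := resid_eq s; have aE := divz_eq a 4; rewrite a4 in aE.
  have ME : M%:Z = 4 * (M %/ 4)%N%:Z + 2 by have := divn_eq M 4; rewrite M4; lia.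
  case: (hpermP sS) => hS H.
  have ho : odd (hperm s).
    have := S_coprime hS; apply: contraTT => he.
    have : (2 %| gcdn (hperm s) M)%N by rewrite dvdn_gcd !dvdn2 he; move: M4; lia.
    by rewrite /coprime; apply: contraTneq => ->.
  have hE : (hperm s)%:Z = 2 * ((hperm s)./2)%:Z + 1 by have := odd_double_half (hperm s); rewrite ho; lia.
  set u := (a %/ 4)%Z in aE; set v := (M %/ 4)%N%:Z in ME; set w := ((hperm s)./2)%:Z in hE.
  case: H => H.
    by rewrite -H aE ME => Eq; exists (u * s%:Z - quo s * v); lia.
  have -> : (resid s)%:Z = M%:Z - (hperm s)%:Z by lia.
  by rewrite aE ME hE => Eq; exists (u * s%:Z - quo s * v - v + w); lia.
have [k kE] : exists k : 'I_M -> int, forall s, s \in S ->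
   2 * quo s = 4 * k s + s%:Z - (hperm s)%:Z.
  exists (fun s : 'I_M => xget 0 [set k : int | 2 * quo s = 4 * k + s%:Z - (hperm s)%:Z]).
  by move=> s /E[k Ek]; case: xgetP => [x -> //|/(_ k)].
have : 2 * \sum_(s in S) quo s = 4 * \sum_(s in S) k s.
  rewrite !mulr_sumr (eq_bigr _ kE) sumrB big_split /=.
  by rewrite (big_hperm _ (fun x => x%:Z)) addrK.
by move=> Eq; apply/dvdzP; exists (\sum_(s in S) k s); lia.
Qed.

End Half.

(** Being a nonzero square modulo an odd prime p, expressed by Euler's criterion, the
    form in which Gauss's lemma produces it. *)
Definition qres p (a : int) : bool := (a%:~R : 'F_p) ^+ p.-1./2 == 1.

Lemma coprime_noprime m n : (0 < n)%N ->
  (forall p, prime p -> (p %| n)%N -> ~~ (p %| m)%N) -> coprime m n.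
Proof.
move=> n0 H; rewrite /coprime; apply: contraT => g1.
have g0 : (1 < gcdn m n)%N by rewrite ltn_neqAle eq_sym g1 gcdn_gt0 n0 orbT.
have pp := pdiv_prime g0; have := H _ pp.
rewrite !(dvdn_trans (pdiv_dvd _)) ?dvdn_gcdl ?dvdn_gcdr //; exact.
Qed.

Lemma Fp_p p : prime p -> p%:R = 0 :> 'F_p.
Proof. by move=> pp; apply/eqP; rewrite -(dvdn_pcharf (pchar_Fp pp)). Qed.

Lemma Fp_intr_eq0 p (a : int) : prime p -> ((a%:~R : 'F_p) == 0) = (p%:Z %| a)%Z.
Proof.
move=> pp; rewrite -[(p%:Z %| a)%Z]/(p %| `|a|)%N (dvdn_pcharf (pchar_Fp pp)).
by case: a => n; rewrite ?NegzE ?rmorphN ?oppr_eq0 ?abszN.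
Qed.

(** X ^ ((p - 1) / 2) - 1 has fewer than p - 1 roots. *)
Lemma qres_ex p : prime p -> odd p -> exists i, coprime i p /\ ~~ qres p i%:Z.
Proof.
move=> pp po; have p1 := prime_gt1 pp.
pose P := 'X^(p.-1./2) - 1%:P : {poly 'F_p}.
have e0 : (0 < p.-1./2)%N by move: po p1; case: (p) => [|[|[|k]]].
have sP : size P = p.-1./2.+1 by rewrite size_XnsubC.
have P0 : P != 0 by rewrite -size_poly_eq0 sP.
pose rs := [seq i%:R : 'F_p | i <- iota 1 p.-1].
have urs : uniq rs.
  rewrite map_inj_in_uniq ?iota_uniq // => i j; rewrite !mem_iota => Hi Hj.
  move=> /(congr1 val); rewrite /= !val_Fp_nat // !modn_small //; lia.
have : ~~ all (root P) rs.
  apply/negP => al; have := max_poly_roots P0 al urs.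
  by rewrite sP size_map size_iota; lia.
rewrite /rs all_map; case/allPn => i; rewrite mem_iota => Hi nr; exists i; split.
  by rewrite coprime_sym prime_coprime // gtnNdvd //; lia.
by move: nr; rewrite /= rootE /P !hornerE subr_eq0 /qres -pmulrn.
Qed.

(** The Chinese remainder theorem for n and the part of Q prime to n, of which 8 is a
    divisor as n is odd. *)
Lemma crt_ex n Q i : odd n -> coprime i n -> (0 < Q)%N -> (n %| Q)%N -> (8 %| Q)%N ->
  exists b, [/\ (b = i %[mod n])%N, (b = 1 %[mod 8])%N, coprime b Q
    & forall p, prime p -> (p %| Q)%N -> ~~ (p %| n)%N -> (b = 1 %[mod p])%N].
Proof.
move=> no co Q0 nQ Q8; have n0 : (0 < n)%N by move: no; case: (n).
pose K := (Q`_(\pi(n)^'))%N; have K0 : (0 < K)%N by rewrite part_gt0.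
have coK : coprime n K.
  by apply: (@pnat_coprime \pi(n)); rewrite ?pnat_pi ?part_pnat.
have pK p : prime p -> (p %| Q)%N -> ~~ (p %| n)%N -> (p %| K)%N.
  move=> pp pQ pn; have : (p \in \pi(n)^') by rewrite inE /= mem_primes pp n0.
  by move=> ppi; rewrite -(part_pnat_id (_ : (\pi(n)^').-nat p)%N) ?partn_dvd // pnatE.
have K8 : (8 %| K)%N.
  rewrite -(part_pnat_id (_ : (\pi(n)^').-nat 8)%N); first exact: partn_dvd.
  by rewrite (_ : 8 = 2 ^ 3)%N // pnatX pnatE // !inE /= mem_primes n0 dvdn2 no.
pose b := chinese n K i 1.
have bn : (b = i %[mod n])%N by rewrite /b chinese_modl.
have bK : (b = 1 %[mod K])%N by rewrite /b chinese_modr.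
have dK q : (q %| K)%N -> (b = 1 %[mod q])%N.
  by move=> qK; have := congr1 (modn^~ q) bK; rewrite !modn_dvdm.
exists b; split=> //; first exact: dK.
  apply: coprime_noprime => // p pp pQ; case: (boolP (p %| n)%N) => [pn|/(pK p pp pQ)/dK bp].
    have -> : (p %| b)%N = (p %| i)%N.
      by rewrite /dvdn; have := congr1 (modn^~ p) bn; rewrite !modn_dvdm // => ->.
    by rewrite -prime_coprime // coprime_sym (coprime_dvdr pn).
  by rewrite /dvdn bp modn_small ?prime_gt1.
by move=> p pp pQ /(pK p pp pQ)/dK.
Qed.

(** The part of K made of the primes that do not divide x is a solution j: a prime factor
    of K divides exactly one of x and y j. *)
Lemma coprime_lift (x y : int) K : (0 < K)%N -> coprimez x y ->
  exists j : nat, coprimez (x + y * j%:Z) K%:Z.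
Proof.
move=> K0 co; pose pi := [pred p | ~~ (p%:Z %| x)%Z] : nat_pred.
exists (K`_pi)%N; apply: coprime_noprime => // p pp pK.
rewrite -[(p %| _)%N]/(p%:Z %| x + y * (K`_pi)%N%:Z)%Z.
have [px|px] := boolP (p%:Z %| x)%Z.
  rewrite rpredDl // dvdzE abszM Euclid_dvdM // negb_or.
  apply/andP; split.
    apply/negP => py; have : (p %| gcdn `|x| `|y|)%N by rewrite dvdn_gcd; apply/andP.
    by move: co; rewrite /coprimez /gcdz => /eqP[->]; rewrite dvdn1 => /eqP p1; rewrite p1 in pp.
  rewrite -prime_coprime //; apply: (@pnat_coprime pi^').
    by rewrite pnatE // !inE /= negbK.
  by rewrite pnatNK part_pnat.
have pj : (p%:Z %| y * (K`_pi)%N%:Z)%Z.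
  rewrite dvdz_mull // dvdzE /=.
  by rewrite -(part_pnat_id (_ : pi.-nat p)) ?partn_dvd // pnatE.
by rewrite rpredDr.
Qed.

(** If x is odd it is invertible modulo 8; if x = 2 mod 4 then a is odd and x j covers the
    even classes.  Checked over all classes modulo 8. *)
Lemma mod8_lift (a x : int) : (x %% 4 != 0)%Z -> ((a %% 2)%Z != 0) || ((x %% 2)%Z != 0) ->
  exists j : nat, ((a + x * j%:Z) %% 8)%Z = 1.
Proof.
have fin : all (fun r : nat => all (fun s : nat => (s %% 4 != 0)%N && (odd r || odd s) ==>
    has (fun j : nat => (r + s * j) %% 8 == 1)%N (iota 0 8)) (iota 0 8)) (iota 0 8).
  by vm_compute.
have Rd (b : int) : exists2 r : nat, (r < 8)%N & exists u : int, b = 8 * u + r%:Z.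
  exists `|(b %% 8)%Z|%N; first by lia.
  by exists (b %/ 8)%Z; lia.
have [r r8 [u ->]] := Rd a; have [s s8 [v ->]] := Rd x => x4 od.
have /allP/(_ r) := fin; rewrite mem_iota => /(_ r8)/allP/(_ s).
rewrite mem_iota => /(_ s8)/implyP H.
have /hasP[j _ /eqP E] : has (fun j : nat => (r + s * j) %% 8 == 1)%N (iota 0 8).
  by apply: H; apply/andP; split; lia.
exists j; have -> : 8 * u + r%:Z + (8 * v + s%:Z) * j%:Z = 8 * (u + v * j%:Z) + (r + s * j)%N%:Z.
  by rewrite PoszD PoszM; ring.
move: (u + v * j%:Z) (r + s * j)%N E => w q E.
lia.
Qed.

Section Parity.
Variables (M : nat) (S : {set 'I_M}) (a : int).
Hypotheses (M_gt1 : (1 < M)%N) (SP : half_units S) (aM : coprimez a M).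
Hypotheses (M_gt2 : (2 < M)%N).

(** By Gauss's lemma the parity is given by the sign a ^ (phi(M) / 2) modulo p.  For
    M = p ^ r it is the quadratic character of a at p.  If M has a second prime factor q,
    then phi(M) / 2 is a multiple of p - 1, because q - 1 is even, and the sign is 1. *)
Lemma quo_odd p : prime p -> odd M -> (p %| M)%N -> (a %% 2 = 1)%Z ->
  (2 %| \sum_(s in S) quo M a s)%Z = p.-nat M ==> qres p a.
Proof.
move=> pp Mo pM a2.
have po : odd p by apply: dvdn_odd pM Mo.
have -> : (2 %| \sum_(s in S) quo M a s)%Z = ~~ odd (nneg S a).
  have := quo_nneg M_gt1 SP aM Mo a2 => D.
  by rewrite -(subrK (nneg S a)%:Z (\sum_(s in S) _)) rpredDl // dvdzE /= dvdn2.
have K0 : M%:R = 0 :> 'F_p.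
  by rewrite -(divnK pM) natrM Fp_p // mulr0.
have a0 : (a%:~R : 'F_p) != 0.
  rewrite Fp_intr_eq0 //; apply/negP => pa.
  have : (p %| gcdn `|a| M)%N by rewrite dvdn_gcd pM andbT.
  by move: aM; rewrite /coprimez /gcdz => /eqP[->]; rewrite dvdn1 => /eqP p1; rewrite p1 in pp.
have aF x : x != 0 :> 'F_p -> x ^+ p.-1 = 1.
  move=> x0; apply: (mulIf x0); rewrite mul1r -exprSr prednK ?prime_gt0 //.
  by rewrite -[in RHS](finfield.expf_card x) card_Fp.
have N1 : -1 != 1 :> 'F_p.
  rewrite eq_sym -addr_eq0 -(natrD _ 1 1) -(dvdn_pcharf (pchar_Fp pp)).
  by apply: contraL po => /dvdn_leq -/(_ isT); have := prime_gt1 pp; case: (p) => [|[|[|]]].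
have <- : ((a%:~R : 'F_p) ^+ #|S| == 1) = ~~ odd (nneg S a).
  rewrite (gauss_pow M_gt1 SP aM K0) -signr_odd; case: odd; rewrite ?eqxx //.
  by rewrite expr1 (negbTE N1).
have cS := card_half M_gt1 SP M_gt2.
have M0 : (0 < M)%N by apply: ltnW.
have pE := odd_double_half p; rewrite po in pE.
have ep : p.-1 = (2 * p.-1./2)%N by lia.
case: (boolP (p.-nat M)) => /= pnat.
  have [r Mr] := p_natP pnat; rewrite [totient _](congr1 totient Mr) in cS.
  have r0 : (0 < r)%N by case: (r) Mr M_gt1 => // ->.
  rewrite totient_pfactor // ep -mulnA in cS.
  have {cS} -> : #|S| = (p.-1./2 * p ^ r.-1)%N by lia.
  rewrite exprM /qres; congr (_ == _); elim: (r.-1) => [|k IH]; first by rewrite expr1.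
  by rewrite expnSr exprM IH; have := finfield.expf_card ((a%:~R : 'F_p) ^+ p.-1./2); rewrite card_Fp.
have [q [qp qM qnp]] : exists q, [/\ prime q, (q %| M)%N & q != p].
  move: pnat; rewrite /pnat M0 /= => /allPn[q]; rewrite mem_primes => /and3P[qp _ qM].
  by rewrite inE => qnp; exists q.
have qo : odd q by apply: dvdn_odd qM Mo.
have : (p.-1 * q.-1 %| totient M)%N.
  rewrite totientE // (bigD1_seq p) ?mem_primes ?pp ?M0 ?pM ?primes_uniq //=.
  rewrite dvdn_mul ?dvdn_mulr // -big_filter (bigD1_seq q) ?filter_uniq ?primes_uniq //=.
    by rewrite -mulnA dvdn_mulr.
  by rewrite mem_filter mem_primes qnp qp M0 qM.
case/dvdnP => k; rewrite -cS.
have qE := odd_double_half q; rewrite qo in qE.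
have eq : q.-1 = (2 * q.-1./2)%N by lia.
rewrite eq => E; have -> : #|S| = (p.-1 * (k * q.-1./2))%N by nia.
by rewrite exprM aF // expr1n eqxx.
Qed.
End Parity.

(** Twice the exponent sumX is d times the sum in the definition of psi, modulo l.  The
    full sum over units splits into pairs s, M - s; since delta (M - s) is
    M - delta s and the quotients q of s and M - s add up to a - 1, each pair
    contributes 2 delta s (e + d q) after multiplication by d, as d (1 - a) = d - 1 = 2 e
    modulo l. *)
Lemma half_sum_psi (M : nat) (S : {set 'I_M}) (a d e k : int) (l w i : nat) :
  (2 < M)%N -> half_units S -> coprimez a M -> (l %| M)%N ->
  (M%:Z %| a * d - 1)%Z -> d = 2 * e + 1 -> a = i%:Z + (w * l * M)%N%:Z * k ->
  (l%:Z %| 2 * \sum_(s in S) (delta M s)%:Z * (e + d * quo M a s)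
    - d * \sum_(1 <= al < M.+1 | coprime al M) (delta M al * (al * i %/ M))%N%:Z)%Z.
Proof.
move=> M2 SP aM lM ad dE aE; have M1 := ltnW M2.
have M0 : (0 < M)%N by apply: ltnW.
have tM (al : nat) : (l%:Z %| (delta M al)%:Z * quo M a al - (delta M al * (al * i %/ M))%N%:Z)%Z.
  have -> : quo M a al = (al * i %/ M)%N%:Z + w%:Z * l%:Z * k * al%:Z.
    rewrite /quo aE (_ : _ * _ = (w%:Z * l%:Z * k * al%:Z) * M%:Z + (al * i)%N%:Z); last by rewrite !PoszM; ring.
    by rewrite divzMDl ?divz_nat 1?addrC // eqz_nat -lt0n.
  apply/dvdzP; exists ((delta M al)%:Z * w%:Z * k * al%:Z); rewrite PoszM; ring.
have -> : d * \sum_(1 <= al < M.+1 | coprime al M) (delta M al * (al * i %/ M))%N%:Z =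
   d * \sum_(1 <= al < M.+1 | coprime al M) (delta M al)%:Z * quo M a al -
   d * \sum_(1 <= al < M.+1 | coprime al M) ((delta M al)%:Z * quo M a al - (delta M al * (al * i %/ M))%N%:Z).
  by rewrite -mulrBr -sumrB; congr (_ * _); apply: eq_bigr => al _; rewrite opprB addrC subrK.
rewrite opprB addrCA rpredD //.
  by rewrite dvdz_mull // rpred_sum // => al _; apply: tM.
rewrite (big_units M1 SP _ (fun al => (delta M al)%:Z * quo M a al)) //= !mulr_sumr -sumrB.
apply: rpred_sum => s sS; have sco := S_coprime SP sS.
have sM := ltn_ord s; have s0 := coprime_pos M1 sco.
have r0 := coprime_pos M1 (resid_coprime M1 aM sco); have rM := resid_lt a M1 s.
have qM : quo M a (M - s)%N = a - 1 - quo M a s.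
  rewrite {1}/quo; have := resid_eq a M1 s; set q := quo M a s; set r := resid M a s => E.
  rewrite (_ : a * _ = (a - 1 - q) * M%:Z + (M%:Z - r%:Z)).
    by rewrite divzMDl ?divz_small ?addr0 // ?eqz_nat -?lt0n //; lia.
  have -> : (M - s)%N%:Z = M%:Z - s%:Z by lia.
  by rewrite mulrBr E; ring.
have dM : (delta M (M - s)%N)%:Z = M%:Z - (delta M s)%:Z.
  by rewrite delta_opp //; have := delta_lt s M1; lia.
rewrite qM dM; set q := quo M a s; set de := (delta M s)%:Z.
have lMz : (l%:Z %| M%:Z)%Z by [].
have : (l%:Z %| a * d - 1)%Z by apply: dvdz_trans ad.
case/dvdzP: lMz => u ->; case/dvdzP => v Ev.
apply/dvdzP; exists (de * v - d * u * (a - 1 - q)).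
have -> : 2 * (de * (e + d * q)) = de * (d - 1) + 2 * de * d * q by rewrite dE; ring.
transitivity (de * (v * l%:Z) - d * u * (a - 1 - q) * l%:Z); [rewrite -Ev|]; ring.
Qed.
Section SiegelFunctions.
Variable R : realType.
Implicit Types (z w h l : R[i]) (u v : nat -> R[i]).
Notation nc := (@ComplexField.Normc.normc R).
Arguments ComplexField.Normc.normc : simpl never.
(** * The functions of the theorem as products of Siegel functions *)

Lemma E_sieg (N : nat) (g h : int) t : (0 < N)%N -> 0 < complex.Im t ->
  E N g h t = sieg (g%:~R / N%:R) (h%:~R / N%:R) t :> R[i].
Proof.
move=> N0 t0; rewrite /E /sieg qpowE; congr (_ * _).
set x : R := g%:~R / N%:R; set y : R := h%:~R / N%:R.
have zE (k : int) : zeta_pow R N k = cex ((k%:~R / N%:R : R)%:C).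
  by rewrite /zeta_pow e2piE rmorphM fmorphV rmorph_int rmorph_nat.
have q1 : nc (cex t) < 1 by apply: nc_cex_lt1.
apply: (@cvg_lim (R[i]^o)) => //; apply/cvgCP.
have H := cvgCM (eprod_cvg (cex (x%:C * t + y%:C)) q1)
                (eprod_cvg (cex (t - (x%:C * t + y%:C))) q1).
have H' : cvgC (fun k => eprod (cex (x%:C * t + y%:C)) (cex t) k.-1 *
                 eprod (cex (t - (x%:C * t + y%:C))) (cex t) k.-1)
     (Sg (x%:C * t + y%:C) t).
  move=> e /H[n0 Hn]; exists n0.+1 => -[|k] // kn; exact: Hn.
apply: (cvgC_eventually (n0 := 1%N)) H' => -[|k] // _.
rewrite /eprod -big_split /= big_add1 /= big_mkord; apply: eq_bigr => i _.
rewrite !zE !qpowE -!cexMn -!cexD; congr ((1 - cex _) * (1 - cex _)).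
  rewrite -/y -natr1 addrK rmorphD rmorph_nat; ring.
rewrite rmorphN mulNr -/y -natr1 !(rmorphB, rmorphD, rmorphN, rmorph_nat, rmorph1) /=; ring.
Qed.

Lemma contCP (f : R[i] -> R[i]) z :
  contC f z <-> {for z, continuous (f : R[i]^o -> R[i]^o)}%classic.
Proof.
split=> [H|/cvgrPdist_lt H e e0].
  move=> A /nearCP[e e0 He]; have [d d0 Hd] := H e e0.
  by apply/nearCP; exists d => // w /Hd; exact: He.
have := H e%:C; rewrite ltcR => /(_ e0) /nearCP [d d0 Hd]; exists d => // w wd.
by have := Hd w wd; rewrite distrC ncE ltcR.
Qed.

Lemma contCM (f g : R[i] -> R[i]) z : contC f z -> contC g z -> contC (fun w => f w * g w) z.
Proof. by move=> /contCP cf /contCP cg; apply/contCP; exact: cvgM cf cg. Qed.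

Lemma holo_cont (f : R[i] -> R[i]) t : holomorphic_at f t -> contC f t.
Proof.
by move=> /nbhs_singleton /derivable1_diffP /differentiable_continuous /contCP.
Qed.

Lemma Im_natM (n : nat) t : (0 < n)%N -> 0 < complex.Im t -> 0 < complex.Im (n%:R * t : R[i]).
Proof.
by move=> n0 t0; rewrite -(rmorph_nat (real_complex R)) Im_mulR mulr_gt0 // ltr0n.
Qed.

Lemma jet2_scale (f : R[i] -> R[i]) (a t : R[i]) : jet2 f (a * t) -> jet2 (fun w => f (a * w)) t.
Proof. by move=> H; apply: jet2_comp => //; apply: jet2M; [exact: jet2_cst|exact: jet2_id]. Qed.

(** The quotient of f by web1 is a continuous square root of 1, hence a constant sign. *)
Lemma sqrt_web1 (f : R[i] -> R[i]) (n : nat) : (0 < n)%N ->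
  (forall t, 0 < complex.Im t -> holomorphic_at f t /\ f t ^+ 2 = web1 (n%:R * t) ^+ 2) ->
  exists2 s : R[i], s != 0 & forall t, 0 < complex.Im t -> f t = s * web1 (n%:R * t).
Proof.
move=> n0 H; have i0 := i_gt0 R.
have w0 t : 0 < complex.Im t -> web1 (n%:R * t) != 0 :> R[i].
  by move=> t0; apply: web_neq0 (Im_natM n0 t0) _ _; left.
pose u t := f t * (web1 (n%:R * t))^-1.
have u2 t : 0 < complex.Im t -> u t ^+ 2 = 1.
  by move=> t0; rewrite /u exprMn exprVn (H t t0).2 divff // expf_neq0 // w0.
have ui0 : u 'i != 0.
  by apply/eqP => E; have := u2 'i i0; rewrite E expr0n /= => /esym/eqP; rewrite oner_eq0.
have cu t : 0 < complex.Im t -> contC u t.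
  move=> t0; apply: contCM; first exact: holo_cont (H t t0).1.
  apply: jet2_cont; apply: jet2V; first exact: w0.
  by apply: jet2_scale; apply: web_jet2; [left|exact: Im_natM].
have E := @discrete_const R (fun t => u 'i * u t) 'i.
exists (u 'i) => // t t0.
have Et : u 'i * u t = 1.
  apply: E t t0 => // [w w1|w w1|].
  - apply: contCM; [exact: jet2_cont (jet2_cst _ _)|exact: cu].
  - by apply: sqr_root_re; rewrite exprMn !u2 // mulr1.
  by rewrite -expr2 u2.
have ut : u t = u 'i.
  by apply: (mulfI ui0); rewrite Et -expr2 u2.
by rewrite -ut /u divfK // w0.
Qed.

Lemma sieg_mob_ph a b c d : a * d - b * c = 1 -> exists k : int,
  [/\ k%:~R = eta2_exp3 a%:~R b%:~R c%:~R d%:~R,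
      k%:~R = eta2_exp4 a%:~R b%:~R c%:~R d%:~R &
      forall x1 x2 t, 0 < complex.Im t -> sieg x1 x2 (mob a b c d t) =
        ph (k%:~R / 12 + (x1 * b%:~R + x2 * d%:~R) * (x1 * a%:~R + x2 * c%:~R - 1) / 2
            - x2 * (x1 - 1) / 2) *
        sieg (x1 * a%:~R + x2 * c%:~R) (x1 * b%:~R + x2 * d%:~R) t :> R[i]].
Proof.
move=> det; have [k [k3 k4 H]] := sieg_mob R det; exists k; split=> // x1 x2 t t0.
have := H x1 x2 t t0; rewrite /sgf; set s := sieg x1 x2 _; set s' := sieg _ _ t => E; clearbody s s'.
apply: (mulfI (ph_neq0 (x2 * (x1 - 1) / 2))); rewrite E !mulrA -!phD.
by congr (ph _ * _); ring.
Qed.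

(** On matrices that are diagonal modulo 24 with a = 1 mod 8, both classes of the exponent
    of eta ^ 2 vanish. *)
Lemma eta2_diag (a b c d k : int) : a * d - b * c = 1 -> (24 %| b)%Z -> (24 %| c)%Z ->
  (a %% 8 = 1)%Z -> k%:~R = eta2_exp3 a%:~R b%:~R c%:~R d%:~R ->
  k%:~R = eta2_exp4 a%:~R b%:~R c%:~R d%:~R -> (12 %| k)%Z.
Proof.
move=> det b24 c24 a8 k3 k4.
have z0 n (w : int) : (n %| 24)%N -> (1 < n)%N -> (24 %| w)%Z -> w%:~R = 0 :> 'Z_n.
  move=> n24 n1 /dvdzP[w' ->]; rewrite rmorphM /=.
  by have -> : 24%:~R = 0 :> 'Z_n; [apply/val_inj; rewrite [LHS](@val_Zp_nat n n1 24); apply/eqP|rewrite mulr0].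
have k3' : (3 %| k)%Z.
  by apply: (@Zp_intr_eq0 3) => //; rewrite k3 (z0 3%N b) // (z0 3%N c) // /eta2_exp3 !mul0r addr0.
have k4' : (4 %| k)%Z.
  apply: (@Zp_intr_eq0 4) => //; rewrite k4 (z0 4%N b) // (z0 4%N c) // /eta2_exp4 /= subr0 add0r.
  have -> : d%:~R = 1 :> 'Z_4.
    have a4 : a%:~R = 1 :> 'Z_4.
      rewrite (divz_eq a 8) a8 rmorphD rmorphM /= (_ : 8%:~R = 0 :> 'Z_4) ?mulr0 ?add0r //.
      by apply/eqP; vm_compute.
    have := congr1 (fun z : int => z%:~R : 'Z_4) det.
    by rewrite rmorphB !rmorphM /= a4 mul1r (z0 4%N b) // mul0r subr0.
  by apply/eqP; vm_compute.
by rewrite (@Gauss_dvdz 3 4) ?k3'.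
Qed.

(** The exponent of f_1 is known modulo 8 from its own recurrence.  Its square is a Siegel
    product, whose multiplier is trivial here, so it is also 0 modulo 12. *)
Lemma web1_diag (n : nat) (a b c d : int) t : ~~ odd n -> 0 < complex.Im t ->
  a * d - b * n%:Z * c = 1 -> (24 %| b)%Z -> (24 %| c)%Z -> (a %% 8 = 1)%Z ->
  web1 (mob a (b * n%:Z) c d t) = web1 t :> R[i].
Proof.
move=> ne t0 det b24 c24 a8.
have nE : n%:Z = (n./2)%:Z * 2 by have := odd_double_half n; rewrite (negbTE ne); lia.
have det2 : a * d - b * (n./2)%:Z * 2 * c = 1 by rewrite -[RHS]det nE; ring.
have [k k8 Hk] := web1_mob R det2.
rewrite nE mulrA Hk //.
have w0 : web1 t != 0 :> R[i] by apply: web_neq0 => //; left.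
have [k2 [k3 k4 Hk2]] := sieg_mob_ph det2.
have /dvdzP[u bE] := b24; have /dvdzP[v cE] := c24.
have /dvdzP[k' kE] : (12 %| k2)%Z.
  by apply: eta2_diag det2 _ c24 a8 k3 k4; rewrite -mulrA dvdz_mulr.
have aE : a = 8 * (a %/ 8)%Z + 1 by have := divz_eq a 8; rewrite a8; lia.
set w := (a %/ 8)%Z in aE.
have E12 : ph (k%:~R / 12) = 1 :> R[i].
  have w2 : web1 t ^+ 2 != 0 :> R[i] by rewrite expf_neq0.
  apply: (mulIf w2); rewrite mul1r.
  have := Hk2 (1 / 2) 0 t t0.
  rewrite !mul0r !addr0 subr0 sieg_web1 Hk // exprMn => E.
  have <- : ph (k%:~R / 24) ^+ 2 = ph (k%:~R / 12) :> R[i].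
    by rewrite -phMn; congr ph; field.
  rewrite E.
  have -> : 1 / 2 * (b * (n./2)%:Z * 2)%:~R = 0 + (b * (n./2)%:Z)%:~R :> R.
    by rewrite add0r [in LHS]rmorphM /=; field.
  have -> : 1 / 2 * a%:~R = 1 / 2 + (4 * w)%:~R :> R.
    by rewrite aE rmorphD !rmorphM /= rmorph1; field.
  rewrite sieg_perZ2 sieg_perZ1 // sieg_web1 mulrA -phD -[RHS]mul1r; congr (_ * _).
  rewrite -(ph_int R (k' + 6 * u * (n./2)%:Z * (8 * w - 1) + 2 * w)); congr ph.
  by rewrite kE bE !(rmorphD, rmorphB, rmorphM) /= ; field.
have /dvdzP[k0 kE0] : (24 %| k)%Z.
  have k8' : (8 %| k)%Z.
    apply: (@Zp_intr_eq0 8) => //; rewrite k8 /web1_exp.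
    have z8 (x : int) : (8 %| x)%Z -> x%:~R = 0 :> 'Z_8.
      case/dvdzP => y ->; rewrite rmorphM /= (_ : 8%:~R = 0) ?mulr0 //.
      by apply/eqP; vm_compute.
    rewrite (z8 (b * _)) ?(z8 c) ?dvdz_mulr //; last by apply: dvdz_trans b24.
      have -> : a%:~R = 1 :> 'Z_8 by rewrite aE rmorphD /= (z8 (8 * w)) ?add0r // dvdz_mulr.
      by apply/eqP; vm_compute.
    by apply: dvdz_trans c24.
  have [z zE] := ph_eq1 E12.
  have kz : k = 12 * z.
    by apply/eqP; rewrite -(eqr_int R) rmorphM /= -zE; apply/eqP; field.
  rewrite (@Gauss_dvdz 3 8) // k8' andbT kz (_ : 12 * z = 3 * (4 * z)); last by ring.
  exact: dvdz_mulr.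
have -> : k%:~R / 24 = k0%:~R :> R by rewrite kE0 rmorphM /=; field.
by rewrite ph_int mul1r.
Qed.

Section Multiplier.
Variables (N m h : nat) (S : {set 'I_(mpp N m)}).
Hypotheses (N_gt0 : (0 < N)%N) (mD : m \in proper_divisors N).
Hypothesis SP : half_units S.
Local Notation l := (ell N m).
Local Notation M := (mpp N m).
Let M1 : (1 < M)%N := M_gt1 N_gt0 mD.
Let l0 : (0 < l)%N := l_gt0 N_gt0 mD.
Let NE : (m * l * M)%N = N := level_eq N_gt0 mD.

(** One factor of F_{m,h}, in the variable N' tau.  The characteristic of
    E_{alpha m l, delta h N'} is (alpha / M, delta h / l), since N = m l M and N' = m M. *)
Definition siegF (al : nat) (t : R[i]) : R[i] :=
  sieg (al%:R / M%:R) ((delta M al)%:R * h%:R / l%:R) t.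

Lemma NZ : N%:Z = m%:Z * l%:Z * M%:Z. Proof. by rewrite -!PoszM NE. Qed.
Lemma M_neq0 : M%:R != 0 :> R. Proof. by rewrite pnatr_eq0 -lt0n ltnW. Qed.
Lemma l_neq0 : l%:R != 0 :> R. Proof. by rewrite pnatr_eq0 -lt0n. Qed.

Lemma siegF_opp al t : 0 < complex.Im t -> (0 < al < M)%N -> coprime al M ->
  siegF (M - al) t = siegF al t.
Proof.
move=> t0 /andP[al0 alM] co; rewrite /siegF delta_opp //.
rewrite !natrB ?(ltnW alM) ?(ltnW (delta_lt al M1)) //.
have /dvdnP[u Mu] : (l %| M)%N := l_dvd_M N_gt0 mD.
rewrite -[RHS]sieg_refl -[RHS](sieg_perZ2 _ _ _ (u * h)%N); congr sieg.
  by rewrite mulrBl divff ?M_neq0.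
have MR : M%:R = u%:R * l%:R :> R by rewrite [M in LHS]Mu natrM.
rewrite MR -pmulrn natrM; field; exact: l_neq0.
Qed.

Section Gamma.
Variables (a b c1 d : int).
Hypothesis det : a * d - b * (N%:Z * c1) = 1.

Lemma level_det : a * d - (b * (Np N m)%:Z) * (c1 * l%:Z) = 1.
Proof.
rewrite -[RHS]det -[in RHS]NE Np_eq // !PoszM; ring.
Qed.

Lemma a_coprime : coprimez a M%:Z.
Proof.
apply/coprimezP; exists (d, - b * m%:Z * l%:Z * c1) => /=.
by rewrite -[RHS]det -[in RHS]NE !PoszM; ring.
Qed.

Lemma level_mob t : 0 < complex.Im t ->
  (Np N m)%:R * mob a b (N%:Z * c1) d t =
  mob a (b * (Np N m)%:Z) (c1 * l%:Z) d ((Np N m)%:R * t) :> R[i].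
Proof.
move=> t0; rewrite /mob mulrA mulrDr !rmorphM /=.
have -> : N%:~R = (Np N m)%:R * l%:R :> R[i].
  by rewrite -natrM Np_eq // -mulnA (mulnC (mpp N m)) mulnA NE.
by rewrite -!pmulrn; congr (_ / _); ring.
Qed.

(** The phase by which a matrix multiplies the factor of index al.  The new characteristic
    is (a al / M + c1 de h, ...), whose first entry is reduced to that of the residue of
    a al by an integral translation, costing another phase. *)
Definition kappa (k : int) (al : nat) : R :=
  let x1 := al%:R / M%:R in let x2 := (delta M al)%:R * h%:R / l%:R in
  let y1 := x1 * a%:~R + x2 * (c1 * l%:Z)%:~R in
  let y2 := x1 * (b * (Np N m)%:Z)%:~R + x2 * d%:~R in
  k%:~R / 12 + y2 * (y1 - 1) / 2 - x2 * (x1 - 1) / 2 +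
  (quo M a al + c1 * (delta M al)%:Z * h%:Z)%:~R * (1 / 2 - y2).

(** The second entry of the new characteristic is, modulo 1, delta (a al) h / l, because
    d is inverse to a modulo M and l divides M: the shape (alpha / M, delta h / l) is
    preserved. *)
Lemma siegF_mob (k : int) :
  (forall x1 x2 t, 0 < complex.Im t ->
    sieg x1 x2 (mob a (b * (Np N m)%:Z) (c1 * l%:Z) d t) =
        ph (k%:~R / 12 + (x1 * (b * (Np N m)%:Z)%:~R + x2 * d%:~R) *
             (x1 * a%:~R + x2 * (c1 * l%:Z)%:~R - 1) / 2 - x2 * (x1 - 1) / 2) *
        sieg (x1 * a%:~R + x2 * (c1 * l%:Z)%:~R)
          (x1 * (b * (Np N m)%:Z)%:~R + x2 * d%:~R) t :> R[i]) ->
  forall al t, 0 < complex.Im t -> coprime al M ->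
  siegF al (mob a (b * (Np N m)%:Z) (c1 * l%:Z) d t) =
  ph (kappa k al) * siegF (resid M a al) t.
Proof.
move=> H al t t0 co; rewrite /siegF H // /kappa.
set x1 := al%:R / M%:R; set x2 := _ * _ / l%:R; set de := delta M al in x2 *.
set y2 := x1 * (b * _)%:~R + _; set r := resid M a al; set q := quo M a al.
have Mn := M_neq0; have ln := l_neq0.
have Er : a%:~R * al%:R = q%:~R * M%:R + r%:R :> R.
  have := congr1 (fun z : int => z%:~R : R) (resid_eq a M1 al).
  by rewrite rmorphM rmorphD rmorphM /= -!pmulrn.
have -> : x1 * a%:~R + x2 * (c1 * l%:Z)%:~R =
    r%:R / M%:R + (q + c1 * de%:Z * h%:Z)%:~R.
  apply: (mulIf Mn); rewrite !mulrDl [x1 * _ * _]mulrAC /x1 divfK // mulrC Er divfK //.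
  by rewrite /x2 !(rmorphD, rmorphM) /= -!pmulrn; field.
have [s sE] : exists s : int, d * de%:Z = (delta M r)%:Z + M%:Z * s.
  have rco : coprimez M%:Z r%:Z.
    by rewrite coprimez_sym; exact: (resid_coprime M1 a_coprime co).
  have : (M%:Z %| d * de%:Z - (delta M r)%:Z)%Z.
    rewrite -(Gauss_dvdzr _ rco).
    have D (x y : nat) : (x * y = 1 %[mod M])%N -> (M%:Z %| x%:Z * y%:Z - 1)%Z.
      by move=> E; rewrite -PoszM -eqz_mod_dvd !modz_nat eqz_nat; apply/eqP.
    have /dvdzP[u Eu] := D _ _ (deltaP M1 co).
    have /dvdzP[v Ev] : (M%:Z %| r%:Z * (delta M r)%:Z - 1)%Z.
      by apply: D; apply: deltaP => //; exact: (resid_coprime M1 a_coprime co).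
    apply/dvdzP; exists (a * d * u + b * m%:Z * l%:Z * c1 - q * d * de%:Z - v).
    have Ez := resid_eq a M1 al; rewrite -/q -/r in Ez.
    have -> : r%:Z * (d * de%:Z - (delta M r)%:Z) =
       a * d * (al%:Z * de%:Z - 1) + (a * d - 1) - q * M%:Z * d * de%:Z
       - (r%:Z * (delta M r)%:Z - 1).
      by rewrite (_ : r%:Z = a * al%:Z - q * M%:Z); [ring|rewrite Ez; ring].
    have -> : a * d - 1 = b * m%:Z * l%:Z * c1 * M%:Z.
      by rewrite -[X in _ - X]det NZ; ring.
    by rewrite Eu Ev; ring.
  by case/dvdzP => s Es; exists s; rewrite (mulrC _ s) -Es; ring.
rewrite sieg_perZ1 // mulrA -phD; congr (ph _ * _).
have /dvdnP[u Mu] : (l %| M)%N := l_dvd_M N_gt0 mD.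
have MR : M%:R = u%:R * l%:R :> R by rewrite [M in LHS]Mu natrM.
rewrite -[RHS](sieg_perZ2 _ _ _ (al%:Z * b * m%:Z + u%:Z * s * h%:Z)); congr sieg.
have sR : d%:~R * de%:R = (delta M r)%:R + M%:R * s%:~R :> R.
  by have := congr1 (fun z : int => z%:~R : R) sE; rewrite rmorphM rmorphD rmorphM /= -!pmulrn.
rewrite /y2 /x2 (_ : _ * d%:~R = (d%:~R * de%:R) * h%:R / l%:R); last by ring.
rewrite MR in sR; rewrite sR Np_eq // PoszM /x1 !(rmorphD, rmorphM) /= -!pmulrn; field.
by rewrite ln Mn.
Qed.
End Gamma.

Section Diagonal.
Variables (a b c1 d : int).
Hypothesis det : a * d - b * (N%:Z * c1) = 1.

Definition prodF (t : R[i]) : R[i] := \prod_(al in S) siegF al ((Np N m)%:R * t).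

Lemma Np_gt0 : (0 < Np N m)%N.
Proof. by rewrite Np_eq // muln_gt0 (pd_gt0 N_gt0 mD) ltnW. Qed.

Lemma Im_level t : 0 < complex.Im t -> 0 < complex.Im ((Np N m)%:R * t : R[i]).
Proof.
move=> t0; rewrite -(rmorph_nat (real_complex R)) Im_mulR mulr_gt0 //.
by rewrite ltr0n Np_gt0.
Qed.

(** Multiplication by a permutes the units modulo M up to sign, and the factors of opposite
    indices are equal, so the product is an eigenfunction. *)
Lemma prodF_mob : exists k : int,
  [/\ k%:~R = eta2_exp3 a%:~R (b * (Np N m)%:Z)%:~R (c1 * l%:Z)%:~R d%:~R,
      k%:~R = eta2_exp4 a%:~R (b * (Np N m)%:Z)%:~R (c1 * l%:Z)%:~R d%:~R &
      forall t, 0 < complex.Im t -> prodF (mob a b (N%:Z * c1) d t) =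
        \prod_(al in S) ph (kappa a b c1 d k al) * prodF t].
Proof.
have [k [k3 k4 H]] := sieg_mob_ph (level_det det); exists k; split=> // t t0.
rewrite /prodF level_mob //.
under eq_bigr => al alS do
  rewrite (siegF_mob det H) ?Im_level ?(S_coprime SP alS) //.
rewrite big_split /=; congr (_ * _).
rewrite (@big_resid _ S a M1 SP (a_coprime det) _ _ _ (fun r => siegF r ((Np N m)%:R * t))) // => r rM co.
by apply: siegF_opp => //; exact: Im_level.
Qed.

(** For matrices that are diagonal modulo 24 N the multiplier is expressed by two sums of
    the quotients of a al by M: sumT for its sign and sumX for its l-th root of unity. *)
Definition sumT : int := \sum_(al in S) quo M a al.
Definition sumX (e : int) : int := \sum_(al in S) (delta M al)%:Z * (e + d * quo M a al).

(** The two phases differ by an integer Z, read off by expanding kappa with b and c1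
    divisible by 24 N, up to a multiple of the determinant relation. *)
Lemma kappa_diag (b' c' k' e : int) (al : nat) : b = 24%N%:Z * N%:Z * b' -> c1 = 24%N%:Z * N%:Z * c' ->
  d = 2 * e + 1 ->
  ph (kappa a b c1 d (12%N%:Z * k') al) =
  ph ((quo M a al)%:~R / 2 - h%:R / l%:R * ((delta M al)%:Z * (e + d * quo M a al))%:~R) :> R[i].
Proof.
move=> bE cE dE; have Mn := M_neq0; have ln := l_neq0.
rewrite /kappa; set q := quo M a al; set de := delta M al.
pose Z : int := k' + 12%N%:Z * m%:Z * l%:Z * b' * m%:Z * a * al%:Z ^+ 2
  + 12%N%:Z * N%:Z * b' * al%:Z * m%:Z * (c1 * de%:Z * h%:Z - 1)
  + 12%N%:Z * m%:Z * M%:Z * c' * d * de%:Z ^+ 2 * h%:Z ^+ 2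
  + 12%N%:Z * m%:Z * N%:Z * b' * c1 * al%:Z * de%:Z * h%:Z
  + 12%N%:Z * N%:Z * c' * de%:Z * h%:Z
  - (q + c1 * de%:Z * h%:Z) * al%:Z * b * m%:Z
  - 24%N%:Z * m%:Z * M%:Z * c' * d * de%:Z ^+ 2 * h%:Z ^+ 2.
rewrite -[RHS](ph_addint _ Z); congr ph.
have dR : a%:~R * d%:~R - b%:~R * (N%:R * c1%:~R) - 1 = 0 :> R.
  have := congr1 (fun z : int => z%:~R : R) det.
  by rewrite rmorphB !rmorphM rmorph1 /= -!pmulrn => ->; rewrite subrr.
have NR : N%:R = m%:R * l%:R * M%:R :> R by rewrite -[in LHS]NE !natrM.
transitivity (q%:~R / 2 - h%:R / l%:R * (de%:Z * (e + d * q))%:~R + Z%:~R +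
  al%:R * de%:R * h%:R / (2 * l%:R * M%:R) * (a%:~R * d%:~R - b%:~R * (N%:R * c1%:~R) - 1) : R); last first.
  by rewrite dR mulr0 addr0.
have bR : b%:~R = 24%:R * N%:R * b'%:~R :> R by rewrite bE !rmorphM /= -!pmulrn.
have cR : c1%:~R = 24%:R * N%:R * c'%:~R :> R by rewrite cE !rmorphM /= -!pmulrn.
have eR : d%:~R = 2 * e%:~R + 1 :> R by rewrite dE rmorphD rmorphM rmorph1 /=.
rewrite /Z Np_eq // PoszM !expr2 !(rmorphD, rmorphB, rmorphN, rmorphM) rmorph1 /= -!pmulrn.
rewrite bR cR eR NR.
by field; rewrite ln Mn.
Qed.

Lemma prodF_diag (e : int) t : 0 < complex.Im t ->
  ((24 * N)%N%:Z %| b)%Z -> ((24 * N)%N%:Z %| c1)%Z ->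
  (a %% 8 = 1)%Z -> d = 2 * e + 1 ->
  prodF (mob a b (N%:Z * c1) d t) =
  ph (sumT%:~R / 2 - h%:R / l%:R * (sumX e)%:~R) * prodF t.
Proof.
move=> t0 /dvdzP[b']; rewrite (mulrC b') PoszM => bE /dvdzP[c']; rewrite (mulrC c') => cE a8 dE.
have [k [k3 k4 ->//]] := prodF_mob.
have /dvdzP[k' kE] : (12 %| k)%Z.
  apply: eta2_diag (level_det det) _ _ a8 k3 k4.
    by rewrite bE -!mulrA dvdz_mulr.
  by rewrite cE -!mulrA dvdz_mulr.
have -> : k = 12%N%:Z * k' by rewrite kE mulrC.
under eq_bigr => al alS do rewrite (kappa_diag k' al bE cE dE).
rewrite -(big_morph _ (@phD R) (@ph0 R)); congr (ph _ * _).
by rewrite sumrB /sumT /sumX !rmorph_sum mulr_suml mulr_sumr.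
Qed.
End Diagonal.

Lemma prodF_neq0 t : 0 < complex.Im t -> prodF t != 0.
Proof.
move=> t0; apply/prodf_neq0 => al alS; apply: sieg_neq0; first exact: Im_level.
move=> [j [_ [E _]]]; have := S_coprime SP alS; have := coprime_pos M1 (S_coprime SP alS).
have : al%:R = (j * M%:Z)%:~R :> R.
  by rewrite rmorphM /= -E -!pmulrn divfK ?M_neq0.
move=> /eqP; rewrite pmulrn eqr_int => /eqP Ej.
have : (M %| al)%N by apply/dvdnP; exists `|j|%N; have := ltn_ord al; nia.
by move=> /dvdn_leq H /H; rewrite leqNgt ltn_ord.
Qed.

Lemma prodF_jet2 t : 0 < complex.Im t -> jet2 prodF t.
Proof.
move=> t0; rewrite /prodF.
apply: (@jet2_ext _ (fun t => \prod_(al <- enum S) siegF al ((Np N m)%:R * t)) _ t 1) => // [w _|].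
  by rewrite big_enum.
elim: (enum S) => [|al s IH].
  by apply: (@jet2_ext _ (fun=> 1) _ t 1) => // [w _|]; [rewrite big_nil|exact: jet2_cst].
apply: (@jet2_ext _ (fun t => siegF al ((Np N m)%:R * t) * \prod_(al <- s) siegF al ((Np N m)%:R * t)) _ t 1) => // [w _|].
  by rewrite big_cons.
apply: jet2M IH; apply: jet2_scale; apply: sieg_jet2 => //; exact: Im_level.
Qed.
End Multiplier.

Lemma is_F_prod (S : forall n, {set 'I_n}) N m (h : nat) f : (0 < N)%N -> m \in proper_divisors N ->
  is_F S N m h f -> mpp N m != 2%N -> forall t, 0 < complex.Im t ->
  f t = prodF h (S (mpp N m)) t :> R[i].
Proof.
move=> N0 mD; rewrite /is_F => H /negbTE M2; rewrite M2 in H => t t0.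
rewrite H // /prodF; apply: eq_bigr => al alS; rewrite E_sieg //; last exact: Im_level.
have Mn := M_neq0 N0 mD; have ln := l_neq0 N0 mD.
have m0 : m%:R != 0 :> R by rewrite pnatr_eq0 -lt0n (pd_gt0 N0 mD).
have NR : N%:R = m%:R * (ell N m)%:R * (mpp N m)%:R :> R.
  by rewrite -[in LHS](level_eq N0 mD) !natrM.
by rewrite /siegF -!pmulrn NR Np_eq // !natrM; congr sieg; field; rewrite ?Mn ?ln ?m0.
Qed.

(** M = 2 forces l = 1 and h = 0, so the characteristic is (1 / 2, 0) and E is
    web1 ^ 2 at N tau. *)
Lemma is_F_web (S : forall n, {set 'I_n}) N m (h : nat) f : (0 < N)%N -> m \in proper_divisors N ->
  odd (ell N 1) -> (h < ell N m)%N ->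
  is_F S N m h f -> mpp N m = 2%N -> exists2 s : R[i], s != 0 &
  forall t, 0 < complex.Im t -> f t = s * web1 (N%:R * t).
Proof.
move=> N0 mD Lo hl; rewrite /is_F => H M2; rewrite M2 in H.
have l1 := level2 N0 mD Lo M2; have h0 : h = 0%N by rewrite l1 in hl; case: (h) hl.
apply: sqrt_web1 => // t t0; have [Hh Hsq] := H t t0; split=> //.
have NpE : Np N m = N by rewrite Np_eq // M2 -[RHS](level_eq N0 mD) l1 M2 muln1.
rewrite Hsq NpE E_sieg //; last exact: Im_natM.
have m0 : m%:R != 0 :> R by rewrite pnatr_eq0 -lt0n (pd_gt0 N0 mD).
have NR : N%:R = m%:R * 2 :> R.
  by rewrite -[in LHS](level_eq N0 mD) l1 M2 muln1 natrM.
rewrite h0 mul0n mul0r -sieg_web1 l1 muln1 -!pmulrn NR; congr sieg; field; exact: m0.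
Qed.
End SiegelFunctions.
Section Expansions.
Variable R : realType.
Implicit Types (z w h l : R[i]) (u v : nat -> R[i]).
Notation nc := (@ComplexField.Normc.normc R).
Arguments ComplexField.Normc.normc : simpl never.
(** * Expansions at the cusps *)

Lemma cex_small (a r : R) : 0 < a -> 0 < r -> exists2 y : R, 0 < y &
  forall t, y < complex.Im t -> nc (cex (a%:C * t)) < r.
Proof.
move=> a0 r0; have p0 : 0 < 2 * pi * a :> R by rewrite !mulr_gt0 // pi_gt0.
exists (`|ln r| / (2 * pi * a) + 1).
  by rewrite ltr_wpDl // divr_ge0 // ltW.
move=> t yt; rewrite nc_cex Im_mulR mulrA -[ltRHS]lnK ?posrE // ltr_expR.
have : `|ln r| / (2 * pi * a) < complex.Im t by lra.
rewrite ltr_pdivrMr // mulrC => H.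
have := ler_norm (- ln r); rewrite normrN; lra.
Qed.

Lemma psbound_half c (r : R) : (forall r : R, 0 <= r < 1 -> psbound c r) -> psbound c (1 / 2 : R).
Proof. by apply; lra. Qed.

Lemma pser0 c (r : R) : 0 < r -> psbound c r -> pser c 0 = c 0%N.
Proof.
move=> r0 cr; have H : nc 0 < r by rewrite nc0.
apply: (cvgC_unique (pserP r0 H cr)).
apply: (cvgC_eventually (n0 := 1%N)) (cvgC_cst (c 0%N)) => -[|n] // _.
rewrite /psums big_ord_recl expr0 mulr1 big1 ?addr0 // => i _.
by rewrite /= expr0n mulr0.
Qed.

Lemma pser_sub c (r : R) (K z : R[i]) (p : nat) : (0 < p)%N -> 0 < r -> psbound c r -> nc z = 1 ->
  exists c' (r' : R), [/\ 0 < r', psbound c' r', c' 0%N = K * c 0%N,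
    forall x, nc x < r' -> nc x ^+ p < r &
    forall x, nc x < r' -> K * pser c (z * x ^+ p) = pser c' x].
Proof.
move=> p0 r0 cr z1.
pose c' k := if (p %| k)%N then K * (c (k %/ p)%N * z ^+ (k %/ p)) else 0.
pose r' := Num.min r 1.
have r'0 : 0 < r' by rewrite lt_min r0 ltr01.
have r'r : r' <= r by rewrite ge_min lexx.
have r'1 : r' <= 1 by rewrite ge_min lexx orbT.
have pw x : nc x < r' -> nc x ^+ p < r.
  move=> xr; have x0 := nc_ge0 x; apply: le_lt_trans (lt_le_trans xr r'r).
  by rewrite -[leRHS]expr1 ler_wiXn2l //; lra.
have c'r : psbound c' r'.
  have [B B0 HB] := cr; exists (nc K * B); first by rewrite mulr_ge0 ?nc_ge0.
  move=> k; rewrite /c'; case: ifP => [/dvdnP[j ->]|_]; last by rewrite nc0 mul0r mulr_ge0 ?nc_ge0.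
  rewrite mulnK // !ncM ncX z1 expr1n mulr1 -mulrA ler_wpM2l ?nc_ge0 //.
  apply: le_trans (HB j); rewrite ler_wpM2l ?nc_ge0 // mulnC exprM.
  apply: lerXn2r; rewrite ?nnegrE ?exprn_ge0 ?(ltW r'0) ?(ltW r0) //.
  by apply: le_trans r'r; rewrite -[leRHS]expr1 ler_wiXn2l // ltW.
exists c', r'; split=> //; first by rewrite /c' dvdn0 div0n expr0 mulr1.
move=> x xr; have zx : nc (z * x ^+ p) < r by rewrite ncM z1 mul1r ncX pw.
have H1 := cvgC_csumZ K (pserP r0 zx cr).
have H2 := cvgC_sub (fun n => leq_pmull n p0) (pserP r'0 xr c'r).
apply: cvgC_unique H2; apply: (cvgC_eventually (n0 := 0%N)) H1 => n _.
elim: n => [|n IH]; first by rewrite muln0 /psums !big_ord0.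
rewrite /psums in IH *; rewrite big_ord_recr /= IH mulnS addnC.
rewrite -!(big_mkord xpredT (fun k => c' k * x ^+ k)).
rewrite (big_cat_nat (leq0n _) (leq_addr p (p * n))) /=; congr (_ + _).
rewrite big_ltn; last by rewrite -[X in (X < _)%N]addn0 ltn_add2l.
rewrite big_nat_cond big1 ?addr0 => [|k /andP[/andP[k1 k2] _]].
  by rewrite /c' dvdn_mulr // mulKn // exprMn -exprM; ring.
rewrite /c' ifF ?mul0r //; apply/negP => /dvdnP[j kE]; move: k1 k2; rewrite kE mulnC.
rewrite -mulSnr !ltn_pmul2r // ltnS => n1 /(leq_trans n1); by rewrite ltnn.
Qed.

(** A q-expansion in powers of q ^ (1 / n) with leading exponent k / n. *)
Definition qe (k : int) (n : nat) (f : R[i] -> R[i]) : Prop :=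
  (0 < n)%N /\ exists c (r y : R), [/\ 0 < r, psbound c r, c 0%N != 0 &
    forall t, y < complex.Im t -> nc (cex ((n%:R^-1)%:C * t)) < r /\
      f t = cex ((k%:~R / n%:R)%:C * t) * pser c (cex ((n%:R^-1)%:C * t))].

(** For unspecified k and n the class is closed under products and inverses; the nonzero
    constant term excludes only the zero function. *)
Definition QE f : Prop := exists k n, qe k n f.

Lemma cex_scaleMn (a : R) (p : nat) t : cex ((p%:R * a)%:C * t) = cex (a%:C * t) ^+ p.
Proof. by rewrite -cexMn rmorphM rmorph_nat mulrA. Qed.

Lemma qe_make f (k : int) (n p : nat) (K z : R[i]) c (r y : R) :
  (0 < n)%N -> (0 < p)%N -> 0 < r -> psbound c r -> c 0%N != 0 -> K != 0 -> nc z = 1 ->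
  (forall t, y < complex.Im t -> nc (cex ((n%:R^-1)%:C * t)) ^+ p < r ->
     f t = cex ((k%:~R / n%:R)%:C * t) * (K * pser c (z * cex ((n%:R^-1)%:C * t) ^+ p))) ->
  qe k n f.
Proof.
move=> n0 p0 r0 cr c0 K0 z1 H; split=> //.
have [c' [r' [r'0 c'r c'0 pw E]]] := pser_sub K p0 r0 cr z1.
have nV : 0 < n%:R^-1 :> R by rewrite invr_gt0 ltr0n.
have [y' y'0 Hy] := cex_small nV r'0.
exists c', r', (Num.max y y'); split=> //; first by rewrite c'0 mulf_neq0.
move=> t; rewrite gt_max => /andP[yt /Hy tr]; split=> //.
by rewrite H ?E // pw.
Qed.

Lemma qe_rescale f k n m : (0 < m)%N -> qe k n f -> qe (k * m%:Z) (n * m) f.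
Proof.
move=> m0 [n0 [c [r [y [r0 cr c0 H]]]]].
have nm : (n * m)%:R != 0 :> R by rewrite pnatr_eq0 -lt0n muln_gt0 n0.
have mR : m%:R != 0 :> R by rewrite pnatr_eq0 -lt0n.
have nR : n%:R != 0 :> R by rewrite pnatr_eq0 -lt0n.
apply: (@qe_make _ _ _ m 1 1 c r y) => //; rewrite ?muln_gt0 ?n0 ?oner_neq0 ?nc1 // => t yt _.
have [_ ->] := H t yt; rewrite !mul1r -cex_scaleMn; congr (cex (_%:C * t) * pser c (cex (_%:C * t))).
  by rewrite rmorphM /= -pmulrn natrM; field; rewrite nR mR.
by rewrite natrM; field; rewrite nR mR.
Qed.

Lemma qe_mul f g k k' n : qe k n f -> qe k' n g -> qe (k + k') n (fun t => f t * g t).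
Proof.
move=> [n0 [c [r [y [r0 cr c0 H]]]]] [_ [c' [r' [y' [r'0 c'r c'0 H']]]]]; split=> //.
pose s := Num.min r r'; have s0 : 0 < s by rewrite lt_min r0.
have sr : s <= r by rewrite ge_min lexx.
have sr' : s <= r' by rewrite ge_min lexx orbT.
have cs : psbound c s by apply: psbound_le cr; rewrite sr ltW.
have c's : psbound c' s by apply: psbound_le c'r; rewrite sr' ltW.
have s2 : 0 < s / 2 < s by lra.
have cc : psbound (cauchy_prod c c') (s / 2).
  apply: psbound_cauchy s2 cs _; apply: psbound_le c's; lra.
have nV : 0 < n%:R^-1 :> R by rewrite invr_gt0 ltr0n.
have s20 : 0 < s / 2 by lra.
have [z z0 Hz] := cex_small nV s20.
exists (cauchy_prod c c'), (s / 2), (Num.max (Num.max y y') z); split=> //.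
  by rewrite /cauchy_prod big_ord_recl big_ord0 addr0 mulf_neq0.
move=> t; rewrite !gt_max => /andP[/andP[yt y't] /Hz ts]; split=> //.
have [_ ->] := H t yt; have [_ ->] := H' t y't.
rewrite (@pser_cauchy _ _ _ s) //; last by lra.
have -> : cex (((k + k')%:~R / n%:R)%:C * t) =
   cex ((k%:~R / n%:R)%:C * t) * cex ((k'%:~R / n%:R)%:C * t).
  by rewrite -cexD -mulrDl -rmorphD -mulrDl -rmorphD.
ring.
Qed.

Lemma qe_inv f k n : qe k n f -> qe (- k) n (fun t => (f t)^-1).
Proof.
move=> [n0 [c [r [y [r0 cr c0 H]]]]]; split=> //.
have [d [s [s0 sr ds d0 E]]] := pser_inv r0 cr c0.
have nV : 0 < n%:R^-1 :> R by rewrite invr_gt0 ltr0n.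
have [z z0 Hz] := cex_small nV s0.
exists d, s, (Num.max y z); split=> // t; rewrite gt_max => /andP[yt /Hz ts]; split=> //.
have [_ ->] := H t yt; rewrite invfM rmorphN mulNr rmorphN mulNr cexN; congr (_ * _).
have Ex := E _ ts; apply: (mulfI (_ : pser c (cex ((n%:R^-1)%:C * t)) != 0)).
  by apply/eqP => E0; move: Ex; rewrite E0 mul0r => /esym/eqP; rewrite oner_eq0.
rewrite Ex divff //; apply/eqP => E0; move: Ex; rewrite E0 mul0r => /esym/eqP; by rewrite oner_eq0.
Qed.

Lemma QE_mul f g : QE f -> QE g -> QE (fun t => f t * g t).
Proof.
move=> [k [n H]] [k' [n' H']]; exists (k * n'%:Z + k' * n%:Z), (n * n')%N.
apply: qe_mul; first exact: qe_rescale H'.1 H.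
by rewrite mulnC; exact: qe_rescale H.1 H'.
Qed.

Lemma QE_inv f : QE f -> QE (fun t => (f t)^-1).
Proof. by move=> [k [n H]]; exists (- k), n; exact: qe_inv. Qed.

Lemma QE_ext f g : (forall t, 0 < complex.Im t -> f t = g t) -> QE f -> QE g.
Proof.
move=> fg [k [n [n0 [c [r [y [r0 cr c0 H]]]]]]]; exists k, n; split=> //.
exists c, r, (Num.max y 0); split=> // t; rewrite gt_max => /andP[yt t0].
by have [? ?] := H t yt; split=> //; rewrite -fg.
Qed.

Lemma QE_cst (a : R[i]) : a != 0 -> QE (fun=> a).
Proof.
move=> a0; exists 0, 1%N; pose c (k : nat) : R[i] := if k == 0%N then 1 else 0.
have c1 : psbound c 1.
  exists 1; first exact: ler01.
  by move=> k; rewrite expr1n mulr1 /c; case: eqP; rewrite ?nc1 ?nc0 ?ler01.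
apply: (@qe_make _ 0 1 1 a 1 c 1 0) => //; rewrite ?ltr01 ?oner_neq0 ?nc1 // => t t0 t1.
rewrite mul0r mul0r cex0 !mul1r -[LHS]mulr1; congr (_ * _).
have x1 : nc (cex ((1%:R^-1)%:C * t) ^+ 1) < 1 by rewrite ncX.
apply: esym; apply: (cvgC_unique (pserP ltr01 x1 c1)).
apply: (cvgC_eventually (n0 := 1%N)) (cvgC_cst 1) => -[|n] // _.
rewrite /psums big_ord_recl expr0 mulr1 big1 ?addr0 // => i _.
by rewrite /c /= mul0r.
Qed.

Lemma QE_exp f (k : int) : QE f -> QE (fun t => f t ^ k).
Proof.
move=> H; have N n : QE (fun t => f t ^+ n).
  elim: n => [|n IH]; first exact: QE_cst (oner_neq0 _).
  by apply: QE_ext (QE_mul H IH) => t _; rewrite exprS.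
by case: k => n; [exact: N | exact: QE_inv (N _)].
Qed.

Lemma QE_prod (I : eqType) (s : seq I) (F : I -> R[i] -> R[i]) :
  (forall i, i \in s -> QE (F i)) -> QE (fun t => \prod_(i <- s) F i t).
Proof.
elim: s => [|i s IH] H.
  by apply: QE_ext (QE_cst (oner_neq0 _)) => t _; rewrite big_nil.
have H1 : QE (F i) by apply: H; rewrite mem_head.
have H2 : QE (fun t => \prod_(i <- s) F i t) by apply: IH => j js; apply: H; rewrite inE js orbT.
by apply: QE_ext (QE_mul H1 H2) => t _; rewrite big_cons.
Qed.

Lemma cex_affine (e a b : R) t :
  cex (e%:C * (a%:C * t + b%:C)) = cex ((e * a)%:C * t) * ph (e * b).
Proof. by rewrite mulrDr cexD mulrA -!rmorphM. Qed.

(** Replacing t by (A t + B) / D only changes the denominator n and twists the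
    coefficients by roots of unity. *)
Lemma QE_lin f (e : R) (k0 : int) (n n0 A D : nat) (B : int) c :
  (0 < n)%N -> (0 < n0)%N -> (0 < A)%N -> (0 < D)%N -> e = k0%:~R / n0%:R ->
  (forall r : R, 0 <= r < 1 -> psbound c r) -> c 0%N != 0 ->
  (forall t, 0 < complex.Im t -> f t = cex (e%:C * t) * pser c (cex ((n%:R^-1)%:C * t))) ->
  QE (fun t => f ((A%:R * t + B%:~R) / D%:R)).
Proof.
move=> nn n00 A0 D0 eE cb c0 H; exists (k0 * A%:Z * n%:Z), (D * n * n0)%N.
have nR : n%:R != 0 :> R by rewrite pnatr_eq0 -lt0n.
have n0R : n0%:R != 0 :> R by rewrite pnatr_eq0 -lt0n.
have DR : D%:R != 0 :> R by rewrite pnatr_eq0 -lt0n.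
apply: (@qe_make _ _ _ (A * n0) (ph (e * (B%:~R / D%:R))) (ph (n%:R^-1 * (B%:~R / D%:R))) c (1 / 2) 0).
- by rewrite !muln_gt0 D0 nn.
- by rewrite muln_gt0 A0.
- by lra.
- exact: psbound_half.
- by [].
- exact: ph_neq0.
- exact: nc_ph.
move=> t t0 _.
have E : (A%:R * t + B%:~R) / D%:R = (A%:R / D%:R : R)%:C * t + (B%:~R / D%:R : R)%:C :> R[i].
  by rewrite !rmorphM !fmorphV !rmorph_nat rmorph_int mulrDl mulrAC.
have Et : 0 < complex.Im ((A%:R * t + B%:~R) / D%:R : R[i]).
  by rewrite E ImD Im_mulR /= addr0 mulr_gt0 // divr_gt0 ?ltr0n.
rewrite H // E !cex_affine -cex_scaleMn.
have -> : (A * n0)%:R * ((D * n * n0)%:R)^-1 = n%:R^-1 * (A%:R / D%:R) :> R.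
  by rewrite !natrM; field; rewrite nR n0R DR.
have -> : (k0 * A%:Z * n%:Z)%:~R / (D * n * n0)%:R = e * (A%:R / D%:R) :> R.
  by rewrite eE !natrM !rmorphM /= -!pmulrn; field; rewrite nR n0R DR.
rewrite mulrA; congr (_ * pser c _); exact: mulrC.
Qed.

Lemma half_plane_lin (A D : nat) (B : int) t : (0 < A)%N -> (0 < D)%N -> 0 < complex.Im t ->
  0 < complex.Im ((A%:R * t + B%:~R) / D%:R : R[i]).
Proof.
move=> A0 D0 t0.
have -> : (A%:R * t + B%:~R) / D%:R = (A%:R / D%:R : R)%:C * t + (B%:~R / D%:R : R)%:C :> R[i].
  by rewrite !rmorphM !fmorphV !rmorph_nat rmorph_int mulrDl mulrAC.
by rewrite ImD Im_mulR /= addr0 mulr_gt0 // divr_gt0 ?ltr0n.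
Qed.

(** The characteristic is first reduced to 0 <= x1 < 1 by an integral translation. *)
Lemma sieg_lin_QE (n A D : nat) (z B : int) (x2 : R) :
  (0 < n)%N -> (0 < A)%N -> (0 < D)%N ->
  ~ (exists j k : int, z%:~R / n%:R = j%:~R :> R /\ x2 = k%:~R) ->
  QE (fun t => sieg (z%:~R / n%:R) x2 ((A%:R * t + B%:~R) / D%:R)).
Proof.
move=> n0 A0 D0 H; have nR : n%:R != 0 :> R by rewrite pnatr_eq0 -lt0n.
pose a := `|(z %% n)%Z|%N; pose k := (z %/ n)%Z.
have zE : z = k * n%:Z + a%:Z by rewrite /a gez0_abs ?modz_ge0 ?eqz_nat -?lt0n //; exact: divz_eq.
have an : (a < n)%N by rewrite -ltz_nat /a gez0_abs ?modz_ge0 ?ltz_pmod ?eqz_nat -?lt0n // ltz_nat.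
have xE : z%:~R / n%:R = a%:R / n%:R + k%:~R :> R.
  by rewrite zE rmorphD rmorphM /= -!pmulrn; field.
have [c [cb c0 Hc]] := sieg_pser x2 an.
have c0' : c 0%N != 0.
  rewrite c0; case: (a =P 0%N) => [a0|_]; last by rewrite oner_eq0.
  rewrite subr_eq0 eq_sym; apply/eqP => /ph_eq1[j xj]; apply: H; exists k, j; split=> //.
  by rewrite xE a0 mul0r add0r.
have Q : QE (fun t => sieg (a%:R / n%:R) x2 ((A%:R * t + B%:~R) / D%:R)).
  have [k0 [n1 [n10 eE]]] : exists (k0 : int) (n1 : nat),
      (0 < n1)%N /\ B2 (a%:R / n%:R) / 2 = k0%:~R / n1%:R :> R.
    exists (6 * a%:Z ^+ 2 - 6 * a%:Z * n%:Z + n%:Z ^+ 2), (12 * n ^ 2)%N; split.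
      by rewrite muln_gt0 expn_gt0 n0.
    rewrite /B2 natrM natrX !(rmorphD, rmorphB, rmorphM, rmorphXn) /= -!pmulrn.
    by field; exact: nR.
  apply: (@QE_lin _ _ k0 n n1 A D B c n0 n10 A0 D0 eE cb c0') => t t0.
  by rewrite (Hc t t0); congr (_ * pser c (cex (_ * t))); rewrite fmorphV rmorph_nat.
have Q' := QE_mul (QE_cst (ph_neq0 (k%:~R * (1 / 2 - x2)))) Q.
apply: QE_ext Q' => t t0; rewrite xE sieg_perZ1 //; exact: half_plane_lin.
Qed.

Lemma webf_lin_QE i (A D : nat) (B : int) : (0 < A)%N -> (0 < D)%N ->
  QE (fun t => @webf R i ((A%:R * t + B%:~R) / D%:R)).
Proof.
move=> A0 D0; have W s : s = 1 \/ s = -1 -> QE (fun t => web s ((A%:R * t + B%:~R) / D%:R)).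
  move=> s1; have [c [cb c0 Hc]] := @web_pser R s s1.
  apply: (@QE_lin _ (- 1 / 48) (- 1) 2 48 A D B c) => //.
    by rewrite c0 oner_neq0.
rewrite /webf; case: eqP => _; first by apply: W; right.
case: eqP => _; first by apply: W; left.
have [c [cb c0 Hc]] := web2_pser R.
apply: (@QE_lin _ (1 / 24) 1 1 24 A D B c) => //.
by rewrite c0 oner_neq0.
Qed.

(** Hermite normal form: (n 0; 0 1) times a matrix of SL2(Z) is again a matrix of SL2(Z)
    times an upper triangular one.  It reduces the expansion of f(n tau) at any cusp
    to expansions of transforms of f at infinity. *)
Lemma hermite (n : nat) (a b c d : int) : (0 < n)%N -> a * d - b * c = 1 ->
  exists p r q s B : int, exists A D : nat,
  [/\ p * s - r * q = 1, (0 < A)%N, (0 < D)%N &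
   forall t : R[i], 0 < complex.Im t ->
    n%:R * mob a b c d t = mob p r q s ((A%:R * t + B%:~R) / D%:R)].
Proof.
move=> n0 det; pose A := gcdz (n%:Z * a) c.
have A0 : 0 < A.
  rewrite lt_def gcdz_eq0 negb_and; apply/andP; split; last by [].
  case: (eqVneq c 0) => [c0|_]; last by rewrite orbT.
  rewrite orbF mulf_neq0 ?eqz_nat -?lt0n //; apply/eqP => a0.
  by move: det; rewrite a0 c0 !(mul0r, mulr0) subrr.
have /dvdzP[p pE] : (A %| n%:Z * a)%Z by exact: dvdz_gcdl.
have /dvdzP[q qE] : (A %| c)%Z by exact: dvdz_gcdr.
have [u [v uv]] := Bezoutz (n%:Z * a) c.
have pq : p * u + q * v = 1.
  apply: (mulIf (lt0r_neq0 A0)); rewrite mul1r -[RHS]uv mulrDl.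
  by rewrite pE qE; ring.
pose D := p * d - q * (n%:Z * b).
have AD : A * D = n%:Z.
  transitivity (p * A * d - q * A * (n%:Z * b)); first by rewrite /D; ring.
  rewrite -pE -qE; transitivity (n%:Z * (a * d - b * c)); first by ring.
  by rewrite det mulr1.
have D0 : 0 < D by rewrite -(pmulr_rgt0 _ A0) AD ltz_nat.
exists p, (- v), q, u, (u * (n%:Z * b) + v * d), `|A|%N, `|D|%N.
have [AN DN] : (`|A|%N)%:Z = A /\ (`|D|%N)%:Z = D by rewrite !gez0_abs ?(ltW A0) ?(ltW D0).
split; rewrite ?absz_gt0 ?lt0r_neq0 //; first by rewrite -[RHS]pq; ring.
move=> t t0; rewrite !pmulrn AN DN.
have DR : D%:~R != 0 :> R[i] by rewrite intr_eq0 lt0r_neq0.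
have E1 : p%:~R * ((A%:~R * t + (u * (n%:Z * b) + v * d)%:~R) / D%:~R) + (- v)%:~R =
    n%:R * (a%:~R * t + b%:~R) / D%:~R :> R[i].
  apply: (mulIf DR); rewrite divfK // mulrDl -mulrA divfK //.
  have -> : n%:R * (a%:~R * t + b%:~R) = (n%:Z * a)%:~R * t + (n%:Z * b)%:~R * (p * u + q * v)%:~R :> R[i].
    by rewrite pq mulr1 !rmorphM /= -!pmulrn; ring.
  by rewrite pE /D !(rmorphD, rmorphB, rmorphN, rmorphM) /= -!pmulrn; ring.
have E2 : q%:~R * ((A%:~R * t + (u * (n%:Z * b) + v * d)%:~R) / D%:~R) + u%:~R =
    (c%:~R * t + d%:~R) / D%:~R :> R[i].
  apply: (mulIf DR); rewrite divfK // mulrDl -mulrA divfK //.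
  have -> : c%:~R * t + d%:~R = (q * A)%:~R * t + d%:~R * (p * u + q * v)%:~R :> R[i].
    by rewrite pq mulr1 qE.
  by rewrite /D !(rmorphD, rmorphB, rmorphN, rmorphM) /= -!pmulrn; ring.
have Yn := mob_den_neq0 t0 det.
by rewrite /mob E1 E2; field; rewrite DR Yn.
Qed.

(** * Leading exponents *)

Lemma series_psums (u : nat -> R[i]) : series u = psums u.
Proof. by apply/funext => n; rewrite /series /psums /= big_mkord. Qed.

Lemma qe_expansion f k n : qe k n f -> exists2 c, c 0%N != 0 & q_expansion f (k%:~R / n%:R) n c.
Proof.
move=> [n0 [c [r [y [r0 cr c0 H]]]]]; exists c => //; split=> //; exists y => t yt.
have [xr ->] := H t yt.
have cv := cvgC_csumZ (cex ((k%:~R / n%:R)%:C * t)) (pserP r0 xr cr).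
rewrite (_ : (fun k0 => _) = (fun j => cex ((k%:~R / n%:R)%:C * t) * (c j * cex ((n%:R^-1)%:C * t) ^+ j))).
  by rewrite series_psums; apply/cvgCP.
apply/funext => j; rewrite qpowE -cex_scaleMn rmorphD mulrDl cexD; ring.
Qed.

Lemma expansion_pser f e n c : c 0%N != 0 -> q_expansion f e n c ->
  exists (r y : R), [/\ 0 < r, psbound c r &
    forall t, y < complex.Im t -> nc (cex ((n%:R^-1)%:C * t)) < r /\
      f t = cex (e%:C * t) * pser c (cex ((n%:R^-1)%:C * t))].
Proof.
move=> c0 [n0 [y Hy]].
have E t : (fun j => c j * qpow t (e + j%:R / n%:R)) =
   (fun j => cex (e%:C * t) * (c j * cex ((n%:R^-1)%:C * t) ^+ j)).
  by apply/funext => j; rewrite qpowE -cex_scaleMn rmorphD mulrDl cexD; ring.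
pose t1 : R[i] := 0 +i* (`|y| + 1).
have yt1 : y < complex.Im t1 by rewrite /t1 /=; have := ler_norm y; lra.
pose r := nc (cex ((n%:R^-1)%:C * t1)).
have r0 : 0 < r by rewrite nc_gt0 cex_neq0.
have H1 := Hy _ yt1; rewrite E series_psums in H1; move/cvgCP: H1 => H1.
have cr : psbound c r.
  have H2 := cvgC_csumZ (cex (e%:C * t1))^-1 H1.
  have [K [n1 [K0 HK]]] := cvgC_bounded H2.
  pose v k := (cex (e%:C * t1))^-1 * (cex (e%:C * t1) * (c k * cex ((n%:R^-1)%:C * t1) ^+ k)).
  have vE k : nc (c k) * r ^+ k = nc (v k).
    by rewrite /v mulKf ?cex_neq0 // ncM ncX.
  exists (2 * K + \sum_(k < n1) nc (v k)).
    by rewrite addr_ge0 ?mulr_ge0 ?(ltW K0) // sumr_ge0 // => k _; exact: nc_ge0.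
  move=> k; rewrite vE; have [kn|kn] := ltnP k n1.
    rewrite (bigD1 (Ordinal kn)) //= addrCA lerDl addr_ge0 ?mulr_ge0 ?(ltW K0) //.
    by rewrite sumr_ge0 // => j _; exact: nc_ge0.
  apply: (@le_trans _ _ (2 * K)); last by rewrite lerDl sumr_ge0 // => j _; exact: nc_ge0.
  have -> : v k = psums v k.+1 - psums v k by rewrite /psums big_ord_recr /= addrAC subrr add0r.
  apply: le_trans (ncD _ _) _; rewrite ncN (_ : 2 * K = K + K); last by ring.
  by apply: lerD; apply: HK => //; exact: leqW.
have nV : 0 < n%:R^-1 :> R by rewrite invr_gt0 ltr0n.
have [z z0 Hz] := cex_small nV r0.
exists r, (Num.max y z); split=> // t; rewrite gt_max => /andP[yt /Hz tr]; split=> //.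
have := Hy _ yt; rewrite E series_psums => /cvgCP Hf.
exact: cvgC_unique Hf (cvgC_csumZ _ (pserP r0 tr cr)).
Qed.

(** Dividing f (t + w) = chi f (t) by the leading power of q and letting t tend to i oo
    leaves an identity between chi and exp (2 i pi e w). *)
Lemma leading_eigen f e (w : nat) (chi : R[i]) : leading_exponent f e ->
  (forall t, 0 < complex.Im t -> f (t + w%:R) = chi * f t) -> chi = ph (e * w%:R).
Proof.
move=> [n [c [c0 He]]] H; have n0 := He.1.
have [r [y [r0 cr Hf]]] := expansion_pser c0 He.
pose zeta : R[i] := ph (n%:R^-1 * w%:R).
pose G x := chi * pser c x - ph (e * w%:R) * pser c (zeta * x).
have G0 t : y < complex.Im t -> 0 < complex.Im t -> G (cex ((n%:R^-1)%:C * t)) = 0.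
  move=> yt t0; have [_ E1] := Hf t yt.
  have yt' : y < complex.Im (t + w%:R) by rewrite ImD -(rmorph_nat (real_complex R)) /= addr0.
  have [_ E2] := Hf _ yt'; have := H t t0; rewrite E1 E2.
  have af (a : R) : cex (a%:C * (t + w%:R)) = cex (a%:C * t) * ph (a * w%:R).
    have -> : t + w%:R = (1 : R)%:C * t + (w%:R : R)%:C by rewrite rmorph1 mul1r rmorph_nat.
    by rewrite cex_affine mulr1.
  rewrite !af /G /zeta (mulrC (ph (n%:R^-1 * w%:R))) => E.
  apply: (mulfI (cex_neq0 (e%:C * t))); rewrite mulr0 mulrBr [X in X - _]mulrCA -E.
  by rewrite mulrA subrr.
have nz0 : nc 0 < r by rewrite nc0.
have cG : contC G 0.
  apply: jet2_cont; apply: jet2D.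
    by apply: jet2M; [exact: jet2_cst|exact: pser_jet2 r0 nz0 cr].
  apply: (@jet2_ext _ (fun x => - ph (e * w%:R) * pser c (zeta * x)) _ _ 1) => // [x _|].
    by rewrite mulNr.
  apply: jet2M; first exact: jet2_cst.
  by apply: jet2_scale; rewrite mulr0; exact: pser_jet2 r0 nz0 cr.
have : G 0 = 0.
  apply: contrapT => /eqP; rewrite -nc_gt0 => /cG[d d0 Hd].
  have nV : 0 < n%:R^-1 :> R by rewrite invr_gt0 ltr0n.
  have [z z0 Hz] := cex_small nV d0.
  pose t1 : R[i] := 0 +i* (`|y| + z + 1).
  have yt1 : y < complex.Im t1 by rewrite /t1 /=; have := ler_norm y; lra.
  have zt1 : z < complex.Im t1 by rewrite /t1 /=; have := normr_ge0 y; lra.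
  have := Hd (cex ((n%:R^-1)%:C * t1)); rewrite subr0 => /(_ (Hz _ zt1)).
  by rewrite G0 //; [rewrite sub0r ncN ltxx|lra].
rewrite /G mulr0 (pser0 r0 cr) => /eqP; rewrite -mulrBl mulf_eq0 (negbTE c0) orbF subr_eq0.
by move=> /eqP.
Qed.

Lemma QE_leading f : QE f -> exists e, leading_exponent f e.
Proof.
by move=> [k [n /qe_expansion[c c0 H]]]; exists (k%:~R / n%:R), n, c.
Qed.

Lemma QE_meromorphic f : QE f -> meromorphic_at_infty f.
Proof. by move=> [k [n /qe_expansion[c _ H]]]; exists k, n, c. Qed.
End Expansions.
Section FunctionsF.
Variable R : realType.
Implicit Types (z w h l : R[i]) (u v : nat -> R[i]).
Notation nc := (@ComplexField.Normc.normc R).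
Arguments ComplexField.Normc.normc : simpl never.
(** * The functions F_{m,h} *)

Section OneF.
Variables (S : forall n, {set 'I_n}) (N m h : nat) (F : R[i] -> R[i]).
Hypotheses (N_gt0 : (0 < N)%N) (mD : m \in proper_divisors N) (L_odd : odd (ell N 1)).
Hypotheses (hl : (h < ell N m)%N) (SP : half_units (S (mpp N m))) (FP : is_F S N m h F).
Local Notation l := (ell N m).
Local Notation M := (mpp N m).

Lemma F_cases :
  (M = 2%N /\ exists2 s : R[i], s != 0 & forall t, 0 < complex.Im t -> F t = s * web1 (N%:R * t))
  \/ (M != 2%N /\ forall t, 0 < complex.Im t -> F t = prodF h (S M) t).
Proof.
case: (M =P 2%N) => [M2|/eqP M2]; [left|right]; split=> //.
  exact: is_F_web hl FP M2.
exact: is_F_prod FP M2.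
Qed.

Lemma N_even : M = 2%N -> ~~ odd N.
Proof. by move=> M2; rewrite -dvdn2 -(level_eq N_gt0 mD) M2 dvdn_mull. Qed.

Lemma F_neq0 t : 0 < complex.Im t -> F t != 0.
Proof.
move=> t0; case: F_cases => [[_ [s s0 ->//]]|[_ ->//]]; last exact: prodF_neq0.
by rewrite mulf_neq0 //; apply: web_neq0; [exact: Im_natM|left].
Qed.

Lemma F_jet2 t : 0 < complex.Im t -> jet2 F t.
Proof.
move=> t0; case: F_cases => [[_ [s s0 E]]|[_ E]].
  apply: (@jet2_ext _ (fun t => s * web1 (N%:R * t)) _ t _ t0) => [w wt|].
    by rewrite E //; exact: half_plane_open wt.
  apply: jet2M; first exact: jet2_cst.
  by apply: jet2_scale; apply: web_jet2; [left|exact: Im_natM].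
apply: (@jet2_ext _ (prodF h (S M)) _ t _ t0) => [w wt|].
  by rewrite E //; exact: half_plane_open wt.
exact: prodF_jet2.
Qed.

Lemma mobN_Im (a b c1 d : int) t : a * d - b * (N%:Z * c1) = 1 -> 0 < complex.Im t ->
  0 < complex.Im (mob a b (N%:Z * c1) d t : R[i]).
Proof. by move=> det t0; apply: mob_Im. Qed.

Lemma level_mobN (a b c1 d : int) t : N%:R * mob a b (N%:Z * c1) d t =
  mob a (b * N%:Z) c1 d (N%:R * t) :> R[i].
Proof.
rewrite /mob mulrA mulrDr !rmorphM /= -!pmulrn.
by congr (_ / _); ring.
Qed.

Lemma F_mob (a b c1 d : int) : a * d - b * (N%:Z * c1) = 1 -> exists2 chi : R[i], chi != 0 &
  forall t, 0 < complex.Im t -> F (mob a b (N%:Z * c1) d t) = chi * F t.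
Proof.
move=> det; case: F_cases => [[M2 [s s0 E]]|[M2 E]].
  have nE : N%:Z = (N./2)%:Z * 2 by have := odd_double_half N; rewrite (negbTE (N_even M2)); lia.
  have det2 : a * d - b * (N./2)%:Z * 2 * c1 = 1 by rewrite -[RHS]det nE; ring.
  have [k _ Hk] := web1_mob R det2; exists (ph (k%:~R / 24)); first exact: ph_neq0.
  move=> t t0; rewrite !E ?mobN_Im // level_mobN nE mulrA Hk ?Im_natM //; ring.
have [k [_ _ Hk]] := prodF_mob R h N_gt0 mD SP det.
exists (\prod_(al in S M) ph (kappa R N m h a b c1 d k al)).
  by apply/prodf_neq0 => al _; exact: ph_neq0.
by move=> t t0; rewrite !E ?mobN_Im // Hk.
Qed.

(** The exponent of the multiplier of F_{m,h} on the matrices that are diagonal modulo 24 N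
    with a = 1 mod 8; it is 0 for F = web1 (N t). *)
Definition theta (a d e : int) : R := if M == 2%N then 0 else
  (sumT (S M) a)%:~R / 2 - h%:R / l%:R * (sumX (S M) a d e)%:~R.

Lemma F_diag (a b c1 d e : int) t : a * d - b * (N%:Z * c1) = 1 -> 0 < complex.Im t ->
  ((24 * N)%N%:Z %| b)%Z -> ((24 * N)%N%:Z %| c1)%Z -> (a %% 8 = 1)%Z -> d = 2 * e + 1 ->
  F (mob a b (N%:Z * c1) d t) = ph (theta a d e) * F t.
Proof.
move=> det t0 b24 c24 a8 dE; rewrite /theta; case: F_cases => [[M2 [s s0 E]]|[M2 E]].
  have det' : a * d - b * N%:Z * c1 = 1 by rewrite -[RHS]det; ring.
  have d24 (x : int) : ((24 * N)%N%:Z %| x)%Z -> (24 %| x)%Z by apply: dvdz_trans; exact: dvdn_mulr.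
  have -> : (M == 2%N) = true by rewrite M2.
  rewrite ph0 mul1r !E ?mobN_Im // level_mobN web1_diag //; [exact: N_even|exact: Im_natM|exact: d24|exact: d24].
by rewrite (negbTE M2) !E ?mobN_Im // (prodF_diag h N_gt0 mD SP det (e := e)).
Qed.

(** Each factor becomes, by the Hermite form, a constant times a Siegel product at
    (A t + B) / D.  Its characteristic is the image of (alpha / M, delta h / l) under
    a matrix of SL2(Z); it is not integral since alpha / M is not. *)
Lemma F_QE (a b c d : int) : a * d - b * c = 1 -> QE (fun t => F (mob a b c d t)).
Proof.
move=> det; case: F_cases => [[M2 [s s0 E]]|[M2 E]].
  have [p [r [q [s' [B [A [D [det' A0 D0 H]]]]]]]] := @hermite R N a b c d N_gt0 det.
  have [j [K K0 HK]] := @webf_mob R p r q s' 1 det'.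
  have Q := QE_mul (QE_cst s0) (QE_mul (QE_cst K0) (webf_lin_QE R j B A0 D0)).
  apply: QE_ext Q => t t0; rewrite E ?mob_Im // H //; congr (_ * _).
  by rewrite -HK //; exact: half_plane_lin.
have N'0 := Np_gt0 N_gt0 mD.
have [p [r [q [s' [B [A [D [det' A0 D0 H]]]]]]]] := @hermite R (Np N m) a b c d N'0 det.
have [k [_ _ Hk]] := sieg_mob_ph R det'.
pose x1 (al : nat) : R := al%:R / M%:R; pose x2 (al : nat) : R := (delta M al)%:R * h%:R / l%:R.
have M1 := M_gt1 N_gt0 mD; have l0 := l_gt0 N_gt0 mD.
have Mn : M%:R != 0 :> R by exact: M_neq0.
have ln : l%:R != 0 :> R by exact: l_neq0.
apply: (@QE_ext _ (fun t => \prod_(al <- enum (S M)) (ph (k%:~R / 12 + (x1 al * r%:~R + x2 al * s'%:~R) *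
     (x1 al * p%:~R + x2 al * q%:~R - 1) / 2 - x2 al * (x1 al - 1) / 2) *
     sieg (x1 al * p%:~R + x2 al * q%:~R) (x1 al * r%:~R + x2 al * s'%:~R) ((A%:R * t + B%:~R) / D%:R)))).
  move=> t t0; rewrite E ?mob_Im // /prodF H // big_enum; apply: eq_bigr => al alS.
  by rewrite /siegF Hk //; exact: half_plane_lin.
apply: QE_prod => al; rewrite mem_enum => alS.
apply: QE_mul; first exact: QE_cst (ph_neq0 _).
have co := S_coprime SP alS; have al0 := coprime_pos M1 co; have alM := ltn_ord al.
have -> : x1 al * p%:~R + x2 al * q%:~R =
   ((al * l)%N%:Z * p + (delta M al * h * M)%N%:Z * q)%:~R / (M * l)%:R :> R.
  by rewrite /x1 /x2 natrM !PoszM !(rmorphD, rmorphM) /= -!pmulrn; field; rewrite Mn ln.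
apply: sieg_lin_QE => //; first by rewrite muln_gt0 l0 ltnW.
move=> [y1 [y2 [E1 E2]]].
have {}E1 : x1 al * p%:~R + x2 al * q%:~R = y1%:~R.
  rewrite -E1 natrM /x1 /x2 !PoszM !(rmorphD, rmorphM) /= -!pmulrn; field; by rewrite Mn ln.
have dR : p%:~R * s'%:~R - r%:~R * q%:~R = 1 :> R.
  by rewrite -!rmorphM -rmorphB det'.
have xE : x1 al = (y1 * s' - y2 * q)%:~R.
  transitivity (x1 al * (p%:~R * s'%:~R - r%:~R * q%:~R)); first by rewrite dR mulr1.
  rewrite rmorphB !rmorphM /= -E1 -E2; move: (x1 al) (x2 al) => u v; ring.
have : al%:Z = (y1 * s' - y2 * q) * M%:Z.
  by apply/eqP; rewrite -(eqr_int R) rmorphM /= -xE /x1 -!pmulrn divfK.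
move=> E3; have : (M%:Z %| al%:Z)%Z by rewrite E3 dvdz_mull.
by rewrite dvdzE /= => /dvdn_leq -/(_ al0); rewrite leqNgt alM.
Qed.
End OneF.
End FunctionsF.
Section GammaInvariance.
Variable R : realType.
Implicit Types (z w h l : R[i]) (u v : nat -> R[i]).
Notation nc := (@ComplexField.Normc.normc R).
Arguments ComplexField.Normc.normc : simpl never.
(** * Products of the F_{m,h} *)

Lemma mob_shift (a b c d : int) (w : int) t :
  mob a b c d (t + w%:~R) = mob a (a * w + b) c (c * w + d) t :> R[i].
Proof. by rewrite /mob !(rmorphD, rmorphM) /=; congr (_ / _); ring. Qed.

Definition mx2 (a b c d : int) : 'M[int]_2 :=
  \matrix_(i, j) (if i == 0 then if j == 0 then a else b else if j == 0 then c else d).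

Lemma det_mx2 (g : 'M[int]_2) : \det g = g 0 0 * g 1 1 - g 0 1 * g 1 0.
Proof.
rewrite (expand_det_row _ 0) !big_ord_recl big_ord0 /cofactor !det_mx11 !mxE /=.
rewrite addr0 expr0 mul1r expr1.
have -> : lift 0 0 = 1 :> 'I_2 by apply/val_inj.
have -> : lift (1 : 'I_2) 0 = 0 :> 'I_2 by apply/val_inj.
by rewrite mulN1r mulrN.
Qed.

Lemma mobiusE (g : 'M[int]_2) t : mobius g t = mob (g 0 0) (g 0 1) (g 1 0) (g 1 1) t :> R[i].
Proof. by []. Qed.

Section Units.
Variables (N : nat) (g : R[i] -> R[i]).
Hypotheses (N_gt0 : (0 < N)%N) (N4 : ~~ (4 %| N)%N).
Hypothesis gQE : forall a b c d : int, a * d - b * c = 1 -> QE (fun t => g (mob a b c d t)).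
Hypothesis g_neq0 : forall t, 0 < complex.Im t -> g t != 0.
Hypothesis gmob : forall a b c1 d : int, a * d - b * (N%:Z * c1) = 1 ->
  exists2 chi : R[i], chi != 0 & forall t, 0 < complex.Im t -> g (mob a b (N%:Z * c1) d t) = chi * g t.

Definition inv (a b c1 d : int) : Prop := forall t, 0 < complex.Im t -> g (mob a b (N%:Z * c1) d t) = g t.

(** The stabilizer of the cusp 1 / c in Gamma_0(N) is generated, up to sign, by
    (1 - c w, w; - c ^ 2 w, 1 + c w), where w is the width.  It is conjugate to the
    translation by w, so it multiplies g by exp (2 i pi e w), where e is the leading
    exponent and e w the order: the order is integral exactly when
    this is 1. *)
Lemma integral_cusp c : (0 < c)%N ->
  let w := (N %/ gcdn (c ^ 2) N)%N in let v := (c ^ 2 %/ gcdn (c ^ 2) N)%N in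
  (integral_cusp_order N g 1 c <-> inv (1 - (c * w)%N%:Z) w%:Z (- v%:Z) (1 + (c * w)%N%:Z)) /\
  (1 - (c * w)%N%:Z) * (1 + (c * w)%N%:Z) - w%:Z * (N%:Z * - v%:Z) = 1.
Proof.
move=> c0 w v.
have wv : (N * v = c ^ 2 * w)%N.
  by rewrite /v /w !muln_divA ?dvdn_gcdl ?dvdn_gcdr // mulnC.
have wvZ : N%:Z * - v%:Z = - (c%:Z ^+ 2 * w%:Z).
  by rewrite mulrN -PoszM wv PoszM.
have detX : (1 - (c * w)%N%:Z) * (1 + (c * w)%N%:Z) - w%:Z * (N%:Z * - v%:Z) = 1.
  by rewrite wvZ !PoszM; ring.
split; last exact: detX.
have [chi chi0 Hchi] := gmob detX.
have key (a b d : int) t : 0 < complex.Im t -> a * d - b * (a * c%:Z) = 1 ->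
    g (mob a b (a * c%:Z) d (t + w%:R)) = chi * g (mob a b (a * c%:Z) d t).
  move=> t0 det; rewrite -Hchi ?mob_Im // mob_comp // -[w%:R]pmulrn -/(w%:Z%:~R) mob_shift wvZ.
  have a1 : a * (d - b * c%:Z) = 1 by rewrite -[RHS]det; ring.
  have da : d - b * c%:Z = a by case: (int_mul_eq1 a1) => [[-> ->]|[-> ->]].
  congr g; rewrite !PoszM.
  have E1 : (1 - c%:Z * w%:Z) * a + w%:Z * (a * c%:Z) = a by ring.
  have E2 : (1 - c%:Z * w%:Z) * b + w%:Z * d = a * w%:Z + b by rewrite -[in RHS]da; ring.
  have E3 : - (c%:Z ^+ 2 * w%:Z) * a + (1 + c%:Z * w%:Z) * (a * c%:Z) = a * c%:Z by ring.
  have E4 : - (c%:Z ^+ 2 * w%:Z) * b + (1 + c%:Z * w%:Z) * d = a * c%:Z * w%:Z + d.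
    by rewrite -[in RHS]da; ring.
  by rewrite E1 E2 E3 E4.
split.
  move=> [k [gam [e [dg cE lead kE]]]] t t0.
  rewrite Hchi //; suff -> : chi = 1 by rewrite mul1r.
  have det := dg; rewrite /SL2Z det_mx2 in det.
  rewrite mul1r in cE.
  rewrite -(ph_int R k) kE; apply: (leading_eigen lead) => s s0.
  by rewrite !mobiusE -cE key // cE.
move=> H.
have chi1 : chi = 1.
  have i0 := i_gt0 R; have := H 'i i0; rewrite Hchi // => E.
  by apply: (mulIf (g_neq0 i0)); rewrite mul1r.
have detV : 1 * 1 - 0 * (1 * c%:Z) = 1 :> int by rewrite mul0r subr0.
have [e lead] := QE_leading (gQE detV).
have E : 1 = ph (e * w%:R) :> R[i].
  rewrite -chi1; apply: (leading_eigen lead) => t t0; exact: key.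
have [k kE] := ph_eq1 (esym E).
exists k, (mx2 1 0 c%:Z 1), e; split.
- by rewrite /SL2Z det_mx2 !mxE /= !mul1r mul0r subr0.
- by rewrite !mxE /= !mul1r.
- suff -> : (fun t => g (mobius (mx2 1 0 c%:Z 1) t)) = (fun t => g (mob 1 0 (1 * c%:Z) 1 t)).
    exact: lead.
  by apply/funext => t; rewrite mobiusE !mxE /= mul1r.
exact/esym.
Qed.

(** With T = (1 1; 0 1) and U = (1 0; N 1), the generators attached to the representatives
    1 / N and 1 / 1 of the cusps infinity and 0 are U T U^-1 and T U^-1 T^-1. *)
Lemma cusps_generators :
  inv (1 - N%:Z) 1 (- N%:Z) (1 + N%:Z) -> inv (1 - N%:Z) N%:Z (- 1) (1 + N%:Z) ->
  (forall t, 0 < complex.Im t -> g (t + 1) = g t) /\ inv 1 0 1 1.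
Proof.
move=> HN H1; have detU : 1 * 1 - 0 * (N%:Z * 1) = 1 :> int by rewrite mul0r subr0.
have [chi chi0 Hchi] := gmob detU.
have gT t : 0 < complex.Im t -> g (t + 1) = g t.
  move=> t0; have t10 : 0 < complex.Im (t + 1) by rewrite ImD /= addr0.
  apply: (mulfI chi0); rewrite -!Hchi // -[RHS]HN ?mob_Im // mob_comp //.
  rewrite -[t + 1]/(t + 1%:~R) mob_shift.
  have -> : (1 - N%:Z) * 1 + 1 * (N%:Z * 1) = 1 :> int by ring.
  have -> : (1 - N%:Z) * 0 + 1 * 1 = 1 * 1 + 0 :> int by ring.
  have -> : N%:Z * - N%:Z * 1 + (1 + N%:Z) * (N%:Z * 1) = N%:Z * 1 :> int by ring.
  by have -> : N%:Z * - N%:Z * 0 + (1 + N%:Z) * 1 = N%:Z * 1 * 1 + 1 :> int by ring.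
split=> // t t0; have Ut := mob_Im t0 detU.
have UT : mob 1 0 (N%:Z * 1) 1 t + 1 = mob (1 + N%:Z) 1 N%:Z 1 t.
  have -> : 1 + N%:Z = 1 + N%:Z * 1 by rewrite mulr1.
  by rewrite -mob_T // add0r mulr1.
rewrite -gT // UT -H1; last by apply: mob_Im => //; ring.
rewrite mob_comp //; last by ring.
have -> : (1 - N%:Z) * (1 + N%:Z) + N%:Z * N%:Z = 1 :> int by ring.
have -> : (1 - N%:Z) * 1 + N%:Z * 1 = 1 :> int by ring.
have -> : N%:Z * - 1 * (1 + N%:Z) + (1 + N%:Z) * N%:Z = 0 :> int by ring.
have -> : N%:Z * - 1 * 1 + (1 + N%:Z) * 1 = 1 :> int by ring.
by rewrite -[in RHS]gT //; congr g; rewrite /mob mul1r mul0r add0r divr1.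
Qed.

Section Reduction.
Hypothesis gT : forall t, 0 < complex.Im t -> g (t + 1) = g t.
Hypothesis gU : inv 1 0 1 1.

Lemma g_shift t (k : int) : 0 < complex.Im t -> g (t + k%:~R) = g t.
Proof.
have Im_int (s : R[i]) (j : int) : complex.Im (s + j%:~R) = complex.Im s.
  by rewrite ImD -(rmorph_int (real_complex R)) /= addr0.
have P (n : nat) s : 0 < complex.Im s -> g (s + n%:~R) = g s.
  move=> s0; elim: n => [|n IH]; first by rewrite addr0.
  by rewrite -addn1 PoszD rmorphD /= addrA gT ?Im_int.
move=> t0; case: k => n; first exact: P.
by rewrite NegzE rmorphN -[in RHS](subrK n.+1%:~R t) P // -rmorphN Im_int.
Qed.

Lemma g_U t (k : int) : 0 < complex.Im t -> g (mob 1 0 (N%:Z * k) 1 t) = g t.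
Proof.
have detU (j : int) : 1 * 1 - 0 * (N%:Z * j) = 1 :> int by rewrite mul0r subr0.
have UU (i j : int) s : 0 < complex.Im s ->
    mob 1 0 (N%:Z * i) 1 (mob 1 0 (N%:Z * j) 1 s) = mob 1 0 (N%:Z * (i + j)) 1 s :> R[i].
  by move=> s0; rewrite mob_comp // !mulr0 !mul0r !mulr1 !mul1r !addr0 add0r mulrDr.
have P (n : nat) s : 0 < complex.Im s -> g (mob 1 0 (N%:Z * n) 1 s) = g s.
  move=> s0; elim: n => [|n IH]; first by rewrite mulr0 mob_1.
  by rewrite -add1n PoszD -UU // gU ?mob_Im.
move=> t0; case: k => n; first exact: P.
rewrite NegzE -(P n.+1) ?mob_Im // UU //.
by rewrite subrr mulr0 mob_1.
Qed.

(** As g is invariant under T and U, invariance under a matrix may be checked after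
    multiplying it by T ^ k on the right; likewise below for U ^ k on either side. *)
Lemma inv_Tr (a b c1 d k : int) : a * d - b * (N%:Z * c1) = 1 ->
  inv a (a * k + b) c1 (N%:Z * c1 * k + d) -> inv a b c1 d.
Proof.
move=> det H t t0; have t0' : 0 < complex.Im (t - k%:~R).
  by rewrite ImD ImN -(rmorph_int (real_complex R)) /= subr0.
by rewrite -{1}(subrK k%:~R t) mob_shift H // -(g_shift k) // subrK.
Qed.

Lemma inv_Ur (a b c1 d k : int) :
  inv (a + b * N%:Z * k) b (c1 + d * k) d -> inv a b c1 d.
Proof.
move=> H t t0; have detU (j : int) : 1 * 1 - 0 * (N%:Z * j) = 1 :> int by rewrite mul0r subr0.
pose s := mob 1 0 (N%:Z * - k) 1 t; have s0 : 0 < complex.Im s by apply: mob_Im.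
have ts : t = mob 1 0 (N%:Z * k) 1 s.
  rewrite /s mob_comp // !mulr0 !mul0r !mulr1 !mul1r !addr0 add0r mulrN subrr.
  by rewrite mob_1.
rewrite {1}ts mob_comp //.
have -> : a * 1 + b * (N%:Z * k) = a + b * N%:Z * k by ring.
have -> : a * 0 + b * 1 = b by ring.
have -> : N%:Z * c1 * 1 + d * (N%:Z * k) = N%:Z * (c1 + d * k) by ring.
have -> : N%:Z * c1 * 0 + d * 1 = d by ring.
by rewrite H // ts g_U.
Qed.

Lemma inv_Ul (a b c1 d k : int) : a * d - b * (N%:Z * c1) = 1 ->
  inv a b (c1 + k * a) (d + N%:Z * k * b) -> inv a b c1 d.
Proof.
move=> det H t t0; rewrite -[LHS](g_U k) ?mob_Im // mob_comp // -[RHS]H //; congr g.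
by congr mob; ring.
Qed.

(** Multiplications by T and U bring every matrix of Gamma_0(N) to one that is diagonal
    modulo 24 N.  If b is odd, or made odd by T, right multiplication by U ^ k adds
    b N k to a, and reaches a = 1 mod 8 because b N is not divisible by 4; k may
    moreover be chosen with a prime to 24 N.  As a is then invertible modulo 24 N,
    the entries b and c1 can be cleared by T and U. *)
Lemma inv_all : (forall a b c1 d : int, a * d - b * (N%:Z * c1) = 1 ->
    ((24 * N)%N%:Z %| b)%Z -> ((24 * N)%N%:Z %| c1)%Z -> (a %% 8 = 1)%Z ->
    coprimez a (24 * N)%N%:Z -> inv a b c1 d) ->
  forall a b c1 d : int, a * d - b * (N%:Z * c1) = 1 -> inv a b c1 d.
Proof.
move=> Hd.
have K0 : (0 < 24 * N)%N by rewrite muln_gt0.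
(* A left multiplication by a power of U clears c1. *)
have H3 (a b c1 d : int) : a * d - b * (N%:Z * c1) = 1 -> ((24 * N)%N%:Z %| b)%Z ->
    (a %% 8 = 1)%Z -> coprimez a (24 * N)%N%:Z -> inv a b c1 d.
  move=> det b24 a8 co.
  have [[u v] uv] := coprimezP _ _ co.
  rewrite /= in uv.
  apply: (@inv_Ul _ _ _ _ (- c1 * u)) => //; apply: Hd => //; first by rewrite -[RHS]det; ring.
  apply/dvdzP; exists (c1 * v); rewrite -[X in X + _]mulr1 -uv; ring.
(* A right multiplication by a power of T clears b. *)
have H2 (a b c1 d : int) : a * d - b * (N%:Z * c1) = 1 ->
    (a %% 8 = 1)%Z -> coprimez a (24 * N)%N%:Z -> inv a b c1 d.
  move=> det a8 co; have [[u v] uv] := coprimezP _ _ co.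
  rewrite /= in uv.
  apply: (@inv_Tr _ _ _ _ (- b * u)) => //; apply: H3 => //; first by rewrite -[RHS]det; ring.
  apply/dvdzP; exists (b * v); rewrite -[X in _ + X]mulr1 -uv; ring.
have H1 (a b c1 d : int) : a * d - b * (N%:Z * c1) = 1 -> (b %% 2 = 1)%Z -> inv a b c1 d.
  move=> det b2.
  have Nm : (N %% 4 != 0)%N by [].
  have bN4 : (b * N%:Z %% 4 != 0)%Z.
    have Gd : ((4 %| b * N%:Z) = (4 %| N%:Z))%Z.
      apply: Gauss_dvdzr; rewrite /coprimez /gcdz eqz_nat -/(coprime _ _).
      by rewrite (_ : `|4|%N = 2 ^ 2)%N // coprimeXl // coprime2n; move: b2; lia.
    by move: Gd N4; rewrite /dvdn; lia.
  have od : ((a %% 2)%Z != 0) || ((b * N%:Z %% 2)%Z != 0).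
    rewrite -negb_and; apply/negP => /andP[/eqP a2 /eqP bN2].
    have aE := divz_eq a 2; have bE := divz_eq (b * N%:Z) 2.
    rewrite a2 in aE; rewrite bN2 in bE.
    have : a * d - b * N%:Z * c1 = 1 by rewrite -[RHS]det; ring.
    rewrite aE bE; move: (a %/ 2)%Z (b * N%:Z %/ 2)%Z => x y; move: d c1 {det} => z w; nia.
  have [j0 j0P] := mod8_lift bN4 od.
  set a' := a + b * N%:Z * j0%:Z in j0P.
  have co : coprimez a' (8 * (b * N%:Z)).
    rewrite coprimezMr; apply/andP; split.
      rewrite coprimez_sym /coprimez /gcdz eqz_nat -/(coprime _ _).
      by rewrite (_ : `|8|%N = 2 ^ 3)%N // coprimeXl // coprime2n; move: j0P; lia.
    apply/coprimezP; exists (d, - c1 - d * j0%:Z) => /=.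
    by rewrite -[RHS]det /a'; ring.
  have [j jP] := coprime_lift K0 co.
  apply: (@inv_Ur _ _ _ _ (j0%:Z + 8 * j%:Z)).
  have aE : a + b * N%:Z * (j0%:Z + 8 * j%:Z) = a' + 8 * (b * N%:Z) * j%:Z by rewrite /a'; ring.
  apply: H2; rewrite aE //; first by rewrite -[RHS]det /a'; ring.
  by rewrite -mulrA addrC mulrC modzMDl.
move=> a b c1 d det; case: (eqVneq (b %% 2)%Z 1) => [|b2]; first exact: H1.
have b0 : (b %% 2)%Z = 0 by move: b2; lia.
have a1 : (a %% 2)%Z = 1.
  have bE := divz_eq b 2; rewrite b0 in bE; have aE := divz_eq a 2.
  have [//|a0] : (a %% 2)%Z = 1 \/ (a %% 2)%Z = 0 by lia.
  rewrite a0 in aE; move: det; rewrite aE bE.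
  move: (a %/ 2)%Z (b %/ 2)%Z => x y E.
  have : 2 * (x * d - y * (N%:Z * c1)) = 1 by rewrite -[RHS]E; ring.
  by lia.
apply: (@inv_Tr _ _ _ _ 1) => //; apply: H1; first by rewrite -[RHS]det; ring.
lia.
Qed.
End Reduction.
End Units.
End GammaInvariance.
Section TotalMultiplier.
Variable R : realType.
Implicit Types (z w h l : R[i]) (u v : nat -> R[i]).
Notation nc := (@ComplexField.Normc.normc R).
Arguments ComplexField.Normc.normc : simpl never.
(** * The multiplier of the product *)

Lemma phMz (k : int) (r : R) : ph (k%:~R * r) = ph r ^ k.
Proof.
case: k => n; first exact: phMn.
by rewrite NegzE rmorphN mulNr phN phMn.
Qed.

Section Arithmetic.
Variables (S : forall n, {set 'I_n}) (N : nat) (a : nat -> nat -> int).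
Hypotheses (N_gt0 : (0 < N)%N) (L_odd : odd (ell N 1)).
Hypothesis S_half : forall m, m \in proper_divisors N -> half_units (S (mpp N m)).
Local Notation L := (ell N 1).
Local Notation pd := (proper_divisors N).

(** The multiplier of g on diagonal matrices depends on the exponents a(m, h) through
    these sums: Ttot / 2 - Ytot / L is its argument in turns. *)
Definition Asum m : int := \sum_(0 <= h < ell N m) a m h.
Definition Hsum m : int := \sum_(1 <= h < ell N m) h%:Z * a m h.
Definition Tm m (al : int) : int := if mpp N m == 2%N then 0 else sumT (S (mpp N m)) al.
Definition Ttot al : int := \sum_(m <- pd) Tm m al * Asum m.
Definition Ytot al d e : int := \sum_(m <- pd | (1 < ell N m)%N)
  sumX (S (mpp N m)) al d e * (L %/ ell N m)%N%:Z * Hsum m.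

Lemma L_gt0 : (0 < L)%N. Proof. exact: ell_gt0 N_gt0 (dvd1n N). Qed.

Lemma theta_total (al d e : int) :
  \sum_(m <- pd) \sum_(0 <= h < ell N m) (a m h)%:~R * theta R S N m h al d e =
  (Ttot al)%:~R / 2 - (Ytot al d e)%:~R / L%:R.
Proof.
have LR : L%:R != 0 :> R by rewrite pnatr_eq0 -lt0n L_gt0.
rewrite /Ttot /Ytot [in X in _ - X]big_mkcond /= !rmorph_sum /= !mulr_suml -sumrB.
apply: eq_big_seq => m mD; rewrite /theta /Tm.
have l0 := l_gt0 N_gt0 mD; have lR : (ell N m)%:R != 0 :> R by rewrite pnatr_eq0 -lt0n.
have Llr : L%:R = (L %/ ell N m)%:R * (ell N m)%:R :> R.
  by rewrite -natrM divnK // l_dvd_L.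
case: eqP => [M2|_].
  rewrite (level2 N_gt0 mD L_odd M2) ltnn mul0r !mul0r subr0.
  by rewrite big1 // => h _; rewrite mulr0.
set T := sumT _ _; set X := sumX _ _ _ _.
rewrite (eq_bigr (fun h : nat => T%:~R / 2 * (a m h)%:~R -
   X%:~R / (ell N m)%:R * (h%:Z * a m h)%:~R)); last first.
  by move=> h _; rewrite rmorphM /= -pmulrn; ring.
rewrite sumrB -!mulr_sumr -!rmorph_sum /=.
congr (_ - _); first by rewrite rmorphM /=; ring.
have -> : \sum_(0 <= h < ell N m) h%:Z * a m h = Hsum m.
  by rewrite big_ltn // mul0r add0r.
case: ltnP => [l1|l1].
  have qR : (L %/ ell N m)%:R != 0 :> R by move: LR; rewrite Llr mulf_eq0 negb_or => /andP[].
  by rewrite !rmorphM /= -pmulrn Llr; field; rewrite qR lR.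
by rewrite /Hsum big_geq // mulr0 mul0r.
Qed.

(** L is odd, so the two fractions cannot cancel. *)
Lemma theta_trivial (al d e : int) :
  ph ((Ttot al)%:~R / 2 - (Ytot al d e)%:~R / L%:R) = 1 :> R[i] <->
  (2 %| Ttot al)%Z /\ (L%:Z %| Ytot al d e)%Z.
Proof.
have LR : L%:R != 0 :> R by rewrite pnatr_eq0 -lt0n L_gt0.
have co : coprimez L%:Z 2.
  by rewrite coprimez_sym /coprimez /gcdz eqz_nat -/(coprime _ _) coprime2n.
split=> [/ph_eq1[k kE]|[/dvdzP[u ->] /dvdzP[v ->]]].
  have E : L%:Z * Ttot al - 2 * Ytot al d e = 2 * L%:Z * k.
    apply/eqP; rewrite -(eqr_int R) rmorphB !rmorphM /= -kE -pmulrn; apply/eqP.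
    by field.
  split.
    rewrite -(@Gauss_dvdzr _ L%:Z) 1?coprimez_sym //.
    by apply/dvdzP; exists (L%:Z * k + Ytot al d e); rewrite -[LHS](subrK (2 * Ytot al d e)) E; ring.
  rewrite -(Gauss_dvdzr _ co).
  by apply/dvdzP; exists (Ttot al - 2 * k); transitivity (L%:Z * Ttot al - (L%:Z * Ttot al - 2 * Ytot al d e)); [|rewrite E]; ring.
rewrite -(ph_int R (u - v)); congr ph; rewrite rmorphB !rmorphM /= -pmulrn.
by field.
Qed.

(** Twice Ytot is d times the sum of the condition modulo L, by half_sum_psi term by term;
    2 and d are invertible modulo L. *)
Lemma Ytot_psi (al d e k : int) (i : nat) : coprimez al N%:Z -> (N%:Z %| al * d - 1)%Z ->
  d = 2 * e + 1 -> al = i%:Z + N%:Z * k ->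
  (L%:Z %| Ytot al d e)%Z = (L%:Z %| \sum_(m <- pd | (1 < ell N m)%N) (psi N i m)%:Z * Hsum m)%Z.
Proof.
move=> coN dN dE alE; set Psi := \sum_(m <- pd | _) _.
have co : coprimez L%:Z 2.
  by rewrite coprimez_sym /coprimez /gcdz eqz_nat -/(coprime _ _) coprime2n.
have LN : (L %| N)%N.
  by have := ell_sqr N_gt0 (dvd1n N); rewrite divn1; apply: dvdn_trans; rewrite expnS dvdn_mulr.
have cod : coprimez L%:Z d.
  have /dvdzP[u uE] : (L%:Z %| al * d - 1)%Z by apply: dvdz_trans dN.
  by apply/coprimezP; exists (- u, al) => /=; rewrite -[RHS](subrK (al * d) 1) -opprB uE; ring.
rewrite -(Gauss_dvdzr _ co) -[RHS](Gauss_dvdzr _ cod).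
have D : (L%:Z %| 2 * Ytot al d e - d * Psi)%Z.
  rewrite /Ytot /Psi !mulr_sumr -sumrB big_seq_cond; apply: rpred_sum => m /andP[mD l1].
  have lL := l_dvd_L N_gt0 mD; have lM := l_dvd_M N_gt0 mD.
  have MN : (mpp N m %| N)%N by rewrite -[X in (_ %| X)%N](level_eq N_gt0 mD) dvdn_mull.
  have M2 : (2 < mpp N m)%N.
    have := M_gt1 N_gt0 mD; rewrite leq_eqVlt => /orP[/eqP E|//].
    by move: l1; rewrite (level2 N_gt0 mD L_odd (esym E)).
  have aM : coprimez al (mpp N m)%:Z.
    by move: coN; rewrite -[X in coprimez _ X%:Z](level_eq N_gt0 mD) PoszM coprimezMr => /andP[].
  have dM : ((mpp N m)%:Z %| al * d - 1)%Z by apply: dvdz_trans dN.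
  have alE' : al = i%:Z + (m * ell N m * mpp N m)%N%:Z * k by rewrite (level_eq N_gt0 mD).
  have /dvdzP[q qE] := half_sum_psi M2 (S_half mD) aM lM dM dE alE'.
  have psiE : (psi N i m)%:Z = (\sum_(1 <= be < (mpp N m).+1 | coprime be (mpp N m))
      (delta (mpp N m) be * (be * i %/ mpp N m))%N%:Z) * (L %/ ell N m)%N%:Z.
    rewrite /psi (big_morph Posz PoszD erefl) mulr_suml; apply: eq_bigr => be _.
    by rewrite -PoszM.
  rewrite psiE /sumX; apply/dvdzP; exists (q * Hsum m).
  transitivity (q * (ell N m)%:Z * (L %/ ell N m)%N%:Z * Hsum m); first by rewrite -qE; ring.
  have -> : L%:Z = (L %/ ell N m)%N%:Z * (ell N m)%:Z by rewrite -PoszM divnK.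
  rewrite -[in LHS](mulnK (L %/ ell N m) (l_gt0 N_gt0 mD)) divnK //; ring.
apply/idP/idP => H.
  by rewrite -[_ * _](subKr (2 * Ytot al d e)) rpredB.
by rewrite -[_ * _](subrK (d * Psi)) rpredD.
Qed.

(** The sum on the right has at most one term, for the prime of which M is a power.  When M
    is even it is empty, and Tm is even since M = 2 mod 4. *)
Lemma parity_Tm m (al : int) : m \in pd -> coprimez al N%:Z -> (al %% 8 = 1)%Z ->
  (2 %| Tm m al - \sum_(p <- primes N | odd p && p.-nat (mpp N m)) (~~ qres p al)%:Z)%Z.
Proof.
move=> mD coN a8; rewrite /Tm.
have MN : (mpp N m %| N)%N by rewrite -[X in (_ %| X)%N](level_eq N_gt0 mD) dvdn_mull.
have M1 := M_gt1 N_gt0 mD; have M0 : (0 < mpp N m)%N := ltnW M1.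
have aM : coprimez al (mpp N m)%:Z.
  by move: coN; rewrite -[X in coprimez _ X%:Z](level_eq N_gt0 mD) PoszM coprimezMr => /andP[].
have [Mo|Me] := boolP (odd (mpp N m)); last first.
  rewrite [X in _ - X]big_hasC; last first.
    apply/hasPn => p; rewrite mem_primes => /and3P[pp _ _]; apply/negP => /andP[po pM].
    have : (2 \in (p : nat_pred)) by apply: (pnatPpi pM); rewrite mem_primes M0 dvdn2 Me.
    by rewrite inE => /eqP p2; move: po; rewrite -p2.
  rewrite subr0; case: eqP => // /eqP M2.
  apply: (quo_even M1 (S_half mD) aM); last by move: a8; lia.
  have M4 : ~~ (4 %| mpp N m)%N.
    by apply/negP => /dvdn_trans/(_ MN); rewrite (negbTE (not4 N_gt0 L_odd)).
  by move: M4 Me; rewrite /dvdn; lia.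
have Mn2 : (mpp N m == 2%N) = false by apply/eqP => M2; move: Mo; rewrite M2.
have M2 : (2 < mpp N m)%N by move: Mn2 M1; case: (mpp N m) => [|[|[|]]].
rewrite Mn2; set p0 := pdiv (mpp N m).
have pp := pdiv_prime M1; have pM := pdiv_dvd (mpp N m); rewrite -/p0 in pp pM.
have po : odd p0 by apply: dvdn_odd pM Mo.
have a2 : (al %% 2 = 1)%Z by move: a8; lia.
have Q := quo_odd M1 (S_half mD) aM M2 pp Mo pM a2.
have only p : p \in primes N -> odd p && p.-nat (mpp N m) = (p == p0) && p0.-nat (mpp N m).
  rewrite mem_primes => /and3P[ppr _ _]; apply/andP/andP => [[_ pn]|[/eqP -> ->//]].
  have : p0 \in (p : nat_pred) by apply: (pnatPpi pn); rewrite mem_primes pp M0 pM.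
  by rewrite inE => /eqP ->.
rewrite [X in _ - X]big_seq_cond [X in _ - X](eq_bigl (fun p => (p \in primes N) && ((p == p0) && p0.-nat (mpp N m)))); last first.
  by move=> p; case: (boolP (p \in primes N)) => // /only ->.
rewrite -big_seq_cond; case: (boolP (p0.-nat (mpp N m))) => pn; last first.
  rewrite big1 ?subr0; last by move=> p; rewrite andbF.
  by rewrite Q (negbTE pn).
rewrite (eq_bigl (pred1 p0)); last by move=> p; rewrite andbT.
rewrite -big_filter filter_pred1_uniq ?primes_uniq ?big_seq1 //; last by rewrite mem_primes pp N_gt0 (dvdn_trans pM MN).
move: Q; rewrite pn /=; case: (qres p0 al) => /= Q; first by rewrite subr0 Q.
have {}Q : (2 %| sumT (S (mpp N m)) al)%Z = false := Q.
by move: (sumT _ _) Q => x; lia.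
Qed.

Lemma parity_Ttot (al : int) : coprimez al N%:Z -> (al %% 8 = 1)%Z ->
  (2 %| Ttot al - \sum_(p <- primes N | odd p) (~~ qres p al)%:Z *
      \sum_(m <- pd | p.-nat (mpp N m)) Asum m)%Z.
Proof.
move=> coN a8.
have -> : \sum_(p <- primes N | odd p) (~~ qres p al)%:Z * \sum_(m <- pd | p.-nat (mpp N m)) Asum m =
    \sum_(m <- pd) (\sum_(p <- primes N | odd p && p.-nat (mpp N m)) (~~ qres p al)%:Z) * Asum m.
  under eq_bigr => p _ do rewrite mulr_sumr big_mkcond /=.
  rewrite exchange_big /=; apply: eq_bigr => m _; rewrite mulr_suml.
  by rewrite big_mkcondr.
rewrite /Ttot -sumrB big_seq; apply: rpred_sum => m mD; rewrite -mulrBl.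
by rewrite dvdz_mulr // parity_Tm.
Qed.
End Arithmetic.

(** Take b = 24 N; a Bezout relation between a and the product of N and (24 N) ^ 2 provides d
    and c1. *)
Lemma diag_ex (N : nat) (a : int) : coprimez a (24 * N)%N%:Z -> (a %% 8 = 1)%Z ->
  exists b c1 d e : int, [/\ a * d - b * (N%:Z * c1) = 1, ((24 * N)%N%:Z %| b)%Z,
    ((24 * N)%N%:Z %| c1)%Z & d = 2 * e + 1].
Proof.
move=> co a8; set K := (24 * N)%N%:Z in co *.
have coN : coprimez a N%:Z by move: co; rewrite /K PoszM coprimezMr => /andP[].
have [[u v] /= uv] : exists uv : int * int, uv.1 * a + uv.2 * (K * (N%:Z * K)) = 1.
  have : coprimez a (K * (N%:Z * K)) by rewrite !coprimezMr co coN.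
  by case/coprimezP => uv; exists uv.
exists K, (- K * v), u, ((u - 1) %/ 2)%Z; split=> //.
- by rewrite -uv; ring.
- by rewrite mulNr rpredN dvdz_mulr.
have KE : K = 2 * (12 * N)%N%:Z by rewrite /K; lia.
have aE := divz_eq a 8; rewrite a8 in aE.
have : (u %% 2 = 1)%Z.
  have : u * a + 2 * (v * ((12 * N)%N%:Z * (N%:Z * K))) = 1 by rewrite -[RHS]uv [in RHS]KE -KE; ring.
  by rewrite aE; move: (_ * (_ * _)) (a %/ 8)%Z => x y; lia.
by lia.
Qed.

Lemma qres_mod p (b i : nat) : prime p -> (b = i %[mod p])%N -> qres p b%:Z = qres p i%:Z.
Proof.
move=> pp E; rewrite /qres; congr (_ ^+ _ == _); rewrite -!pmulrn.
by rewrite (divn_eq b p) (divn_eq i p) E !natrD !natrM Fp_p // !mulr0.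
Qed.

Lemma qres1 p : qres p 1. Proof. by rewrite /qres expr1n. Qed.

(** The odd part of N is treated by the Chinese remainder theorem; as 4 does not divide N,
    the condition at 2 says at most that i is odd. *)
Lemma class_lift (N i : nat) : (0 < N)%N -> ~~ (4 %| N)%N -> coprime i N ->
  exists b k : int, [/\ b = i%:Z + N%:Z * k, (b %% 8 = 1)%Z & coprimez b (24 * N)%N%:Z].
Proof.
move=> N0 N4 co; set n := (N`_(2^'))%N.
have nN : (n %| N)%N by exact: dvdn_part.
have no : odd n.
  by rewrite odd_2'nat part_pnat.
have coi : coprime i n by exact: coprime_dvdr nN co.
have Q0 : (0 < 24 * N)%N by rewrite muln_gt0.
have [b [bn b8 bQ _]] := crt_ex no coi Q0 (dvdn_mull 24 nN) (dvdn_mulr N (isT : 8 %| 24)%N).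
have NE : (N`_2 * n)%N = N by exact: partnC.
have dn : (n%:Z %| b%:Z - i%:Z)%Z.
  by rewrite -eqz_mod_dvd !modz_nat eqz_nat; apply/eqP.
have d2 : ((N`_2)%N%:Z %| b%:Z - i%:Z)%Z.
  have l2 : (logn 2 N < 2)%N by rewrite ltnNge -pfactor_dvdn.
  rewrite p_part; case lE : (logn 2 N) l2 => [|[|//]] _; first by rewrite expn0 dvd1z.
  have N2 : (2 %| N)%N by rewrite -[2%N]/(2 ^ 1)%N pfactor_dvdn // lE.
  have io : odd i by rewrite -coprime2n coprime_sym (coprime_dvdr N2).
  have bo : odd b by have := congr1 (modn^~ 2) b8; rewrite !modn_dvdm // !modn2; case: odd.
  by rewrite expn1 -eqz_mod_dvd !modz_nat eqz_nat !modn2 bo io.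
have /dvdzP[k kE] : (N%:Z %| b%:Z - i%:Z)%Z.
  rewrite -[X in (X%:Z %| _)%Z]NE PoszM Gauss_dvdz ?d2 //.
  by rewrite /coprimez /gcdz eqz_nat; exact: coprime_partC.
exists b%:Z, k; split=> //; first by rewrite mulrC -kE; ring.
by rewrite modz_nat b8.
Qed.
End TotalMultiplier.

Unset Implicit Arguments.
Set Strict Implicit.
Set Printing Implicit Defensive.

Theorem theorem1p13 (R : realType) (N : nat) (S : forall n : nat, {set 'I_n})
    (F : nat -> nat -> R[i] -> R[i]) (a : nat -> nat -> int)
    (N_gt0 : (0 < N)%N) (L_odd : odd (ell N 1))
    (S_half : forall m : nat,
       m \in proper_divisors N -> half_units (S (mpp N m)))
    (F_def : forall m h : nat,
       m \in proper_divisors N -> (h < ell N m)%N -> is_F S N m h (F m h)) :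
  let L := ell N 1 in
  let g := fun tau : R[i] =>
    \prod_(m <- proper_divisors N) \prod_(0 <= h < ell N m)
      F m h tau ^ a m h in
  modular_unit N g <->
  [/\ integral_cusp_order N g 1 N,
      integral_cusp_order N g 1 1,
      integral_cusp_order N g 1 (N`_(2^'))%N,
      forall i : nat, (1 <= i <= N)%N -> coprime i N ->
        (\sum_(m <- proper_divisors N | (1 < ell N m)%N)
           (psi N i m)%:Z * \sum_(1 <= h < ell N m) h%:Z * a m h
         = 0 %[mod L%:Z])%Z
    & forall p : nat, prime p -> odd p -> (p %| N)%N ->
        (\sum_(m <- proper_divisors N | p.-nat (mpp N m))
           \sum_(0 <= h < ell N m) a m h
         = 0 %[mod 2])%Z].
Proof.
move=> L g.
have N4 := not4 N_gt0 L_odd.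
pose s := [seq (m, h) | m <- proper_divisors N, h <- index_iota 0 (ell N m)].
have sP x : x \in s -> x.1 \in proper_divisors N /\ (x.2 < ell N x.1)%N.
  by case/allpairsPdep => m [h [mD]]; rewrite mem_index_iota => hl ->.
have gE t : g t = \prod_(x <- s) F x.1 x.2 t ^ a x.1 x.2 by rewrite big_allpairs_dep.
have FP x : x \in s -> is_F S N x.1 x.2 (F x.1 x.2) by case/sP; exact: F_def.
have FS x : x \in s -> half_units (S (mpp N x.1)) by case/sP => /S_half.
have g0 t : 0 < complex.Im t -> g t != 0.
  move=> t0; rewrite gE prodf_seq_neq0; apply/allP => x xs /=.
  have [mD hl] := sP x xs; apply: expfz_neq0.
  exact: (F_neq0 N_gt0 mD L_odd hl (FS x xs) (FP x xs) t0).
have gQE (b c d e : int) : b * e - c * d = 1 -> QE (fun t => g (mob b c d e t)).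
  move=> det.
  suff : QE (fun t => \prod_(x <- s) F x.1 x.2 (mob b c d e t) ^ a x.1 x.2).
    by apply: QE_ext => t _; rewrite gE.
  apply: QE_prod => x xs; apply: QE_exp; have [mD hl] := sP x xs.
  exact: (F_QE N_gt0 mD L_odd hl (FS x xs) (FP x xs) det).
have gmul (b c c1 d : int) (chi : nat * nat -> R[i]) : b * d - c * (N%:Z * c1) = 1 ->
    (forall x, x \in s -> forall t, 0 < complex.Im t ->
      F x.1 x.2 (mob b c (N%:Z * c1) d t) = chi x * F x.1 x.2 t) ->
    forall t, 0 < complex.Im t ->
      g (mob b c (N%:Z * c1) d t) = (\prod_(x <- s) chi x ^ a x.1 x.2) * g t.
  move=> det H t t0; rewrite !gE -big_split /=; apply: eq_big_seq => x xs.
  by rewrite H // expfzMl.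
have gmob (b c c1 d : int) : b * d - c * (N%:Z * c1) = 1 -> exists2 chi : R[i], chi != 0 &
    forall t, 0 < complex.Im t -> g (mob b c (N%:Z * c1) d t) = chi * g t.
  move=> det.
  have ex (x : nat * nat) : exists z : R[i], x \in s -> z != 0 /\
      forall t, 0 < complex.Im t -> F x.1 x.2 (mob b c (N%:Z * c1) d t) = z * F x.1 x.2 t.
    have [xs|] := boolP (x \in s); last by exists 0.
    have [mD hl] := sP x xs.
    by have [z z0 Hz] := F_mob N_gt0 mD L_odd hl (FS x xs) (FP x xs) det; exists z.
  have [chi Hchi] := choice ex.
  exists (\prod_(x <- s) chi x ^ a x.1 x.2).
    rewrite prodf_seq_neq0; apply/allP => x xs /=; apply: expfz_neq0.
    by have [] := Hchi x xs.
  by apply: gmul => // x xs; have [] := Hchi x xs.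
have gdiag (b c c1 d e : int) t : b * d - c * (N%:Z * c1) = 1 -> 0 < complex.Im t ->
    ((24 * N)%N%:Z %| c)%Z -> ((24 * N)%N%:Z %| c1)%Z -> (b %% 8 = 1)%Z -> d = 2 * e + 1 ->
    g (mob b c (N%:Z * c1) d t) =
    ph ((Ttot S N a b)%:~R / 2 - (Ytot S N a b d e)%:~R / L%:R) * g t.
  move=> det t0 c24 c124 b8 dE; rewrite -(theta_total R S a N_gt0 L_odd).
  rewrite (gmul _ _ _ _ (fun x => ph (theta R S N x.1 x.2 b d e)) det) //.
    congr (_ * _); rewrite big_allpairs_dep /= (big_morph _ (@phD R) (@ph0 R)).
    apply: eq_bigr => m _; rewrite (big_morph _ (@phD R) (@ph0 R)).
    by apply: eq_bigr => h _; rewrite phMz.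
  move=> x xs w w0; have [mD hl] := sP x xs.
  exact: (F_diag N_gt0 mD L_odd hl (FS x xs) (FP x xs) det w0 c24 c124 b8 dE).
have cusp c (c0 : (0 < c)%N) := @integral_cusp R N g gQE g0 gmob c c0.
have LZ : L%:Z != 0 by rewrite eqz_nat -lt0n L_gt0.
split.
  (* Necessity: the multiplier is trivial on the stabilizers of the cusps and on the
     matrices that are diagonal modulo 24 N. *)
  move=> [[_ gG _] _].
  have invG (b c c1 d : int) : b * d - c * (N%:Z * c1) = 1 -> inv N g b c c1 d.
    move=> det t t0; rewrite -[RHS](gG (mx2 b c (N%:Z * c1) d)) //.
      by rewrite mobiusE !mxE.
    by split; rewrite /SL2Z ?det_mx2 !mxE //= dvdz_mulr.
  have cuspG c : (0 < c)%N -> integral_cusp_order N g 1 c.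
    by move=> c0; have [E det] := cusp c c0; apply/E; exact: invG.
  have triv (b c c1 d e : int) : b * d - c * (N%:Z * c1) = 1 ->
      ((24 * N)%N%:Z %| c)%Z -> ((24 * N)%N%:Z %| c1)%Z -> (b %% 8 = 1)%Z -> d = 2 * e + 1 ->
      (2 %| Ttot S N a b)%Z /\ (L%:Z %| Ytot S N a b d e)%Z.
    move=> det c24 c124 b8 dE; apply/(theta_trivial R S a N_gt0 L_odd).
    have i0 := i_gt0 R; apply: (mulIf (g0 _ i0)); rewrite (mul1r (g _)).
    by rewrite -(gdiag b c c1 d e 'i det i0 c24 c124 b8 dE); exact: invG.
  split; [exact: cuspG|exact: cuspG|by apply: cuspG; rewrite part_gt0| |].
    move=> i _ co; have [b [k [bE b8 bQ]]] := class_lift N_gt0 N4 co.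
    have [c [c1 [d [e [det c24 c124 dE]]]]] := diag_ex bQ b8.
    have [_ Y] := triv _ _ _ _ _ det c24 c124 b8 dE.
    have bN : coprimez b N%:Z by move: bQ; rewrite PoszM coprimezMr => /andP[].
    have bd : (N%:Z %| b * d - 1)%Z by apply/dvdzP; exists (c * c1); rewrite -det; ring.
    apply/eqP; rewrite eqz_mod_dvd subr0.
    by rewrite -(Ytot_psi a N_gt0 L_odd S_half bN bd dE bE).
  (* b is a nonsquare modulo p and 1 modulo the other odd primes dividing N, so only
     the term of p remains in the parity of Ttot. *)
  move=> p pp po pN; have [i [ip nq]] := qres_ex pp po.
  have Q0 : (0 < 24 * N)%N by rewrite muln_gt0.
  have [b [bp b8 bQ b1]] := crt_ex po ip Q0 (dvdn_mull 24 pN) (dvdn_mulr N (isT : 8 %| 24)%N).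
  have b8' : (b%:Z %% 8 = 1)%Z by rewrite modz_nat b8.
  have [c [c1 [d [e [det c24 c124 dE]]]]] := @diag_ex N b%:Z bQ b8'.
  have [T _] := triv _ _ _ _ _ det c24 c124 b8' dE.
  have bN : coprimez b%:Z N%:Z by move: (bQ : coprimez b%:Z (24 * N)%N%:Z); rewrite PoszM coprimezMr => /andP[].
  have := parity_Ttot a N_gt0 L_odd S_half bN b8'; rewrite rpredBl // => H.
  apply/eqP; rewrite eqz_mod_dvd subr0; move: H.
  rewrite -big_filter (bigD1_seq p) ?filter_uniq ?primes_uniq //=; last first.
    by rewrite mem_filter po mem_primes pp N_gt0.
  rewrite (qres_mod pp bp) nq mul1r [X in _ + X]big1_seq ?addr0 // => q /andP[qp].
  rewrite mem_filter mem_primes => /and4P[qo qpr _ qN].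
  have -> : qres q b%:Z by rewrite (qres_mod (i := 1%N) qpr) ?qres1 // b1 ?dvdn_mull // dvdn_prime2.
  by rewrite mul0r.
(* Sufficiency: g is invariant under T and U by the cusps, which reduces invariance
   to the diagonal matrices modulo 24 N. *)
move=> [c1 c2 _ c4 c5].
have [gT gU] : (forall t, 0 < complex.Im t -> g (t + 1) = g t) /\ inv N g 1 0 1 1.
  apply: (cusps_generators gmob).
    have [E _] := cusp N N_gt0; move/E: c1.
    have -> : gcdn (N ^ 2) N = N by rewrite gcdnC; apply/gcdn_idPl; rewrite expnS dvdn_mulr.
    by rewrite divnn N_gt0 muln1 expnS expn1 mulnK.
  have [E _] := cusp 1%N isT; move/E: c2.
  by rewrite exp1n gcd1n !divn1 mul1n.
have invG (b c c3 d : int) : b * d - c * (N%:Z * c3) = 1 -> inv N g b c c3 d.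
  move: b c c3 d; apply: (inv_all N_gt0 N4 gT gU) => b c c3 d det c24 c324 b8 bQ t t0.
  have bN : coprimez b N%:Z by move: bQ; rewrite PoszM coprimezMr => /andP[].
  have [e dE] : exists e, d = 2 * e + 1.
    exists ((d - 1) %/ 2)%Z; have bE := divz_eq b 8; rewrite b8 in bE.
    have /dvdzP[c' cE] := c24.
    have : 1 = 2 * (4 * (b %/ 8)%Z * d - 12 * c' * N%:Z * (N%:Z * c3)) + d.
      by rewrite -[LHS]det [X in X * d]bE cE PoszM; ring.
    by move: (_ - _) => x; lia.
  rewrite (gdiag _ _ _ _ e) //.
  suff -> : ph ((Ttot S N a b)%:~R / 2 - (Ytot S N a b d e)%:~R / L%:R) = 1 :> R[i] by rewrite mul1r.
  apply/(theta_trivial R S a N_gt0 L_odd); split.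
    rewrite -[Ttot _ _ _ _](subrK (\sum_(p <- primes N | odd p) (~~ qres p b)%:Z *
      \sum_(m <- proper_divisors N | p.-nat (mpp N m)) Asum N a m)).
    apply: rpredD; first exact: parity_Ttot.
    rewrite big_seq_cond; apply: rpred_sum => p /andP[]; rewrite mem_primes => /and3P[pp _ pN] po.
    by rewrite dvdz_mull //; have := c5 p pp po pN; move/eqP; rewrite eqz_mod_dvd subr0.
  have bd : (N%:Z %| b * d - 1)%Z by apply/dvdzP; exists (c * c3); rewrite -det; ring.
  (* The representative of b modulo N between 1 and N, hence the shift by 1. *)
  pose i := (`|((b - 1) %% N%:Z)%Z|%N).+1.
  have iE : b = i%:Z + N%:Z * ((b - 1) %/ N%:Z)%Z.
    rewrite /i -addn1 PoszD gez0_abs ?modz_ge0 ?eqz_nat -?lt0n //.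
    have := divz_eq (b - 1) N%:Z; move: (_ %/ _)%Z (_ %% _)%Z => x y E.
    by rewrite -[LHS](subrK 1) E; ring.
  have iN : (1 <= i <= N)%N.
    by rewrite /i /= -ltz_nat gez0_abs ?ltz_pmod ?modz_ge0 ?eqz_nat -?lt0n // ltz_nat.
  have ico : coprime i N.
    have : coprimez i%:Z N%:Z; last by [].
    by rewrite coprimez_sym /coprimez -(gcdzMDl ((b - 1) %/ N%:Z)%Z) mulrC addrC -iE -/(coprimez _ _) coprimez_sym.
  rewrite (Ytot_psi a N_gt0 L_odd S_half bN bd dE iE).
  by have := c4 i iN ico; move/eqP; rewrite eqz_mod_dvd subr0.
have holo t : 0 < complex.Im t -> holomorphic_at g t.
  move=> t0; apply: (jet2_holomorphic t0) => w wt; have w0 := half_plane_open t0 wt.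
  apply: (@jet2_ext R (fun t => \prod_(x <- s) F x.1 x.2 t ^ a x.1 x.2) _ w 1 ltr01) => [v _|].
    by rewrite gE.
  suff H r : all (fun x => x \in s) r ->
      jet2 (fun t => \prod_(x <- r) F x.1 x.2 t ^ a x.1 x.2) w.
    by apply: H; apply/allP.
  elim: r => [|x r IH] /=.
    by move=> _; apply: (@jet2_ext R (fun=> 1) _ w 1 ltr01) => [v _|]; [rewrite big_nil|exact: jet2_cst].
  case/andP => xs rs; have [mD hl] := sP x xs.
  apply: (@jet2_ext R (fun t => F x.1 x.2 t ^ a x.1 x.2 * \prod_(x <- r) F x.1 x.2 t ^ a x.1 x.2) _ w 1 ltr01) => [v _|].
    by rewrite big_cons.
  apply: jet2M; last exact: IH.
  have J := F_jet2 N_gt0 mD L_odd hl (FP x xs) w0.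
  have J0 := F_neq0 N_gt0 mD L_odd hl (FS x xs) (FP x xs) w0.
  have JX n : jet2 (fun t => F x.1 x.2 t ^+ n) w.
    elim: n => [|n IHn]; first exact: jet2_cst.
    apply: (@jet2_ext R (fun t => F x.1 x.2 t * F x.1 x.2 t ^+ n) _ w 1 ltr01) => [v _|].
      by rewrite exprS.
    exact: jet2M.
  case: (a x.1 x.2) => n; first exact: JX.
  by apply: jet2V (JX n.+1); rewrite expf_neq0.
split; last by move=> t t0; split; [exact: holo|exact: g0].
split.
- move=> t t0; exists 0%N, g; split; first exact: holo.
  by apply: nearW => w; rewrite expr0 divr1.
- move=> gam t [dg /dvdzP[c3 cE]] t0; rewrite mobiusE cE mulrC.
  by apply: invG => //; move: dg; rewrite /SL2Z det_mx2 cE (mulrC c3).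
move=> gam dg; apply: QE_meromorphic; apply: gQE.
by rewrite -[RHS]dg det_mx2.
Qed.
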